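(* Let $k$ be an algebraically closed field, let $n \ge 1$, and let $\Delta = \{\Delta_1, \ldots, \Delta_m\}$ be a collection of $m$ partitions whose sizes add up to $n$, such that $X(\Delta)$ is as defined below. Let $\Gamma = \Sigma\Delta$, let $\Gamma'$ be the transpose partition of $\Gamma$, written $d_1 \ge d_2 \ge \cdots$. Then: (1) the Zariski closure of $S(\Gamma')$ contains $X(\Delta)$; (2) the Zariski closure of $X(\Delta)$ contains $U(\Gamma)$; (3) if $A \in S(\Gamma') \cup X(\Delta) \cup U(\Gamma)$, then the centralizer $C(A)$ of $A$ in $M_n(k)$ satisfies $\dim C(A) = \sum_i d_i^2$; (4) for each $1 \le d < n$, the dimension of $\mathcal{G}_d^A$ is the same for all $A \in S(\Gamma') \cup X(\Delta) \cup U(\Gamma)$.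
   Context: For $A \in M_n(k)$ with $m$ distinct eigenvalues, $\Delta(A)$ is the collection of $m$ partitions $\Delta_i$, where $\Delta_i$ is the partition given by the sizes of the Jordan blocks of $A$ on its $i$-th generalized eigenspace. For a collection $\Delta$ of $m$ partitions with sizes summing to $n$, $X(\Delta) = \{A \in M_n(k) : \Delta(A) = \Delta\}$. $\Sigma\Delta = \sum_i \Delta_i$, where partitions are added as row vectors with nonincreasing entries (padding with zeros to equal length), i.e. componentwise. For a partition $\Gamma$ of $n$, $U(\Gamma)$ is the set of matrices in $M_n(k)$ with a single eigenvalue whose Jordan block sizes are given by $\Gamma$, and $S(\Gamma)$ is the set of semisimple matrices in $M_n(k)$ whose eigenspace dimensions are given by $\Gamma$. $\mathcal{G}_d$ is the Grassmannian of $d$-dimensional subspaces of $k^n$ and $\mathcal{G}_d^A = \{W \in \mathcal{G}_d : AW \subseteq W\}$. *)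

(* Defs.v *)
From HB Require Import structures.
From mathcomp Require Import all_boot all_order all_algebra.
Set Implicit Arguments. Unset Strict Implicit. Unset Printing Implicit Defensive.
Import Order.TTheory GRing.Theory Num.Theory.
Local Open Scope ring_scope.

Section Defs.
Variable k : fieldType.

Definition is_partition (p : seq nat) : bool :=
  sorted geq p && all (fun x => 0 < x)%N p.

Fixpoint psum (p q : seq nat) : seq nat :=
  match p, q with
  | [::], _ => q
  | _, [::] => p
  | a :: p', b :: q' => (a + b)%N :: psum p' q'
  end.

Definition ptranspose (p : seq nat) : seq nat :=
  [seq count (fun x => j < x)%N p | j <- iota 0 (foldr maxn 0%N p)].

Definition SigmaD (m : nat) (Delta : 'I_m -> seq nat) : seq nat :=
  foldr psum [::] [seq Delta i | i <- enum 'I_m].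

(* jordan_mx bl : the block diagonal matrix whose consecutive diagonal blocks
   are Jordan blocks J_s(lambda) (lambda on the diagonal, 1 on the
   superdiagonal), for (lambda, s) in bl, in order. *)
Definition jblk (bl : seq (k * nat)) (i : nat) : nat :=
  find (fun t => i < sumn (take t.+1 (map snd bl)))%N (iota 0 (size bl)).

Definition jordan_mx n (bl : seq (k * nat)) : 'M[k]_n :=
  \matrix_(i < n, j < n)
    if i == j then (nth (0, 0%N) bl (jblk bl i)).1
    else if (j == i.+1 :> nat) && (jblk bl i == jblk bl j) then 1 else 0.

Definition similar n (A B : 'M[k]_n) : Prop :=
  exists2 P : 'M[k]_n, P \in unitmx & A = invmx P *m B *m P.

Definition Xset n m (Delta : 'I_m -> seq nat) (A : 'M[k]_n) : Prop :=
  exists lam : 'I_m -> k, injective lam /\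
    similar A (jordan_mx n (flatten [seq [seq (lam i, s) | s <- Delta i]
                                    | i <- enum 'I_m])).

Definition Uset n (Gamma : seq nat) (A : 'M[k]_n) : Prop :=
  exists lam : k, similar A (jordan_mx n [seq (lam, s) | s <- Gamma]).

(* S(Gamma): semisimple, eigenspace dimensions given by Gamma (distinct
   eigenvalues lam i with multiplicity nth 0 Gamma i). *)
Definition Sset n (Gamma : seq nat) (A : 'M[k]_n) : Prop :=
  exists lam : nat -> k,
    (forall i j, (i < size Gamma)%N -> (j < size Gamma)%N ->
       lam i = lam j -> i = j) /\
    similar A (jordan_mx n (flatten [seq nseq (nth 0%N Gamma i) (lam i, 1%N)
                                    | i <- iota 0 (size Gamma)])).

Inductive polyfun (p q : nat) : ('M[k]_(p, q) -> k) -> Prop :=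
| pf_const (c : k) : polyfun (fun _ => c)
| pf_coord (i : 'I_p) (j : 'I_q) : polyfun (fun A => A i j)
| pf_add f g : polyfun f -> polyfun g -> polyfun (fun A => f A + g A)
| pf_mul f g : polyfun f -> polyfun g -> polyfun (fun A => f A * g A).

Definition zclosure p q (S : 'M[k]_(p, q) -> Prop) : 'M[k]_(p, q) -> Prop :=
  fun A => forall f, polyfun f -> (forall B, S B -> f B = 0) -> f A = 0.

Definition centralizer_dim n (A : 'M[k]_n) : nat :=
  \rank (kermx (lin_mx (fun X : 'M[k]_n => X *m A - A *m X))).

(* A d-dimensional subspace W of k^n is represented by its canonical
   row-space matrix <<B>>%MS (B : 'M_(d,n) of rank d); column vectors of k^n
   correspond to rows via transposition. *)
Definition Grpt n d (W : 'M[k]_n) : Prop :=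
  exists B : 'M[k]_(d, n), row_free B /\ W = (<<B>>)%MS.

(* G_d^A = {W in G_d | A W <= W}  (in row convention: W *m A^T <= W) *)
Definition GrA n d (A : 'M[k]_n) (W : 'M[k]_n) : Prop :=
  Grpt d W /\ (W *m A^T <= W)%MS.

(* Zariski closed subsets of G_d: quotient topology from the Stiefel variety
   {B : 'M_(d,n) | rank B = d} (an open subset of affine space). *)
Definition Grclosed n d (Z : 'M[k]_n -> Prop) : Prop :=
  exists F : ('M[k]_(d, n) -> k) -> Prop,
    (forall f, F f -> polyfun f) /\
    forall B : 'M[k]_(d, n), row_free B ->
      (Z (<<B>>)%MS <-> forall f, F f -> f B = 0).

Definition relclosed n d (Y T : 'M[k]_n -> Prop) : Prop :=
  exists Z, Grclosed d Z /\ forall W, T W <-> (Y W /\ Z W).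

Definition irreducible n d (T : 'M[k]_n -> Prop) : Prop :=
  (exists W, T W) /\
  forall Z1 Z2, Grclosed d Z1 -> Grclosed d Z2 ->
    (forall W, T W -> Z1 W \/ Z2 W) ->
    (forall W, T W -> Z1 W) \/ (forall W, T W -> Z2 W).

Definition irr_chain n d (Y : 'M[k]_n -> Prop) (c : nat -> 'M[k]_n -> Prop)
    (r : nat) : Prop :=
  (forall i, (i <= r)%N -> relclosed d Y (c i) /\ irreducible d (c i)) /\
  (forall i, (i < r)%N ->
     (forall W, c i W -> c i.+1 W) /\ exists W, c i.+1 W /\ ~ c i W).

Definition Grdim n d (Y : 'M[k]_n -> Prop) (r : nat) : Prop :=
  (exists c, irr_chain d Y c r) /\ ~ (exists c, irr_chain d Y c r.+1).

End Defs.

(* Main.v *)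
Require Import Defs.
From HB Require Import structures.
From mathcomp Require Import all_boot all_order all_algebra.
From mathcomp Require Import perm zify ring.
From Stdlib Require Import Classical ClassicalEpsilon FunctionalExtensionality.
Set Implicit Arguments. Unset Strict Implicit. Unset Printing Implicit Defensive.
Import Order.TTheory GRing.Theory Num.Theory.
Local Open Scope ring_scope.

(** Let [d_(mu,t)] be the number of Jordan blocks of [A] of eigenvalue [mu] and
    size larger than [t].  For the three families of the theorem the positive
    [d_(mu,t)] are, up to order, the parts of [Gamma'], so it suffices to express
    both invariants of a matrix in Jordan form through them.

    Stable subspaces: the coordinates of [k^n] are ordered by their level in the
    Jordan chains.  The pivots of a stable subspace then form initial segments of
    the chains, and the subspace is spanned by the shifts of one reduced vector
    per chain, whose free coordinates are arbitrary.  Hence the stable subspaces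
    with given pivots, [e_(mu,t)] of them at the level [(mu, t)], are covered by an
    affine space of dimension [sum e (d - e)], and the dimension is the maximum
    [r] of this sum over all [e <= d] with [sum e] prescribed.  By an exchange
    argument the maximum is reached for an [e] that decreases along the chains,
    which some cell realizes; the closures of a coordinate flag in that cell form
    a chain of length [r].  Conversely, lift a chain of irreducible closed sets to
    the Stiefel variety, extend it downwards through one orbit, and pick [f_i]
    vanishing on the [i]-th set but not on the next: the monomials in the [f_i]
    are linearly independent on the largest set, and counting them in the image
    of a polynomial map bounds the length of the chain.

    Closures: a block diagonal matrix whose blocks are bidiagonal is a sum of
    cyclic modules, so its Jordan form is read off the multiplicities on the
    diagonal of each block; letting the diagonal entries collide along a line
    gives both degenerations. *)

(** * Polynomial functions *)

(** Why [Gamma']: the numbers of blocks of one eigenvalue larger than 0, 1, 2, ... are the columns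
    of its partition, and adding partitions as row vectors places their diagrams side by side, so
    the transpose of the sum is the sorted union of all the columns. The Stiefel fibres are [GL_d]
    orbits, hence [d * d] extra steps below a lifted chain and [d * d] extra parameters in every
    cover. For a chain of [l] steps and [D] parameters, exponents up to [N] give [(N + 1) ^ l]
    independent products, while their pullbacks live in a space whose dimension grows only like
    [N ^ D]; thus [l <= D]. The obstacle is that an actual cell can be smaller than the affine space
    covering it: a free coordinate may come after its pivot in the order, and then has to vanish.
    The upper bound tolerates this excess; the lower bound needs a pivot set without it. The two
    bounds meet because the maximum of the excessive count is already attained at such a set. *)

Section PolynomialFunctions.
Variable k : closedFieldType.

Definition subalgebra (X : Type) (S : (X -> k) -> Prop) : Prop :=
  [/\ forall c, S (fun _ => c),
      forall f g, S f -> S g -> S (fun x => f x + g x)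
    & forall f g, S f -> S g -> S (fun x => f x * g x)].

Lemma polyfun_subalgebra p q : subalgebra (@polyfun k p q).
Proof. by split; [exact: pf_const|exact: pf_add|exact: pf_mul]. Qed.

(** The only induction on [polyfun]: choosing [S] as the polynomials in one variable, the polynomial
    maps in given parameters, or [polyfun] on another space gives every substitution used below. *)
Lemma polyfun_comp X (S : (X -> k) -> Prop) p q (f : 'M[k]_(p, q) -> k)
    (Phi : X -> 'M[k]_(p, q)) :
  subalgebra S -> (forall i j, S (fun x => Phi x i j)) -> polyfun f ->
  S (fun x => f (Phi x)).
Proof.
case=> Sc Sa Sm Se; elim=> [c|i j|{}f g _ IHf _ IHg|{}f g _ IHf _ IHg] //.
- exact: Sa.
- exact: Sm.
Qed.

Lemma subalgebra_sum X (S : (X -> k) -> Prop) I (r : seq I) (P : pred I)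
    (F : I -> X -> k) :
  subalgebra S -> (forall i, P i -> S (F i)) ->
  S (fun x => \sum_(i <- r | P i) F i x).
Proof.
case=> Sc Sa _ SF; elim: r => [|i r IHr].
  by have := Sc 0; congr S; apply: functional_extensionality => x; rewrite big_nil.
have [Pi|nPi] := boolP (P i).
  have := Sa _ _ (SF i Pi) IHr; congr S; apply: functional_extensionality => x.
  by rewrite big_cons Pi.
move: IHr; congr S; apply: functional_extensionality => x.
by rewrite big_cons (negbTE nPi).
Qed.

Lemma subalgebra_prod X (S : (X -> k) -> Prop) I (r : seq I) (P : pred I)
    (F : I -> X -> k) :
  subalgebra S -> (forall i, P i -> S (F i)) ->
  S (fun x => \prod_(i <- r | P i) F i x).
Proof.
case=> Sc _ Sm SF; elim: r => [|i r IHr].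
  by have := Sc 1; congr S; apply: functional_extensionality => x; rewrite big_nil.
have [Pi|nPi] := boolP (P i).
  have := Sm _ _ (SF i Pi) IHr; congr S; apply: functional_extensionality => x.
  by rewrite big_cons Pi.
move: IHr; congr S; apply: functional_extensionality => x.
by rewrite big_cons (negbTE nPi).
Qed.

Lemma subalgebra_exp X (S : (X -> k) -> Prop) (f : X -> k) e :
  subalgebra S -> S f -> S (fun x => f x ^+ e).
Proof.
move=> SS Sf; have := subalgebra_prod (index_iota 0 e) (P := predT)
  (F := fun _ => f) SS (fun _ _ => Sf).
congr S; apply: functional_extensionality => x.
by rewrite prodr_const_nat subn0.
Qed.

Lemma subalgebra_mulmx X (S : (X -> k) -> Prop) p q r
    (F : X -> 'M[k]_(p, q)) (G : X -> 'M[k]_(q, r)) i j :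
  subalgebra S -> (forall i j, S (fun x => F x i j)) ->
  (forall i j, S (fun x => G x i j)) -> S (fun x => (F x *m G x) i j).
Proof.
move=> SS SF SG; have [_ _ Sm] := SS.
have := subalgebra_sum (index_enum 'I_q) (P := predT)
  (F := fun l x => F x i l * G x l j) SS (fun l _ => Sm _ _ (SF i l) (SG l j)).
by congr S; apply: functional_extensionality => x; rewrite mxE.
Qed.

Lemma subalgebra_det X (S : (X -> k) -> Prop) p (F : X -> 'M[k]_p) :
  subalgebra S -> (forall i j, S (fun x => F x i j)) -> S (fun x => \det (F x)).
Proof.
move=> SS SF; have [Sc _ Sm] := SS; rewrite /determinant.
apply: (subalgebra_sum (F := fun (s : 'S_p) x =>
  (-1) ^+ s * \prod_i F x i (s i)) _ SS) => s _.
apply: Sm; first exact: Sc.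
exact: (subalgebra_prod _ SS).
Qed.

Lemma subalgebra_adj X (S : (X -> k) -> Prop) p (F : X -> 'M[k]_p) i j :
  subalgebra S -> (forall i j, S (fun x => F x i j)) ->
  S (fun x => (\adj (F x)) i j).
Proof.
move=> SS SF; have [Sc _ Sm] := SS.
suff: S (fun x => (-1) ^+ (j + i) * \det (row' j (col' i (F x)))).
  by congr S; apply: functional_extensionality => x; rewrite mxE.
apply: Sm; first exact: Sc.
apply: subalgebra_det => // a b.
have := SF (lift j a) (lift i b).
by congr S; apply: functional_extensionality => x; rewrite !mxE.
Qed.

Lemma horner_subalgebra :
  subalgebra (fun f : k -> k => exists p : {poly k}, forall t, f t = p.[t]).
Proof.
split=> [c|f g [p Ef] [q Eg]|f g [p Ef] [q Eg]].
- by exists c%:P => t; rewrite hornerC.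
- by exists (p + q) => t; rewrite hornerD Ef Eg.
- by exists (p * q) => t; rewrite hornerM Ef Eg.
Qed.

(* If every point were a root of [p], then [p * 'X + 1] would have none. *)
Lemma exists_nonroot (p : {poly k}) : p != 0 -> exists t, p.[t] != 0.
Proof.
move=> p0; apply: NNPP => noroot.
have p_eq0 t : p.[t] = 0.
  by apply/eqP/negPn/negP => pt; apply: noroot; exists t.
have /closed_rootP [t] : size (p * 'X + 1%:P) != 1%N.
  by rewrite size_MXaddC (negbTE p0) /= eqSS size_poly_eq0.
by rewrite /root !hornerE p_eq0 mul0r add0r oner_eq0.
Qed.

Lemma horner_eq0 (p : {poly k}) : (forall t, p.[t] = 0) -> p = 0.
Proof.
move=> p0; apply: contraTeq isT => /exists_nonroot [t].
by rewrite p0 eqxx.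
Qed.

Lemma polyfun_line p q (f : 'M[k]_(p, q) -> k) x y : polyfun f ->
  exists P : {poly k}, forall t, f (x + t *: (y - x)) = P.[t].
Proof.
move=> pf; apply: (polyfun_comp (Phi := fun t => x + t *: (y - x))
  horner_subalgebra _ pf) => i j.
exists ((x i j)%:P + 'X * (y i j - x i j)%:P) => t.
by rewrite !hornerE !mxE.
Qed.

Definition affine_set p q (S : 'M[k]_(p, q) -> Prop) : Prop :=
  forall x y t, S x -> S y -> S (x + t *: (y - x)).

(** On the line from [x] to [y] both functions are nonzero one-variable polynomials, the first at 0
    and the second at 1, so their product has a nonroot. *)
Lemma affine_nonvanishing p q (S : 'M[k]_(p, q) -> Prop) f g x y :
  affine_set S -> polyfun f -> polyfun g -> S x -> S y ->
  f x != 0 -> g y != 0 -> exists z, [/\ S z, f z != 0 & g z != 0].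
Proof.
move=> aS pf pg Sx Sy fx gy.
have [P EP] := polyfun_line x y pf; have [Q EQ] := polyfun_line x y pg.
have P0 : P != 0.
  by apply: contraNneq fx => P0; rewrite -[x]addr0 -(scale0r (y - x)) EP P0 horner0.
have Q0 : Q != 0.
  apply: contraNneq gy => Q0.
  by rewrite (_ : y = x + 1 *: (y - x)) ?EQ ?Q0 ?horner0 // scale1r addrC subrK.
have [t] := exists_nonroot (mulf_neq0 P0 Q0).
rewrite hornerM mulf_eq0 negb_or => /andP [Pt Qt].
by exists (x + t *: (y - x)); rewrite EP EQ; split=> //; apply: aS.
Qed.

Lemma affine_setT p q : affine_set (fun _ : 'M[k]_(p, q) => True).
Proof. by []. Qed.

(** Irreducibility read on functions: the ideal of [S] is prime, or the unit ideal when [S] is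
    empty. *)
Definition vanishing_prime p q (S : 'M[k]_(p, q) -> Prop) : Prop :=
  forall f g, polyfun f -> polyfun g -> (forall x, S x -> f x * g x = 0) ->
  (forall x, S x -> f x = 0) \/ (forall x, S x -> g x = 0).

Lemma not_vanishing p q (S : 'M[k]_(p, q) -> Prop) (f : 'M[k]_(p, q) -> k) :
  ~ (forall x, S x -> f x = 0) -> exists2 x, S x & f x != 0.
Proof.
move=> nf; apply: NNPP => nex; apply: nf => x Sx.
by apply/eqP/negPn/negP => fx; apply: nex; exists x.
Qed.

Lemma affine_vanishing_prime p q (S : 'M[k]_(p, q) -> Prop) :
  affine_set S -> vanishing_prime S.
Proof.
move=> aS f g pf pg fg0; apply: NNPP => /not_or_and [nf ng].
have [x Sx fx] := not_vanishing nf; have [y Sy gy] := not_vanishing ng.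
have [z [Sz fz gz]] := affine_nonvanishing aS pf pg Sx Sy fx gy.
by have /eqP := fg0 z Sz; rewrite mulf_eq0 (negbTE fz) (negbTE gz).
Qed.

Lemma unitmx_dense p (f : 'M[k]_p -> k) : polyfun f ->
  (forall u, u \in unitmx -> f u = 0) -> forall u, f u = 0.
Proof.
move=> pf f0 u; apply/eqP/negPn/negP => fu.
have pdet : polyfun (fun v : 'M[k]_p => \det v).
  by apply: subalgebra_det; [exact: polyfun_subalgebra|exact: pf_coord].
have [|z [_ fz dz]] := affine_nonvanishing (y := 1%:M) (@affine_setT p p)
  pf pdet I I fu; first by rewrite det1 oner_neq0.
by move: fz; rewrite f0 ?eqxx // unitmxE unitfE.
Qed.

End PolynomialFunctions.

(** * Chains of irreducible sets in affine space *)

Section LinearIndependence.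
Variable k : closedFieldType.

Definition indep_on (X : Type) (S : X -> Prop) (I : finType) (F : I -> X -> k) :=
  forall c : I -> k, (forall x, S x -> \sum_i c i * F i x = 0) ->
  forall i, c i = 0.

(** With more functions than spanning ones, the coefficient matrix has a nonzero left kernel vector,
    which is a linear relation. *)
Lemma indep_on_card X (S : X -> Prop) (I J : finType) (F : I -> X -> k)
    (G : J -> X -> k) (a : I -> J -> k) :
  indep_on S F -> (forall i x, S x -> F i x = \sum_j a i j * G j x) ->
  (#|I| <= #|J|)%N.
Proof.
move=> Find EF; rewrite leqNgt; apply/negP => ltJI.
pose M : 'M[k]_(#|I|, #|J|) := \matrix_(i, j) a (enum_val i) (enum_val j).
have /rowV0Pn [u /sub_kermxP uM0] : kermx M != 0.
  rewrite -mxrank_eq0 mxrank_ker subn_eq0 -ltnNge.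
  exact: leq_ltn_trans (rank_leq_col M) ltJI.
case/negP; apply/eqP/rowP => i; rewrite mxE.
have := Find (fun i => u 0 (enum_rank i)) _ (enum_val i); rewrite enum_valK; apply.
move=> x Sx; under eq_bigr do rewrite EF // mulr_sumr.
rewrite exchange_big /= big1 // => j _.
under eq_bigr do rewrite mulrA; rewrite -mulr_suml.
have /rowP/(_ (enum_rank j)) := uM0; rewrite !mxE => uM0j.
rewrite (_ : \sum_i _ = 0) ?mul0r // -[RHS]uM0j.
rewrite (reindex (@enum_val I predT)) /=; last first.
  by exists enum_rank => y _; rewrite ?enum_valK ?enum_rankK.
by apply: eq_bigr => l _; rewrite !mxE enum_valK enum_rankK.
Qed.

End LinearIndependence.

(** * Polynomial maps and their degrees *)

Section MonomialExpansions.
Variables (k : closedFieldType) (J : finType).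
Implicit Type x : J -> k.

Definition monomial (b : J -> nat) x : k := \prod_j x j ^+ b j.

(* The degree is bounded variable by variable. *)
Definition deg_le (e : nat) (g : (J -> k) -> k) : Prop :=
  exists2 s : seq (k * {ffun J -> nat}),
    all (fun p : k * {ffun J -> nat} => [forall j, p.2 j <= e]%N) s &
    forall x, g x = \sum_(p <- s) p.1 * monomial p.2 x.

Definition polynomial_map (g : (J -> k) -> k) : Prop := exists e, deg_le e g.

Lemma deg_leW e e' g : (e <= e')%N -> deg_le e g -> deg_le e' g.
Proof.
move=> le_e [s /allP sP Eg]; exists s => //; apply/allP => p /sP /forallP pe.
by apply/forallP => j; apply: leq_trans (pe j) le_e.
Qed.

Lemma deg_le_const e c : deg_le e (fun _ => c).
Proof.
exists [:: (c, [ffun=> 0%N])] => /=.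
  by rewrite andbT; apply/forallP => j; rewrite ffunE.
by move=> x; rewrite big_seq1 /monomial big1 ?mulr1 // => j _; rewrite ffunE.
Qed.

Lemma deg_le_coord j0 : deg_le 1 (fun x => x j0).
Proof.
exists [:: (1, [ffun j => (j == j0 : nat)])] => /=.
  by rewrite andbT; apply/forallP => j; rewrite ffunE; case: (j == j0).
move=> x; rewrite big_seq1 /monomial mul1r (bigD1 j0) //= big1 => [|j jj0].
  by rewrite ffunE eqxx expr1 mulr1.
by rewrite ffunE (negbTE jj0).
Qed.

Lemma deg_le_add e f g :
  deg_le e f -> deg_le e g -> deg_le e (fun x => f x + g x).
Proof.
move=> [s sP Ef] [s' s'P Eg]; exists (s ++ s'); first by rewrite all_cat sP.
by move=> x; rewrite big_cat /= Ef Eg.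
Qed.

Lemma deg_le_mul e e' f g :
  deg_le e f -> deg_le e' g -> deg_le (e + e') (fun x => f x * g x).
Proof.
move=> [s /allP sP Ef] [s' /allP s'P Eg].
pose pair_mul (p p' : k * {ffun J -> nat}) :=
  (p.1 * p'.1, [ffun j => (p.2 j + p'.2 j)%N]).
exists [seq pair_mul p p' | p <- s, p' <- s'].
  apply/allP => _ /allpairsP [[p p'] /= [/sP /forallP ps /s'P /forallP ps' ->]].
  by apply/forallP => j; rewrite ffunE leq_add.
move=> x; rewrite Ef Eg big_allpairs_dep mulr_suml; apply: eq_bigr => p _.
rewrite mulr_sumr; apply: eq_bigr => p' _ /=.
rewrite mulrACA; congr (_ * _); rewrite /monomial -big_split /=.
by apply: eq_bigr => j _; rewrite ffunE exprD.
Qed.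

Lemma polynomial_map_subalgebra : subalgebra polynomial_map.
Proof.
split=> [c|f g [e ef] [e' eg]|f g [e ef] [e' eg]].
- by exists 0%N; apply: deg_le_const.
- exists (maxn e e'); apply: deg_le_add.
    exact: deg_leW (leq_maxl _ _) ef.
  exact: deg_leW (leq_maxr _ _) eg.
- by exists (e + e')%N; apply: deg_le_mul.
Qed.

Lemma deg_le_exp e f a : deg_le e f -> deg_le (a * e) (fun x => f x ^+ a).
Proof.
move=> ef; elim: a => [|a IHa]; first exact: deg_le_const.
have := deg_le_mul ef IHa; rewrite mulSn; congr deg_le.
by apply: functional_extensionality => x; rewrite exprS.
Qed.

Lemma deg_le_prod e l (F : nat -> (J -> k) -> k) :
  (forall i, (i < l)%N -> deg_le e (F i)) ->
  deg_le (l * e) (fun x => \prod_(i < l) F i x).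
Proof.
elim: l => [|l IHl] eF.
  have := deg_le_const (0 * e) 1; congr deg_le.
  by apply: functional_extensionality => x; rewrite big_ord0.
have := deg_le_mul (eF l (ltnSn l)) (IHl (fun i il => eF i (ltnW il))).
rewrite mulSn; congr deg_le; apply: functional_extensionality => x.
by rewrite big_ord_recr /= mulrC.
Qed.

(** A separate bound for each variable turns the exponents into a finite function type, so the
    spanning family has exactly [e.+1 ^ #|J|] members. *)
Lemma deg_le_span e g : deg_le e g ->
  exists a : {ffun J -> 'I_e.+1} -> k,
    forall x, g x = \sum_b a b * monomial (fun j => b j) x.
Proof.
move=> [s sP Eg].
pose trunc (b : {ffun J -> nat}) : {ffun J -> 'I_e.+1} := [ffun j => inord (b j)].
exists (fun b => \sum_(p <- s | trunc p.2 == b) p.1) => x; rewrite Eg.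
under [RHS]eq_bigr do rewrite mulr_suml big_mkcond.
rewrite exchange_big /= [LHS]big_seq [RHS]big_seq; apply: eq_bigr => p ps.
rewrite (bigD1 (trunc p.2)) //= eqxx big1 ?addr0 => [|b /negbTE]; last first.
  by rewrite eq_sym => ->.
congr (_ * _); apply: eq_bigr => j _; rewrite ffunE inordK //.
by have /allP/(_ _ ps)/forallP := sP; apply.
Qed.

End MonomialExpansions.

(** * The length of a chain inside the image of polynomial maps *)

Section ChainBound.
Variables (k : closedFieldType) (p q : nat).
Implicit Types S : 'M[k]_(p, q) -> Prop.

(* A vanishing combination of the [f ^ a * F i] restricts to one of the [F i]
   where [f] vanishes; once the terms with [a = 0] are gone, primality allows
   to divide by [f]. *)
Lemma indep_on_extend S S' f (I : finType) (F : I -> 'M[k]_(p, q) -> k) N :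
  vanishing_prime S' ->
  (forall h, polyfun h -> (forall x, S' x -> h x = 0) -> forall x, S x -> h x = 0) ->
  polyfun f -> (forall x, S x -> f x = 0) -> (exists2 x, S' x & f x != 0) ->
  (forall i, polyfun (F i)) -> indep_on S F ->
  indep_on S' (fun (ai : 'I_N * I) x => f x ^+ ai.1 * F ai.2 x).
Proof.
move=> primeS' SS' pf f0 [y S'y fy] pF indF c c0.
have alg := @polyfun_subalgebra k p q.
(* Extending the coefficients by zero to all natural exponents lets the induction shift the exponent
   by one. *)
pose b a i := if insub a is Some a' then c (a', i) else 0.
have b0 M : forall b : nat -> I -> k, (forall x, S' x ->
    \sum_(a < M) \sum_i b a i * (f x ^+ a * F i x) = 0) ->
    forall a i, (a < M)%N -> b a i = 0.
  elim: M => // M IHM {}b bM.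
  have b00 i : b 0%N i = 0.
    move: i; apply: indF => x Sx.
    rewrite -[RHS](SS' _ _ bM x Sx); last first.
      apply: (subalgebra_sum (F := fun (a : 'I_M.+1) x => \sum_i b a i * (f x ^+ a * F i x)) _ alg) => a _.
      apply: (subalgebra_sum (F := fun i x => b a i * (f x ^+ a * F i x)) _ alg) => i _.
      by apply: pf_mul; [exact: pf_const|apply: pf_mul => //; exact: subalgebra_exp].
    rewrite big_ord_recl /= [X in _ + X]big1 ?addr0 => [|a _].
      by apply: eq_bigr => i _; rewrite expr0 mul1r.
    by rewrite big1 // => i _; rewrite f0 // expr0n /= mul0r mulr0.
  case=> // a i aM; apply: (IHM (fun a => b a.+1)) => // {a i aM}.
  have [||fz|] := primeS' f
    (fun x => \sum_(a < M) \sum_i b a.+1 i * (f x ^+ a * F i x)) pf.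
  - apply: (subalgebra_sum (F := fun (a : 'I_M) x => \sum_i b a.+1 i * (f x ^+ a * F i x)) _ alg) => a _.
    apply: (subalgebra_sum (F := fun i x => b a.+1 i * (f x ^+ a * F i x)) _ alg) => i _.
    by apply: pf_mul; [exact: pf_const|apply: pf_mul => //; exact: subalgebra_exp].
  - move=> x S'x; rewrite -[RHS](bM x S'x) big_ord_recl /=.
    rewrite [X in X + _]big1 ?add0r => [|i _]; last by rewrite b00 mul0r.
    rewrite mulr_sumr; apply: eq_bigr => a _; rewrite mulr_sumr.
    by apply: eq_bigr => i _; rewrite mulrCA exprS !mulrA.
  - by rewrite fz ?eqxx in fy.
  - by [].
case=> a i.
have : b a i = 0.
  apply: (b0 N) => // x S'x; rewrite -[RHS](c0 x S'x).
  rewrite (pair_bigA _ (fun (a : 'I_N) i => b (val a) i * (f x ^+ a * F i x))) /=.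
  by apply: eq_bigr => -[a' i'] _ /=; rewrite /b valK.
by rewrite /b valK.
Qed.


(** The constant 1 is independent on the nonempty bottom set, and each step up multiplies the family
    by the powers 0 to [N] of the new separating function. *)
Lemma chain_indep (S : nat -> 'M[k]_(p, q) -> Prop) (f : nat -> 'M[k]_(p, q) -> k)
    (l N : nat) :
  (exists x, S 0%N x) ->
  (forall i, (i < l)%N -> vanishing_prime (S i.+1)) ->
  (forall i h, (i < l)%N -> polyfun h ->
     (forall x, S i.+1 x -> h x = 0) -> forall x, S i x -> h x = 0) ->
  (forall i, (i < l)%N -> polyfun (f i)) ->
  (forall i x, (i < l)%N -> S i x -> f i x = 0) ->
  (forall i, (i < l)%N -> exists2 x, S i.+1 x & f i x != 0) ->
  exists (I : finType) (a : I -> nat -> nat),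
    [/\ #|I| = (N.+1 ^ l)%N, forall i j, (a i j <= N)%N &
        indep_on (S l) (fun i x => \prod_(j < l) f j x ^+ a i j)].
Proof.
move=> [x0 Sx0]; elim: l => [|l IHl] primeS nestS pf f0 fn0.
  exists unit, (fun _ _ => 0%N); split=> // [|c c0 []]; first by rewrite card_unit.
  by have := c0 x0 Sx0; rewrite (big_pred1 tt) => [|[]] //; rewrite big_ord0 mulr1.
have [|||||I [a [cI aN indI]]] := IHl.
- by move=> i il; apply: primeS; rewrite ltnS ltnW.
- by move=> i h il; apply: nestS; rewrite ltnS ltnW.
- by move=> i il; apply: pf; rewrite ltnS ltnW.
- by move=> i x il; apply: f0; rewrite ltnS ltnW.
- by move=> i il; apply: fn0; rewrite ltnS ltnW.
pose a' (ai : 'I_N.+1 * I) j := if j == l then val ai.1 else a ai.2 j.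
exists ('I_N.+1 * I)%type, a'; split.
- by rewrite card_prod card_ord cI expnS.
- by move=> [b i] j; rewrite /a' /=; case: (j == l); rewrite ?aN // -ltnS ltn_ord.
have pF i : polyfun (fun x => \prod_(j < l) f j x ^+ a i j).
  apply: (subalgebra_prod (F := fun (j : 'I_l) x => f j x ^+ a i j)
    _ (@polyfun_subalgebra k p q)) => j _.
  apply: subalgebra_exp; first exact: polyfun_subalgebra.
  by apply: pf; rewrite ltnS ltnW.
have := indep_on_extend (N := N.+1) (primeS l (ltnSn l)) (fun h => nestS l h (ltnSn l))
  (pf l (ltnSn l)) (fun x => f0 l x (ltnSn l)) (fn0 l (ltnSn l)) pF indI.
congr indep_on; apply: functional_extensionality => -[b i].
apply: functional_extensionality => x; rewrite big_ord_recr /= /a' eqxx mulrC.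
by congr (_ * _); apply: eq_bigr => j _; rewrite /= ltn_eqF.
Qed.

(** An irreducible set covered by finitely many sets lies in the closure of one of them. The
    induction carries a polynomial [h] with a nonzero value such that the remaining sets cover the
    locus where [h] is nonzero; discarding a set multiplies [h] by a polynomial vanishing on that
    set. *)
Lemma vanishing_prime_cover S (T : eqType) (Z : T -> 'M[k]_(p, q) -> Prop)
    (ts : seq T) :
  vanishing_prime S -> (exists x, S x) ->
  (forall x, S x -> exists2 t, t \in ts & Z t x) ->
  exists2 t, t \in ts & forall h, polyfun h ->
    (forall x, S x -> Z t x -> h x = 0) -> forall x, S x -> h x = 0.
Proof.
move=> primeS [x0 Sx0] cover.
suff gen : forall h, polyfun h -> (exists2 x, S x & h x != 0) ->
    (forall x, S x -> h x != 0 -> exists2 t, t \in ts & Z t x) ->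
    exists2 t, t \in ts & forall h, polyfun h ->
      (forall x, S x -> Z t x -> h x = 0) -> forall x, S x -> h x = 0.
  apply: (gen (fun _ => 1)); first exact: pf_const.
    by exists x0; rewrite ?oner_neq0.
  by move=> x Sx _; apply: cover.
elim: ts {cover} => [|t ts IHts] h ph [x Sx hx] cover.
  by have [] := cover x Sx hx.
have [dense|] := classic (forall h, polyfun h ->
  (forall x, S x -> Z t x -> h x = 0) -> forall x, S x -> h x = 0).
  by exists t; rewrite ?mem_head.
move=> /not_all_ex_not [g] /(imply_to_and (polyfun g)) [pg].
move=> /(imply_to_and (forall x, S x -> Z t x -> g x = 0)) [gZ gn0].
have [] := IHts (fun x => h x * g x); first exact: pf_mul.
- apply: not_vanishing => hg0; have [h0|//] := primeS h g ph pg hg0.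
  by rewrite h0 ?eqxx in hx.
- move=> y Sy; rewrite mulf_eq0 negb_or => /andP [hy gy].
  have [t'] := cover y Sy hy; rewrite inE => /predU1P [->|tts] Zy.
    by rewrite gZ ?eqxx in gy.
  by exists t'.
by move=> t' t'ts dense; exists t'; rewrite ?inE ?t'ts ?orbT.
Qed.

(** One parametrization is dense in the top set, so the independent products of the [f j] stay
    independent after pulling back to at most [D] variables, where their degrees bound their
    number. *)
Lemma chain_length_le (S : nat -> 'M[k]_(p, q) -> Prop)
    (f : nat -> 'M[k]_(p, q) -> k) (l D : nat)
    (T : finType) (J : T -> finType) (Phi : forall t, (J t -> k) -> 'M[k]_(p, q)) :
  (exists x, S 0%N x) ->
  (forall i, (i < l)%N -> vanishing_prime (S i.+1)) ->
  (forall i h, (i < l)%N -> polyfun h ->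
     (forall x, S i.+1 x -> h x = 0) -> forall x, S i x -> h x = 0) ->
  (forall i, (i < l)%N -> polyfun (f i)) ->
  (forall i x, (i < l)%N -> S i x -> f i x = 0) ->
  (forall i, (i < l)%N -> exists2 x, S i.+1 x & f i x != 0) ->
  (forall t i j, polynomial_map (fun y => Phi t y i j)) ->
  (forall x, S l x -> exists2 t, (#|J t| <= D)%N & exists y, x = Phi t y) ->
  (l <= D)%N.
Proof.
move=> Sx0 primeS nestS pf f0 fn0 polPhi cover.
case: (posnP l) => [->//|l_gt0]; rewrite leqNgt; apply/negP => ltDl.
have Sl : S l = S l.-1.+1 by rewrite prednK.
have [|||t tD dense] := @vanishing_prime_cover (S l) T (fun t x => exists y, x = Phi t y)
    (enum (fun t => #|J t| <= D)%N).
- by rewrite Sl; apply: primeS; rewrite prednK.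
- by rewrite Sl; have [|x] := fn0 l.-1; rewrite ?prednK //; exists x.
- by move=> x /cover [t tD ex]; exists t; rewrite ?mem_enum.
rewrite mem_enum in tD.
have [e fe] : exists e, forall i, (i < l)%N -> deg_le e (fun y => f i (Phi t y)).
  elim: (l) pf => [|l' IH] pf; first by exists 0%N.
  have [|e fe] := IH; first by move=> i il; apply: pf; rewrite ltnS ltnW.
  have [e' fe'] := polyfun_comp (polynomial_map_subalgebra k (J t)) (polPhi t) (pf l' (ltnSn _)).
  exists (maxn e e') => i; rewrite ltnS leq_eqVlt => /predU1P [->|il].
    exact: deg_leW (leq_maxr _ _) fe'.
  exact: deg_leW (leq_maxl _ _) (fe _ il).
(* The pulled back products have degree at most [l * N * e] in each variable, and
   [l * N * e + 1 <= C * (N + 1)]. If [D < l], the choice [N = C ^ D] gives [C ^ D * (N + 1) ^ D <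
   (N + 1) ^ (D + 1) <= (N + 1) ^ l]. *)
pose C := (l * e).+1; pose N := (C ^ D)%N.
have [I [a [cI aN indI]]] := chain_indep N Sx0 primeS nestS pf f0 fn0.
have indPhi : indep_on (fun _ : J t -> k => True)
    (fun i y => \prod_(j < l) f j (Phi t y) ^+ a i j).
  move=> c c0; apply: indI => x Sx; move: x Sx.
  apply: (dense (fun x => \sum_i c i * \prod_(j < l) f j x ^+ a i j)).
    apply: (subalgebra_sum (F := fun i x => c i * \prod_(j < l) f j x ^+ a i j)
      _ (@polyfun_subalgebra k p q)) => i _.
    apply: pf_mul; first exact: pf_const.
    apply: (subalgebra_prod (F := fun (j : 'I_l) x => f j x ^+ a i j)
      _ (@polyfun_subalgebra k p q)) => j _.
    by apply: subalgebra_exp; [exact: polyfun_subalgebra|exact: pf].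
  by move=> x _ [y ->]; apply: c0.
have degF i : deg_le (l * (N * e)) (fun y => \prod_(j < l) f j (Phi t y) ^+ a i j).
  apply: deg_le_prod (fun j y => f j (Phi t y) ^+ a i j) _ => j jl.
  by apply: deg_leW (deg_le_exp (a i j) (fe j jl)); rewrite leq_mul2r aN orbT.
pose b i := constructive_indefinite_description _ (deg_le_span (degF i)).
have := indep_on_card indPhi (fun i x _ => proj2_sig (b i) x).
rewrite cI card_ffun card_ord leqNgt => /negP; apply.
have step : ((l * (N * e)).+1 <= C * N.+1)%N by rewrite /C; lia.
have le1 : ((l * (N * e)).+1 ^ #|J t| <= (C * N.+1) ^ D)%N.
  apply: leq_trans (leq_pexp2l _ tD) _ => //.
  by case: (posnP D) => [->|D0]; rewrite ?expn0 ?leq_exp2r.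
apply: leq_ltn_trans le1 _; rewrite expnMn.
apply: leq_trans (leq_pexp2l _ ltDl) => //.
by rewrite expnS ltn_pmul2r ?expn_gt0.
Qed.

End ChainBound.

(** * Chains in the Grassmannian *)

Section Grassmannian.
Variables (k : closedFieldType) (n d : nat).
Implicit Types (B : 'M[k]_(d, n)) (T Y Z : 'M[k]_n -> Prop).

Definition lift T B : Prop := row_free B /\ T <<B>>%MS.

Lemma genmx_mul_unit u B : u \in unitmx -> (<<u *m B>> = <<B>>)%MS.
Proof. by move=> uu; apply/eq_genmx; apply: eqmxMfull; rewrite row_full_unit. Qed.

Lemma row_free_mul_unit u B :
  u \in unitmx -> row_free B -> row_free (u *m B).
Proof.
move=> uu fB; rewrite -row_leq_rank -{1}(eqP fB).
by rewrite (eqmxMfull B _) ?row_full_unit.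
Qed.

Lemma genmx_eq_mul B B' : row_free B -> row_free B' -> (<<B'>> = <<B>>)%MS ->
  exists2 u, u \in unitmx & B' = u *m B.
Proof.
move=> fB fB' EB; have sB : (B' <= B)%MS by rewrite -(genmxE B) -EB genmxE.
exists (B' *m pinvmx B); last by rewrite mulmxKpV.
rewrite -row_free_unit -row_leq_rank -{1}(eqP fB') -{1}(mulmxKpV sB).
exact: mxrankM_maxl.
Qed.

Lemma polyfun_mulmxl m (u : 'M[k]_(m, d)) f :
  polyfun f -> polyfun (fun B => f (u *m B)).
Proof.
apply: polyfun_comp (fun B => u *m B) (@polyfun_subalgebra k d n) _ => i j.
apply: (subalgebra_mulmx (F := fun _ => u) (G := id)).
- exact: polyfun_subalgebra.
- by move=> *; apply: pf_const.
- exact: pf_coord.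
Qed.

Lemma polyfun_orbit B f : polyfun f -> polyfun (fun u : 'M[k]_d => f (u *m B)).
Proof.
apply: polyfun_comp (fun u => u *m B) (@polyfun_subalgebra k d d) _ => i j.
apply: (subalgebra_mulmx (F := id) (G := fun _ => B)).
- exact: polyfun_subalgebra.
- exact: pf_coord.
- by move=> *; apply: pf_const.
Qed.

(** The zeros of [f] alone need not be a union of fibres; the translates of [f] by all invertible
    matrices are equations for the subspaces all of whose frames are zeros. *)
Lemma Grclosed_invariant_zeros f : polyfun f ->
  Grclosed d (fun W => forall B, row_free B -> W = <<B>>%MS -> f B = 0).
Proof.
move=> pf; exists (fun g => exists2 u, u \in unitmx & g = (fun B => f (u *m B))).
split=> [_ [u _ ->]|B fB]; first exact: polyfun_mulmxl.
split=> [f0 _ [u uu ->]|f0 B' fB' EB].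
  by apply: f0; [exact: row_free_mul_unit|rewrite genmx_mul_unit].
have [u uu ->] := genmx_eq_mul fB fB' (esym EB).
by apply: (f0 (fun B => f (u *m B))); exists u.
Qed.

(* The fibres of the lift are orbits of the irreducible group [GL_d]. *)
Lemma lift_vanishing_prime T :
  (forall W, T W -> Grpt d W) -> irreducible d T -> vanishing_prime (lift T).
Proof.
move=> TG [_ irrT] f g pf pg fg0.
have pdet : polyfun (fun v : 'M[k]_d => \det v).
  by apply: subalgebra_det; [exact: polyfun_subalgebra|exact: pf_coord].
have [|T1|T2] := irrT _ _ (Grclosed_invariant_zeros pf) (Grclosed_invariant_zeros pg).
- move=> W TW; apply: NNPP => /not_or_and [nf ng].
  have [B [fB EW]] := TG W TW.
  have point (h : 'M[k]_(d, n) -> k) : ~ (forall B, row_free B -> W = <<B>>%MS -> h B = 0) ->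
      exists u : 'M[k]_d, h (u *m B) != 0.
    move=> nh; apply: NNPP => nex; apply: nh => B' fB' EB'.
    have [|u uu ->] := genmx_eq_mul fB fB'; first by rewrite -EB'.
    by apply/eqP/negPn/negP => hu; apply: nex; exists u.
  have [u fu] := point f nf; have [v gv] := point g ng.
  (* Neither factor vanishes on the whole fibre; in the affine space of all square matrices this
     yields a point where both factors and the determinant are nonzero. *)
  have [w [_ fgw dw]] : exists w : 'M[k]_d,
      [/\ True, f (w *m B) * g (w *m B) != 0 & \det w != 0].
    have [w [_ fw gw]] := affine_nonvanishing (@affine_setT k d d)
      (polyfun_orbit B pf) (polyfun_orbit B pg) I I fu gv.
    have := affine_nonvanishing (y := 1%:M) (@affine_setT k d d)
      (pf_mul (polyfun_orbit B pf) (polyfun_orbit B pg)) pdet I I (mulf_neq0 fw gw).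
    by apply; rewrite det1 oner_neq0.
  have uw : w \in unitmx by rewrite unitmxE unitfE.
  move: fgw; rewrite fg0 ?eqxx //; split; first exact: row_free_mul_unit.
  by rewrite genmx_mul_unit // -EW.
- by left=> B [fB TB]; apply: T1 TB _ fB _.
- by right=> B [fB TB]; apply: T2 TB _ fB _.
Qed.

Lemma irr_chain_separate Y c r i : (forall W, Y W -> Grpt d W) ->
  irr_chain d Y c r -> (i < r)%N ->
  exists f, [/\ polyfun f, forall B, lift (c i) B -> f B = 0
               & exists2 B, lift (c i.+1) B & f B != 0].
Proof.
move=> YG [cP cS] ir; have [_ [W [ciW nciW]]] := cS i ir.
have [[Zi [[F [Fpol FP]] ciE]] _] := cP i (ltnW ir).
have [[Z' [_ cSiE]] _] := cP i.+1 ir.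
have [YW _] := (cSiE W).1 ciW; have [B [fB EW]] := YG W YW.
have [f Ff fB0] : exists2 f, F f & f B != 0.
  apply: NNPP => nf; apply: nciW; apply/ciE; split=> //; rewrite EW.
  by apply/FP => // f Ff; apply/eqP/negPn/negP => fB0; apply: nf; exists f.
exists f; split; first exact: Fpol.
  by move=> B' [fB' /ciE [_ /(FP B' fB')]]; apply.
by exists B => //; split; rewrite // -EW.
Qed.

(** The [r.+1] steps of the chain are preceded by [d * d] steps inside the span of one frame, where
    one entry of the multiplier is released at a time; the total exceeds the number of parameters by
    one. *)
Lemma no_irr_chain Y r (T : finType) (J : T -> finType)
    (Phi : forall t, (J t -> k) -> 'M[k]_(d, n)) :
  (forall W, Y W -> Grpt d W) ->
  (forall t i j, polynomial_map (fun y => Phi t y i j)) ->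
  (forall B, lift Y B ->
     exists2 t, (#|J t| <= d * d + r)%N & exists y, B = Phi t y) ->
  ~ (exists c, irr_chain d Y c r.+1).
Proof.
move=> YG polPhi cover [c chain]; have [cP cS] := chain.
have cY i : (i <= r.+1)%N -> forall W, c i W -> Y W.
  by move=> ir W; have [[Z [_ cE]] _] := cP i ir; move/cE => [].
have cG i ir W ciW := YG W (cY i ir W ciW).
have [W0 c0W0] : exists W, c 0%N W by have [_ [[W cW] _]] := cP 0%N isT; exists W.
have [B0 [fB0 EW0]] := cG 0%N isT W0 c0W0.
have lift0 u : u \in unitmx -> lift (c 0%N) (u *m B0).
  by move=> uu; split; rewrite ?row_free_mul_unit // genmx_mul_unit // -EW0.
have orbit0 h : polyfun h -> (forall B, lift (c 0%N) B -> h B = 0) ->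
    forall u, h (u *m B0) = 0.
  move=> ph h0; apply: (@unitmx_dense _ _ (fun u => h (u *m B0))).
    exact: polyfun_orbit.
  by move=> u uu; apply: h0; apply: lift0.
(* At [i = d * d] this is the whole linear space of the [u *m B0], singular [u] included, and it
   stands in place of the lift of [c 0]. It need not lie in the lift of [c 1], but by density of the
   invertible matrices every polynomial vanishing on that lift vanishes on it. *)
pose S i B := if (i <= d * d)%N then
    exists2 u, B = u *m B0 & forall j : 'I_(d * d), (i <= j)%N -> mxvec u 0 j = 0
  else lift (c (i - d * d)%N) B.
pose sep (j : 'I_r.+1) := constructive_indefinite_description _
  (irr_chain_separate YG chain (ltn_ord j)).
(* The first [d * d] separating functions read the entries of [u] from [u *m B0]; the later ones
   come from the given chain. *)
pose f i B := if insub i is Some j then mxvec (B *m pinvmx B0) 0 j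
  else if insub (i - d * d)%N is Some j then proj1_sig (sep j) B else 0.
have fE1 (j : 'I_(d * d)) B : f j B = mxvec (B *m pinvmx B0) 0 j.
  by rewrite /f valK.
have fE2 i (ir : (i < r.+1)%N) : f (d * d + i)%N = proj1_sig (sep (Ordinal ir)).
  by rewrite /f insubF ?ltnNge ?leq_addr // addKn insubT.
have small i : (i < d * d + r.+1)%N -> (i < d * d)%N \/
    exists2 j, (j < r.+1)%N & i = (d * d + j)%N.
  move=> il; case: (ltnP i (d * d)) => [|le_i]; first by left.
  by right; exists (i - d * d)%N; lia.
have Sbig j B : S (d * d + j.+1)%N B = lift (c j.+1) B.
  by rewrite /S leqNgt -addSnnS leq_addr addSnnS /= addKn.
have : (d * d + r.+1 <= d * d + r)%N; last by rewrite addnS ltnn.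
apply: (chain_length_le (S := S) (f := f) (Phi := Phi)) => //.
- by exists 0; rewrite /S /=; exists 0 => [|j _]; rewrite ?mul0mx // linear0 mxE.
- move=> i il; have [ltd|[j jr ->]] := small i il; last first.
    rewrite -addnS; have -> : S (d * d + j.+1)%N = lift (c j.+1).
      by apply: functional_extensionality => B; rewrite Sbig.
    by apply: lift_vanishing_prime; [exact: cG|have [] := cP j.+1 jr].
  apply: affine_vanishing_prime => x y t; rewrite /S ltd.
  move=> [u -> u0] [v -> v0]; exists (u + t *: (v - u)).
    by rewrite mulmxDl -scalemxAl mulmxBl.
  move=> j ij; rewrite linearD linearZ /= linearB /= !mxE u0 // v0 //.
  by rewrite subrr mulr0 addr0.
- move=> i h il ph; have [ltd|[j jr ->]] := small i il.
    rewrite /S ltd (ltnW ltd) => h0 x [u -> u0]; apply: h0; exists u => // j ij.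
    by apply: u0; apply: ltnW.
  rewrite -addnS => h0.
  have h0' B : lift (c j) B -> h B = 0.
    move=> [fB cB]; apply: h0; rewrite Sbig; split=> //.
    by have [sub _] := cS j jr; apply: sub.
  case: j jr h0 h0' => [|j] jr h0 h0' x; last by rewrite Sbig; apply: h0'.
  by rewrite addn0 /S leqnn => -[u -> _]; apply: orbit0.
- move=> i il; have [ltd|[j jr ->]] := small i il; last first.
    by rewrite fE2; case: (sep _) => g [].
  suff: polyfun (fun B => f (Ordinal ltd) B) by [].
  have -> : (fun B => f (Ordinal ltd) B) =
      (fun B => mxvec (B *m pinvmx B0) 0 (Ordinal ltd)).
    by apply: functional_extensionality => B; rewrite fE1.
  case/mxvec_indexP: (Ordinal ltd) => a b.
  have -> : (fun B => mxvec (B *m pinvmx B0) 0 (mxvec_index a b)) =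
      (fun B => (B *m pinvmx B0) a b).
    by apply: functional_extensionality => B; rewrite mxvecE.
  apply: (subalgebra_mulmx (F := id) (G := fun _ => pinvmx B0)).
  + exact: polyfun_subalgebra.
  + exact: pf_coord.
  + by move=> *; apply: pf_const.
- move=> i x il; have [ltd|[j jr ->]] := small i il.
    rewrite /S (ltnW ltd) => -[u -> u0].
    by rewrite (fE1 (Ordinal ltd)) -mulmxA mulmxVp // mulmx1 u0.
  rewrite fE2; case: (sep _) => g [pg g0 _] /=.
  case: j jr g0 => [|j] jr g0; last by rewrite Sbig; apply: g0.
  by rewrite addn0 /S leqnn => -[u -> _]; apply: orbit0.
- move=> i il; have [ltd|[j jr ->]] := small i il; last first.
    rewrite fE2; case: (sep _) => g [_ _ [B LB gB]] /=; exists B => //.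
    by rewrite -addnS Sbig.
  exists (vec_mx (delta_mx 0 (Ordinal ltd)) *m B0); last first.
    rewrite (fE1 (Ordinal ltd)) -mulmxA mulmxVp // mulmx1 vec_mxK mxE !eqxx.
    exact: oner_neq0.
  rewrite /S ltd; exists (vec_mx (delta_mx 0 (Ordinal ltd))) => // j ij.
  by rewrite vec_mxK mxE [_ == Ordinal _]gtn_eqF ?andbF.
- move=> B; rewrite Sbig => -[fB cB]; apply: cover; split=> //.
  exact: cY cB.
Qed.

(* The chain consists of the closures of the images of a coordinate flag. *)
Lemma irr_chain_of_cell Y r (Phi : 'rV[k]_r -> 'M[k]_(d, n))
    (h : 'I_r -> 'M[k]_(d, n) -> k) :
  (forall W, Y W -> Grpt d W) ->
  (forall i j, polyfun (fun y => Phi y i j)) ->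
  (forall y, row_free (Phi y)) -> (forall y, Y <<Phi y>>%MS) ->
  (forall j, polyfun (h j)) ->
  (forall j u y, u \in unitmx -> (h j (u *m Phi y) == 0) = (y 0 j == 0)) ->
  exists c, irr_chain d Y c r.
Proof.
move=> YG polPhi fPhi YPhi ph hPhi.
pose E i (y : 'rV[k]_r) := forall j : 'I_r, (i <= j)%N -> y 0 j = 0.
(* Requiring the zeros on the whole orbit of the image makes the family stable under [GL_d], so it
   defines a closed set in the quotient. *)
pose F i f := polyfun f /\ forall u y, u \in unitmx -> E i y -> f (u *m Phi y) = 0.
pose Z i W := forall B, row_free B -> W = <<B>>%MS -> forall f, F i f -> f B = 0.
have Zcl i : Grclosed d (Z i).
  exists (F i); split=> [f []//|B fB]; split=> [ZB f Ff|FB B' fB' EB f Ff].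
    exact: (ZB B).
  have [u uu ->] := genmx_eq_mul fB fB' (esym EB).
  apply: (FB (fun B => f (u *m B))); have [pf f0] := Ff; split.
    exact: polyfun_mulmxl.
  by move=> v y uv Ey; rewrite mulmxA f0 // unitmx_mul uu.
have ZPhi i y : E i y -> Z i <<Phi y>>%MS.
  move=> Ey B fB EB f [_ f0].
  by have [u uu ->] := genmx_eq_mul (fPhi y) fB (esym EB); apply: f0.
exists (fun i W => Y W /\ Z i W); split=> i ir; last first.
  split=> [W [YW ZW]|].
    split=> // B fB EW f [pf f0]; apply: (ZW B fB EW); split=> // u y uu Ey.
    by apply: f0 => // j ij; apply: Ey; apply: ltnW.
  (* The inclusion is strict: the function [h] of index [i] vanishes on the orbit of the smaller
     coordinate subspace but not at this new unit vector. *)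
  pose y : 'rV[k]_r := delta_mx 0 (Ordinal ir).
  exists <<Phi y>>%MS; split.
    split=> //; apply: ZPhi => j ij.
    by rewrite mxE [_ == Ordinal _]gtn_eqF ?andbF.
  case=> _ /(_ (Phi y) (fPhi y) erefl (h (Ordinal ir))) => hy.
  have /eqP : h (Ordinal ir) (1%:M *m Phi y) = 0.
    rewrite mul1mx; apply: hy; split=> // u z uu Ez; apply/eqP.
    by rewrite hPhi // Ez.
  by rewrite hPhi ?unitmx1 // mxE !eqxx oner_eq0.
split; first by exists (Z i).
split; first by exists <<Phi 0>>%MS; split=> //; apply: ZPhi => j _; rewrite mxE.
move=> Z1 Z2 [F1 [pF1 Z1P]] [F2 [pF2 Z2P]] cover.
have aE : affine_set (E i).
  by move=> x y t Ex Ey j ij; rewrite !mxE Ex // Ey // subrr mulr0 addr0.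
have reduce Z' (F' : ('M[k]_(d, n) -> k) -> Prop) : (forall f, F' f -> polyfun f) ->
    (forall B, row_free B -> Z' <<B>>%MS <-> forall f, F' f -> f B = 0) ->
    (forall y, E i y -> Z' <<Phi y>>%MS) -> forall W, Y W /\ Z i W -> Z' W.
  move=> pF' Z'P Z'Phi W [YW ZW]; have [B [fB EW]] := YG W YW.
  rewrite EW; apply/Z'P => // f Ff; apply: (ZW B fB EW); split; first exact: pF'.
  move=> u y uu Ey; apply: ((Z'P (u *m Phi y) _).1 _ f Ff).
    exact: row_free_mul_unit.
  by rewrite genmx_mul_unit //; apply: Z'Phi.
have fails Z' (F' : ('M[k]_(d, n) -> k) -> Prop) :
    (forall B, row_free B -> Z' <<B>>%MS <-> forall f, F' f -> f B = 0) ->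
    ~ (forall y, E i y -> Z' <<Phi y>>%MS) ->
    exists y f, [/\ E i y, F' f & f (Phi y) != 0].
  move=> Z'P nZ; apply: NNPP => nex; apply: nZ => y Ey; apply/Z'P => // f Ff.
  by apply/eqP/negPn/negP => fy; apply: nex; exists y, f.
apply: NNPP => /not_or_and [n1 n2].
have [|y1 [f1 [Ey1 Ff1 fy1]]] := fails _ _ Z1P.
  by move=> all1; apply: n1; apply: reduce Z1P all1.
have [|y2 [f2 [Ey2 Ff2 fy2]]] := fails _ _ Z2P.
  by move=> all2; apply: n2; apply: reduce Z2P all2.
have pull f : polyfun f -> polyfun (fun y => f (Phi y)).
  by apply: polyfun_comp => //; exact: polyfun_subalgebra.
have [y [Ey g1 g2]] := affine_nonvanishing aE (pull _ (pF1 _ Ff1))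
  (pull _ (pF2 _ Ff2)) Ey1 Ey2 fy1 fy2.
have [|/(Z1P _ (fPhi y)) z1|/(Z2P _ (fPhi y)) z2] := cover <<Phi y>>%MS.
- by split=> //; apply: ZPhi.
- by rewrite z1 ?eqxx in g1.
- by rewrite z2 ?eqxx in g2.
Qed.

End Grassmannian.

(** * Jordan frames *)

Section BlockIndices.
Variables (n : nat) (sz : seq nat).
Implicit Types i j : 'I_n.

Definition blk i : nat := reshape_index sz i.
Definition off i : nat := reshape_offset sz i.

Hypothesis sz_n : sumn sz = n.

Lemma blk_lt i : (blk i < size sz)%N.
Proof. by rewrite /blk reshape_indexP // sz_n. Qed.

Lemma off_lt i : (off i < nth 0%N sz (blk i))%N.
Proof. by rewrite /off reshape_offsetP // sz_n. Qed.

Lemma blk_off_inj i j : blk i = blk j -> off i = off j -> i = j.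
Proof.
move=> Eb Eo; apply: val_inj.
by rewrite /= -(reshape_indexK sz i) -(reshape_indexK sz j) -/(blk i) -/(off i) Eb Eo.
Qed.

Lemma ex_blk_off b s : (b < size sz)%N -> (s < nth 0%N sz b)%N ->
  exists2 i, blk i = b & off i = s.
Proof.
move=> bsz sb; have := flatten_indexP sb; rewrite sz_n => lt_n.
by exists (Ordinal lt_n); rewrite /blk /off /= ?flatten_indexKl ?flatten_indexKr.
Qed.

Lemma nat_succ_blk i j : (j == i.+1 :> nat) && (blk i == blk j) =
  (blk i == blk j) && (off j == (off i).+1).
Proof.
rewrite andbC; case: eqP => //= Eb.
have := reshape_indexK sz i; have := reshape_indexK sz j.
by rewrite /flatten_index -/(blk i) -/(off i) -/(blk j) -/(off j) Eb; lia.
Qed.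

(* Level first, then the later block is the smaller one. *)
Definition key i : nat := (off i * (size sz) + (size sz - (blk i).+1))%N.

Lemma key_lt i j : (key i < key j)%N =
  (off i < off j)%N || (off i == off j) && (blk j < blk i)%N.
Proof.
rewrite /key; have := blk_lt i; have := blk_lt j.
move: (off i) (off j) (blk i) (blk j) (size sz) => a b c d s cs ds.
by case: (ltngtP a b) => ab /=; [|apply/negbTE|]; nia.
Qed.

Lemma key_inj : injective key.
Proof.
move=> i j Ek.
have := key_lt i j; have := key_lt j i; rewrite Ek ltnn => /esym h1 /esym h2.
by apply: blk_off_inj; lia.
Qed.

End BlockIndices.

(** * Bidiagonal block matrices *)

Section Bidiagonal.
Variables (k : closedFieldType) (n : nat) (sz : seq nat).
Hypothesis sz_n : sumn sz = n.
Implicit Types i j : 'I_n.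

Local Notation blk := (@blk n sz).
Local Notation off := (@off n sz).

(** On row vectors this lowers the offset by [a] inside each block and kills the offsets below [a];
    it is the [a]-th power of the nilpotent part of the transposed Jordan matrix. *)
Definition shift (a : nat) : 'M[k]_n :=
  \matrix_(i, j) ((blk i == blk j) && (off i == off j + a)%N)%:R.

(** The diagonal is arbitrary, so that Jordan matrices and their perturbations have the same
    form. *)
Definition bidiag (a : 'I_n -> k) : 'M[k]_n :=
  \matrix_(i, j) if i == j then a i
                 else ((blk i == blk j) && (off j == (off i).+1))%:R.

Lemma shift0 : shift 0 = 1%:M.
Proof.
apply/matrixP => i j; rewrite !mxE addn0; congr ((nat_of_bool _)%:R).
apply/andP/eqP => [[/eqP Eb /eqP Eo]|->]; last by rewrite !eqxx.
exact: (blk_off_inj Eb Eo).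
Qed.

Lemma shiftS a : shift a *m shift 1 = shift a.+1.
Proof.
apply/matrixP => i j; rewrite !mxE.
case Eij: ((blk i == blk j) && (off i == off j + a.+1)%N).
  have /andP [/eqP Eb /eqP Eo] := Eij.
  have [||l El Ol] := @ex_blk_off n sz sz_n (blk i) (off j).+1.
  - exact: blk_lt.
  - by apply: leq_ltn_trans (off_lt sz_n i); rewrite Eo; lia.
  rewrite (bigD1 l) //= !mxE El Ol Eb Eo addn1 addSnnS !eqxx mul1r.
  rewrite big1 ?addr0 // => l' nl; rewrite !mxE -natrM mulnb.
  case: andP => // -[/andP [/eqP El' /eqP Eo'] /andP [_ /eqP Ol']].
  by case/eqP: nl; apply: (@blk_off_inj n sz); rewrite ?El -?El' ?Ol ?Ol' //; lia.
rewrite big1 // => l _; rewrite !mxE -natrM mulnb.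
case: andP => // -[/andP [/eqP El /eqP Eo] /andP [/eqP El' /eqP Eo']].
by move: Eij; rewrite El El' Eo Eo' !eqxx /=; lia.
Qed.

Lemma tr_bidiag (a : 'I_n -> k) : (bidiag a)^T = diag_mx (\row_i a i) + shift 1.
Proof.
apply/matrixP => i j; rewrite !mxE eq_sym; case: (eqVneq i j) => [->|nij].
  by rewrite eqxx addn1 (ltn_eqF (ltnSn _)) addr0.
by rewrite mulr0n add0r eq_sym addn1.
Qed.

End Bidiagonal.

(** * Stability under the semisimple and nilpotent parts *)

Section StableSubspaces.
Variable k : closedFieldType.

Lemma stable_horner n d (C : 'M[k]_(d, n.+1)) (M : 'M[k]_n.+1) p :
  (C *m M <= C)%MS -> (C *m horner_mx M p <= C)%MS.
Proof.
move=> CM; elim/poly_ind: p => [|p c IHp].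
  by rewrite rmorph0 mulmx0 sub0mx.
rewrite rmorphD rmorphM /= horner_mx_X horner_mx_C mulmxDr.
rewrite addmx_sub //; last by rewrite mul_mx_scalar scalemx_sub.
by rewrite mulmxA (submx_trans (submxMr _ IHp)).
Qed.

Definition eigenproj n (la : 'I_n -> k) mu : 'M[k]_n :=
  diag_mx (\row_i (la i == mu)%:R).

(* The projection onto a generalized eigenspace is a polynomial in [M]. *)
Lemma stable_eigenproj n d (C : 'M[k]_(d, n)) (M : 'M[k]_n) (la : 'I_n -> k) e mu :
  (C *m M <= C)%MS ->
  (forall i, iter e (mulmxr (M - (la i)%:M)) (delta_mx 0 i : 'rV_n) = 0) ->
  (C *m eigenproj la mu <= C)%MS.
Proof.
case: n C M la => [|n] C M la CM nil.
  by rewrite (_ : C *m _ = 0) ?sub0mx //; apply/matrixP => i [].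
pose p := ('X - mu%:P) ^+ e.
pose q := \prod_(i | la i != mu) ('X - (la i)%:P) ^+ e.
have nilp i a : iter a (mulmxr (M - (la i)%:M)) (delta_mx 0 i : 'rV_n.+1) =
    delta_mx 0 i *m horner_mx M (('X - (la i)%:P) ^+ a).
  elim: a => [|a IHa]; first by rewrite expr0 rmorph1 mulmx1.
  rewrite iterS IHa exprSr rmorphM /= rmorphB /= horner_mx_X horner_mx_C.
  by rewrite mulmxA.
have /Bezout_eq1_coprimepP [[u v] /= uv] : coprimep p q.
  apply: coprimep_expl; rewrite /q; elim/big_ind: _ => [|x y px py|i ni].
  - by rewrite coprimep1.
  - by rewrite coprimepMr px.
  - by apply: coprimep_expr; rewrite coprimep_XsubC2 // subr_eq0.
(* By Bezout [v * q] is 1 modulo [p], while [q] contains the annihilating power of every basis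
   vector with another eigenvalue; hence the two matrices agree on the basis. *)
rewrite (_ : eigenproj _ _ = horner_mx M (v * q)); first exact: stable_horner.
apply/row_matrixP => i; rewrite !rowE.
have -> : delta_mx 0 i *m eigenproj la mu =
    (la i == mu)%:R *: delta_mx 0 i :> 'rV[k]_n.+1.
  apply/rowP => j; rewrite -rowE row_diag_mx !mxE eqxx /=.
  by case: (j == i).
have [Ei|ni] := eqVneq (la i) mu.
  have -> : v * q = 1 - u * p by rewrite -uv addrC addKr.
  rewrite rmorphB /= mulmxBr [horner_mx M 1]rmorph1 mulmx1 mulrC rmorphM /= mulmxA.
  by rewrite /p -Ei -nilp nil mul0mx subr0 scale1r.
rewrite scale0r mulrC /q (bigD1 i) //= -mulrA rmorphM /= mulmxA.
by rewrite -nilp nil mul0mx.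
Qed.

Section Levels.
Variables (n : nat) (sz : seq nat).
Hypothesis sz_n : sumn sz = n.
Local Notation blk := (@blk n sz).
Local Notation off := (@off n sz).
Local Notation shift := (shift k n sz).

Lemma delta_shift1 (i : 'I_n) : (delta_mx 0 i : 'rV_n) *m shift 1 = 0 \/
  exists2 j, blk j = blk i /\ off i = (off j).+1 &
    (delta_mx 0 i : 'rV_n) *m shift 1 = delta_mx 0 j.
Proof.
case: (posnP (off i)) => [o0|o_gt0].
  left; apply/rowP => j; rewrite -rowE !mxE o0 addn1 andbF //.
right; have [||j bj oj] := @ex_blk_off n sz sz_n (blk i) (off i).-1.
- exact: blk_lt.
- by apply: leq_ltn_trans (off_lt sz_n i); lia.
exists j; first by rewrite bj oj prednK.
apply/rowP => l; rewrite -rowE !mxE eqxx /=; congr ((nat_of_bool _)%:R).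
apply/andP/eqP => [[/eqP bl /eqP ol]|->]; last by rewrite bj oj addn1 prednK ?eqxx.
by apply: (@blk_off_inj n sz); rewrite ?bj // oj ol addn1.
Qed.

Variable lam : nat -> k.
Let la (i : 'I_n) := lam (blk i).
Let J := bidiag sz la.

Lemma bidiag_nilpotent (i : 'I_n) e : (off i < e)%N ->
  iter e (mulmxr (J^T - (la i)%:M)) (delta_mx 0 i : 'rV_n) = 0.
Proof.
have step j : (delta_mx 0 j : 'rV_n) *m (J^T - (la j)%:M) = delta_mx 0 j *m shift 1.
  rewrite mulmxBr /J tr_bidiag mulmxDr mul_mx_scalar.
  rewrite (_ : delta_mx 0 j *m diag_mx _ = la j *: delta_mx 0 j) ?[_ + _ *m _]addrC ?addrK //.
  apply/rowP => l; rewrite -rowE row_diag_mx !mxE eqxx /=.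
  by case: (l == j); rewrite ?mulr1 ?mulr0.
have iter0 a M : iter a (mulmxr M) (0 : 'rV[k]_n) = 0.
  by elim: a => // a IHa; rewrite iterS IHa /= mul0mx.
move: {2}(off i) (erefl (off i)) => o; elim: o i e => [|o IHo] i [//|e] Eo oe.
  rewrite iterSr /= step; have [->|[j [_ oj] _]] := delta_shift1 i; first exact: iter0.
  by rewrite Eo in oj.
rewrite iterSr /= step; have [->|[j [bj oj] ->]] := delta_shift1 i; first exact: iter0.
have -> : la i = la j by rewrite /la bj.
by apply: IHo; lia.
Qed.

(** The diagonal part is a combination of the projections, which preserve the subspace; subtracting
    it from [J^T] leaves the shift. *)
Lemma stable_levels d (C : 'M[k]_(d, n)) : (C *m J^T <= C)%MS ->
  (forall mu, (C *m eigenproj la mu <= C)%MS) /\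
  (C *m shift 1 <= C)%MS.
Proof.
move=> CJ.
have proj mu : (C *m eigenproj la mu <= C)%MS.
  apply: (@stable_eigenproj _ _ C J^T la (\max_i (off i).+1) mu CJ) => i.
  by apply: bidiag_nilpotent; apply: (leq_bigmax (F := fun i => (off i).+1)).
split=> //.
have -> : shift 1 = J^T - diag_mx (\row_i la i) by rewrite /J tr_bidiag addrC addKr.
rewrite mulmxBr addmx_sub // eqmx_opp.
have -> : diag_mx (\row_i la i) =
    \sum_(mu <- undup (codom la)) mu *: eigenproj la mu.
  apply/matrixP => i j; rewrite summxE !mxE.
  case: (eqVneq i j) => [<-|nij]; last first.
    by rewrite big1 // => mu _; rewrite !mxE (negbTE nij) mulr0n mulr0.
  rewrite (bigD1_seq (la i)) ?undup_uniq ?mem_undup ?codom_f //= !mxE !eqxx mulr1.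
  rewrite big1 ?addr0 // => mu nmu; rewrite !mxE eqxx eq_sym (negbTE nmu).
  by rewrite mulr0.
rewrite mulmx_sumr summx_sub // => mu _.
by rewrite -scalemxAr scalemx_sub.
Qed.

End Levels.
End StableSubspaces.

(** * Cells of stable subspaces *)

Section Cells.
Variables (k : closedFieldType) (n : nat) (sz : seq nat) (lam : nat -> k) (d : nat).
Hypothesis sz_n : sumn sz = n.
Implicit Types (i j q : 'I_n) (e : 'I_d -> 'I_n) (g : 'I_n * 'I_n -> k).

Local Notation blk := (@blk n sz).
Local Notation off := (@off n sz).
Local Notation key := (@key n sz).
Local Notation shift := (shift k n sz).
Local Notation la := (fun i => lam (blk i)).
Local Notation J := (bidiag sz (fun i => lam (blk i))).

Definition down_closed e := forall i j, i \in codom e -> blk j = blk i ->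
  (off j <= off i)%N -> j \in codom e.

Definition is_top e i := (i \in codom e) &&
  [forall q, (q \in codom e) && (blk q == blk i) ==> (off q <= off i)%N].

Definition top e i : 'I_n := [arg max_(q > i | (q \in codom e) && (blk q == blk i)) off q].

Definition wrow g i : 'rV[k]_n := \row_q ((q == i)%:R + g (i, q)).

(* The stable subspace with pivots [codom e] whose generators, indexed by the
   top pivots of the blocks, are the vectors [wrow g i]. *)
Definition cellmx e g : 'M[k]_(d, n) := \matrix_a
  (wrow g (top e (e a)) *m shift (off (top e (e a)) - off (e a))).

(** The [key] order between [x.2] and [x.1] is deliberately not imposed: without it the cardinality
    depends only on the number of pivots at each level. *)
Definition params e : {set 'I_n * 'I_n} :=
  [set x | [&& is_top e x.1, x.2 \notin codom e, lam (blk x.1) == lam (blk x.2)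
             & (off x.2 <= off x.1)%N]].

Lemma topP e i : i \in codom e ->
  [/\ is_top e (top e i), blk (top e i) = blk i & (off i <= off (top e i))%N].
Proof.
move=> ie; rewrite /top; case: arg_maxnP => [|t /andP [te /eqP bt] tmax].
  by rewrite ie eqxx.
split=> //; last by apply: tmax; rewrite ie eqxx.
rewrite /is_top te /=; apply/forallP => q; apply/implyP; rewrite bt => qP.
exact: tmax.
Qed.

Lemma is_top_uniq e i j : is_top e i -> is_top e j -> blk i = blk j -> i = j.
Proof.
move=> /andP [ie /forallP it] /andP [je /forallP jt] bij.
apply: (blk_off_inj bij); apply/eqP; rewrite eqn_leq.
have := it j; have := jt i; rewrite ie je bij eqxx /= => -> ->.
by [].
Qed.

Lemma is_top_codom e i : is_top e i -> i \in codom e.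
Proof. by case/andP. Qed.

Lemma mul_shiftP (v : 'rV[k]_n) m q :
  (exists q', [/\ blk q' = blk q, off q' = (off q + m)%N
                & (v *m shift m) 0 q = v 0 q']) \/
  (v *m shift m) 0 q = 0 /\ (forall q', blk q' = blk q -> off q' <> (off q + m)%N).
Proof.
have [[q' [bq oq]]|none] := classic (exists q', blk q' = blk q /\ off q' = (off q + m)%N).
  left; exists q'; split=> //; rewrite mxE (bigD1 q') //= !mxE bq oq !eqxx mulr1.
  rewrite big1 ?addr0 // => j nj; rewrite mxE.
  case: andP => [[/eqP bj /eqP oj]|_]; last by rewrite mulr0.
  by case/eqP: nj; apply: (@blk_off_inj n sz); rewrite ?bj ?oj.
right; split=> [|q' bq oq]; last by apply: none; exists q'.
rewrite mxE big1 // => j _; rewrite mxE.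
case: andP => [[/eqP bj /eqP oj]|_]; last by rewrite mulr0.
by case: none; exists j.
Qed.

Lemma mul_shiftE (v : 'rV[k]_n) m q q' :
  blk q' = blk q -> off q' = (off q + m)%N -> (v *m shift m) 0 q = v 0 q'.
Proof.
move=> bq oq; have [[j [bj oj ->]]|[_ /(_ q' bq)//]] := mul_shiftP v m q.
by congr (v 0 _); apply: (@blk_off_inj n sz); rewrite ?bj ?oj.
Qed.

Section Triangular.
Variables (e : 'I_d -> 'I_n) (g : 'I_n * 'I_n -> k).
Hypothesis gP : forall i q, is_top e i -> g (i, q) != 0 ->
  q \notin codom e /\ (key q < key i)%N.

Lemma wrow_codom i q : is_top e i -> q \in codom e -> wrow g i 0 q = (q == i)%:R.
Proof.
move=> it qe; rewrite mxE; have [->|/(gP it) []] := eqVneq (g (i, q)) 0.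
  by rewrite addr0.
by rewrite qe.
Qed.

(** A shift lowers all offsets by the same amount and so preserves the order of [key]; the leading
    position of the shifted row is the shifted leading position. *)
Lemma cellmx_upper a q : (key (e a) < key q)%N -> cellmx e g a q = 0.
Proof.
move=> kq; have [tt bt ot] := topP (codom_f e a).
set t := top e (e a) in tt bt ot *.
have Er : cellmx e g a q = (wrow g t *m shift (off t - off (e a))) 0 q.
  by rewrite !mxE.
rewrite Er; have [[q' [bq oq ->]]|[]//] := mul_shiftP (wrow g t) (off t - off (e a)) q.
have kt : (key t < key q')%N.
  by move: kq; rewrite !key_lt // bq bt oq; lia.
rewrite mxE; have [E|/(gP tt) []] := eqVneq (g (t, q')) 0; last by lia.
by rewrite E addr0; case: eqP kt => // ->; rewrite ltnn.
Qed.

Lemma cellmx_diag a : cellmx e g a (e a) = 1.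
Proof.
have [tt bt ot] := topP (codom_f e a); rewrite !mxE.
rewrite -[LHS](_ : (wrow g (top e (e a)) *m
  shift (off (top e (e a)) - off (e a))) 0 (e a) = _); last by rewrite mxE.
rewrite (@mul_shiftE _ _ _ (top e (e a))) // ?subnKC //.
by rewrite wrow_codom ?eqxx // is_top_codom.
Qed.

(** The submatrix on the pivot columns is unitriangular for the order of [key]: in a relation, the
    row of largest leading position must have coefficient zero. *)
Lemma cellmx_unit : injective e -> colsub e (cellmx e g) \in unitmx.
Proof.
move=> inj_e; rewrite -row_free_unit; apply: inj_row_free => u u0.
apply: contraTeq isT => /rV0Pn [a1 ua1].
case: (arg_maxnP (fun a => key (e a)) (P := fun a => u 0 a != 0) ua1) => a ua amax.
have /rowP/(_ a) := u0; rewrite mxE (bigD1 a) //= big1 => [|b nb].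
  have -> : colsub e (cellmx e g) a a = 1 by rewrite mxE cellmx_diag.
  by rewrite mulr1 addr0 mxE => ua0; rewrite ua0 eqxx in ua.
have [->|ub] := eqVneq (u 0 b) 0; first by rewrite mul0r.
have -> : colsub e (cellmx e g) b a = cellmx e g b (e a) by rewrite mxE.
rewrite cellmx_upper ?mulr0 //.
have := amax b ub; rewrite /= leq_eqVlt => /predU1P [|//] /(@key_inj n sz sz_n)/inj_e.
by move=> Eb; rewrite Eb eqxx in nb.
Qed.

End Triangular.

Lemma cellmx_stable e g : down_closed e ->
  (forall i q, is_top e i -> g (i, q) != 0 ->
     lam (blk q) = lam (blk i) /\ (off q <= off i)%N) ->
  (cellmx e g *m J^T <= cellmx e g)%MS.
Proof.
move=> dce gP; apply/row_subP => a; rewrite row_mul rowK.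
have [tt bt ot] := topP (codom_f e a).
set t := top e (e a) in tt bt ot *; set m := (off t - off (e a))%N.
have cell_row b : row b (cellmx e g) =
    wrow g (top e (e b)) *m shift (off (top e (e b)) - off (e b)) by rewrite rowK.
have supp q : (wrow g t *m shift m) 0 q * lam (blk q) =
    lam (blk t) * (wrow g t *m shift m) 0 q.
  have [[q' [bq oq ->]]|[-> _]] := mul_shiftP (wrow g t) m q; last by rewrite mul0r mulr0.
  rewrite -bq mxE; have [->|/(gP _ _ tt) [-> _]] := eqVneq (g (t, q')) 0; last exact: mulrC.
  by rewrite addr0; case: eqP => [->|_]; rewrite ?mul0r ?mulr0 // mulrC.
have wlam : wrow g t *m shift m *m diag_mx (\row_i lam (blk i)) =
    lam (blk t) *: (wrow g t *m shift m).
  by apply/rowP => q; rewrite mul_mx_diag mxE [in RHS]mxE [(\row_i _) 0 q]mxE supp.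
rewrite tr_bidiag mulmxDr wlam addmx_sub //.
  by rewrite scalemx_sub // -cell_row row_sub.
(* At offset 0 the total shift is [off t + 1], beyond every offset in the support of [wrow g t].
   Otherwise one more shift gives the row of the preceding pivot of the same block. *)
rewrite -mulmxA shiftS //; case: (posnP (off (e a))) => [o0|o_gt0].
  rewrite (_ : _ *m _ = 0) ?sub0mx //; apply/rowP => q; rewrite [RHS]mxE.
  have [[q' [bq oq ->]]|[]//] := mul_shiftP (wrow g t) m.+1 q.
  have lt_q : (off t < off q')%N by rewrite oq /m o0; lia.
  rewrite mxE; have [->|/(gP _ _ tt) [_]] := eqVneq (g (t, q')) 0; last by lia.
  by rewrite addr0; case: eqP lt_q => // ->; rewrite ltnn.
have [||j bj oj] := @ex_blk_off n sz sz_n (blk (e a)) (off (e a)).-1.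
- exact: blk_lt.
- by apply: leq_ltn_trans (off_lt sz_n (e a)); lia.
have /codomP [b Eb] : j \in codom e.
  by apply: (dce (e a)); rewrite ?codom_f // oj; lia.
have [tt' bt' ot'] := topP (codom_f e b).
have Et : top e (e b) = t.
  by apply: is_top_uniq tt' tt _; rewrite bt' -Eb bj bt.
rewrite (_ : wrow g t *m shift m.+1 = row b (cellmx e g)) ?row_sub //.
by rewrite cell_row Et -Eb oj /m; congr (_ *m shift _); lia.
Qed.

Lemma stable_shift (C : 'M[k]_(d, n)) m :
  (C *m shift 1 <= C)%MS -> (C *m shift m <= C)%MS.
Proof.
move=> C1; elim: m => [|m IHm]; first by rewrite shift0 // mulmx1.
by rewrite -shiftS // mulmxA (submx_trans (submxMr _ IHm)).
Qed.

Section Pivots.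
Variable C : 'M[k]_(d, n).
Hypothesis C_free : row_free C.

Definition is_pivot i := exists w : 'rV[k]_n,
  [/\ (w <= C)%MS, w 0 i != 0 & forall j, (key i < key j)%N -> w 0 j = 0].

Definition pivots : {set 'I_n} :=
  [set i | if excluded_middle_informative (is_pivot i) then true else false].

Lemma pivotsP i : reflect (is_pivot i) (i \in pivots).
Proof. by rewrite inE; case: excluded_middle_informative => ?; constructor. Qed.

Lemma leading_pivot (w : 'rV[k]_n) : (w <= C)%MS -> w != 0 ->
  exists2 i, i \in pivots & w 0 i != 0 /\ forall j, (key i < key j)%N -> w 0 j = 0.
Proof.
move=> wC /rV0Pn [i0 wi0].
case: (arg_maxnP key (P := fun i => w 0 i != 0) wi0) => i wi imax.
have lead j : (key i < key j)%N -> w 0 j = 0.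
  move=> kij; apply/eqP/negPn/negP => wj.
  by have := imax j wj; rewrite /= leqNgt kij.
by exists i => //; apply/pivotsP; exists w.
Qed.

(** A vector of the subspace is determined by its pivot coordinates, so there are at least [d]
    pivots; vectors with distinct leading positions are independent, so there are at most [d]. *)
Lemma card_pivots : #|pivots| = d.
Proof.
apply/eqP; rewrite eqn_leq; apply/andP; split; last first.
  pose CI : 'M[k]_(d, #|pivots|) := colsub enum_val C.
  suff /eqP <- : row_free CI by apply: rank_leq_col.
  apply: inj_row_free => u u0; apply/eqP/negPn/negP => un0.
  have [||i iI [wi _]] := @leading_pivot (u *m C).
  - exact: submxMl.
  - apply: contraNneq un0 => uC0.
    by rewrite -[u]mulmx1 -(mulmxVp C_free) mulmxA uC0 mul0mx.
  have /rowP/(_ (enum_rank_in iI i)) := u0.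
  rewrite mulmx_colsub !mxE enum_rankK_in // => E.
  by move: wi; rewrite mxE E eqxx.
pose w (a : 'I_#|pivots|) := constructive_indefinite_description _
  (pivotsP _ (enum_valP a)).
pose L : 'M[k]_(#|pivots|, n) := \matrix_a proj1_sig (w a).
have LC : (L <= C)%MS by apply/row_subP => a; rewrite rowK; case: (w a) => v [].
rewrite -[d](eqP C_free); suff /eqP <- : row_free L by apply: mxrankS.
apply: inj_row_free => u u0; apply: contraTeq isT => /rV0Pn [a1 ua1].
case: (arg_maxnP (fun a => key (enum_val a)) (P := fun a => u 0 a != 0) ua1) => a ua amax.
have /rowP/(_ (enum_val a)) := u0; rewrite mxE (bigD1 a) //= big1 => [|b nb].
  rewrite !mxE addr0; case: (w a) => v /= [_ va _] /eqP.
  by rewrite mulf_eq0 (negbTE ua) (negbTE va).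
have [->|ub] := eqVneq (u 0 b) 0; first by rewrite mul0r.
rewrite mxE; case: (w b) => v /= [_ _ vb]; rewrite vb ?mulr0 //.
have := amax b ub; rewrite /= leq_eqVlt => /predU1P [|//].
by move/(@key_inj n sz sz_n)/enum_val_inj => Eb; rewrite Eb eqxx in nb.
Qed.

End Pivots.

(** The reduced basis dual to the pivot columns is unique. Stability under the projections therefore
    confines each reduced row to one eigenvalue, and stability under shifts makes the pivots down
    closed; the shifts of the top rows lie in [C] and already have its rank. *)
Lemma stable_cell (C : 'M[k]_(d, n)) : row_free C -> (C *m J^T <= C)%MS ->
  exists e g u, [/\ injective e, down_closed e,
    forall x, g x != 0 -> x \in params e & C = u *m cellmx e g].
Proof.
move=> fC CJ; have [Cproj C1] := stable_levels sz_n CJ.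
have cd := card_pivots fC.
pose e a := enum_val (cast_ord (esym cd) a).
have inj_e : injective e by move=> a b /enum_val_inj/cast_ord_inj.
have codom_e i : (i \in codom e) = (i \in pivots C).
  apply/codomP/idP => [[a ->]|iI]; first exact: enum_valP.
  exists (cast_ord cd (enum_rank_in iI i)).
  by rewrite /e cast_ordK enum_rankK_in.
have W0 (w : 'rV[k]_n) : (w <= C)%MS -> (forall a, w 0 (e a) = 0) -> w = 0.
  move=> wC we; apply/eqP/negPn/negP => wn0.
  have [i iI [wi _]] := leading_pivot wC wn0; move: iI; rewrite -codom_e.
  by case/codomP => a Ei; rewrite Ei we eqxx in wi.
have uCe : colsub e C \in unitmx.
  rewrite -row_free_unit; apply: inj_row_free => u u0.
  rewrite -[u]mulmx1 -(mulmxVp fC) mulmxA (W0 (u *m C)) ?mul0mx ?submxMl // => a.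
  by have /rowP/(_ a) := u0; rewrite mulmx_colsub !mxE.
have [R [RC Re]] : exists R : 'M[k]_(d, n),
    (forall a, row a R <= C)%MS /\ (forall a b, R a (e b) = (a == b)%:R).
  exists (invmx (colsub e C) *m C); split=> [a|a b]; first by rewrite row_mul submxMl.
  have : colsub e (invmx (colsub e C) *m C) = 1%:M by rewrite -mulmx_colsub mulVmx.
  by move/matrixP/(_ a b); rewrite [LHS]mxE => ->; rewrite mxE.
have Rkey a q : R a q != 0 -> (key q <= key (e a))%N.
  move=> Raq; have rn0 : row a R != 0.
    by apply: contraNneq Raq => /rowP/(_ q); rewrite !mxE => ->.
  have [i iI [wi lead]] := leading_pivot (RC a) rn0.
  move: iI; rewrite -codom_e => /codomP [b Ei].
  move: wi lead; rewrite Ei mxE Re; case: (eqVneq a b) => [<- _ lead|_]; last by rewrite eqxx.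
  by rewrite leqNgt; apply: contraNN Raq => /lead; rewrite mxE => ->.
have Rlam a q : R a q != 0 -> lam (blk q) = lam (blk (e a)).
  move=> Raq; apply/eqP; pose pr := eigenproj (fun i => lam (blk i)) (lam (blk (e a))).
  have prE j : (row a R *m pr) 0 j = R a j * (lam (blk j) == lam (blk (e a)))%:R.
    by rewrite mul_mx_diag !mxE.
  (* Projecting a reduced row changes none of its pivot coordinates, so the difference is a vector
     of [C] vanishing at all pivots. *)
  have Epr : row a R *m pr - row a R = 0.
    apply: W0 => [|b].
      rewrite addmx_sub // ?eqmx_opp //.
      by apply: submx_trans (Cproj _); apply: submxMr.
    rewrite mxE prE 2!mxE Re; case: (eqVneq a b) => [->|_]; last by rewrite mul0r subr0.
    by rewrite eqxx mulr1 subrr.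
  move/rowP/(_ q): Epr; rewrite mxE prE 3!mxE.
  by case: eqP => // _ /eqP; rewrite mulr0 sub0r oppr_eq0 (negbTE Raq).
have dce : down_closed e.
  move=> i j; rewrite !codom_e => /pivotsP [w [wC wi lead]] bj oj.
  apply/pivotsP; exists (w *m shift (off i - off j)); split.
  - by apply: submx_trans (stable_shift (off i - off j) C1); apply: submxMr.
  - by rewrite (@mul_shiftE _ _ _ i) ?subnKC.
  - move=> q kq.
    have [[q' [bq oq ->]]|[]//] := mul_shiftP w (off i - off j) q.
    by apply: lead; move: kq; rewrite !key_lt // bq bj oq; lia.
(* Since [e] is injective the sum has at most one term: it picks the row whose pivot is [x.1]. *)
pose g (x : 'I_n * 'I_n) : k := if x.2 \in codom e then 0 else
  \sum_(a | (e a == x.1) && is_top e x.1) R a x.2.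
have wrowE a : is_top e (e a) -> wrow g (e a) = row a R.
  move=> ta; apply/rowP => q; rewrite !mxE /g /=; case: ifP => [/codomP [b ->]|nq].
    by rewrite addr0 Re (inj_eq inj_e) eq_sym.
  rewrite (big_pred1 a) => [|b]; last by rewrite ta andbT (inj_eq inj_e).
  by case: eqP nq => [->|_ _]; rewrite ?codom_f ?add0r.
have gP x : g x != 0 -> exists a, [/\ e a = x.1, is_top e x.1,
    x.2 \notin codom e & R a x.2 != 0].
  rewrite /g; case: ifP => [_|nx]; first by rewrite eqxx.
  case tx: (is_top e x.1); last by rewrite big_pred0 ?eqxx // => a; rewrite andbF.
  have /codomP [a Ea] := is_top_codom tx.
  rewrite (big_pred1 a) => [|b]; last by rewrite andbT Ea (inj_eq inj_e).
  by move=> Ra; exists a.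
have gparams x : g x != 0 -> x \in params e.
  move=> /gP [a [Ea tx nx Ra]]; rewrite inE tx nx /= -Ea (Rlam _ _ Ra) eqxx /=.
  by have := Rkey _ _ Ra; rewrite leqNgt key_lt //; lia.
have unit_cell : colsub e (cellmx e g) \in unitmx.
  apply: cellmx_unit => // i q ti /gP [a [/= Ea _ nq Ra]]; split=> //.
  rewrite -Ea ltn_neqAle Rkey // andbT; apply: contraNneq nq => /(@key_inj n sz sz_n) ->.
  exact: codom_f.
have cell_free : row_free (cellmx e g).
  apply: inj_row_free => u u0; rewrite -[u](mulmxK unit_cell) mulmx_colsub u0.
  by rewrite linear0 mul0mx.
have cellC : (cellmx e g <= C)%MS.
  apply/row_subP => a; rewrite rowK; have [tt _ _] := topP (codom_f e a).
  have /codomP [b Eb] := is_top_codom tt; rewrite Eb in tt *.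
  rewrite wrowE //; apply: submx_trans (stable_shift _ C1).
  exact: submxMr.
have Ccell : (C <= cellmx e g)%MS.
  by have := mxrank_leqif_sup cellC; rewrite (eqP fC) (eqP cell_free) => /leqif_refl.
by exists e, g, (C *m pinvmx (cellmx e g)); split=> //; rewrite mulmxKpV.
Qed.

(** For a fixed non-pivot [q], a top pivot [i] with [off q <= off i] corresponds to the unique pivot
    of its block at the offset of [q]; [top] is the inverse map. *)
Lemma card_params e : down_closed e -> #|params e| =
  (\sum_(q | q \notin codom e)
     #|[set p in codom e | (lam (blk p) == lam (blk q)) && (off p == off q)]|)%N.
Proof.
move=> dce; pose F q := [set p in codom e | (lam (blk p) == lam (blk q)) && (off p == off q)].
have inj_top q : {in F q &, injective (top e)}.
  move=> p p'; rewrite !inE => /and3P [pe _ /eqP op] /and3P [pe' _ /eqP op'] Et.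
  apply: (@blk_off_inj n sz); last by rewrite op op'.
  by have [_ <- _] := topP pe; have [_ <- _] := topP pe'; rewrite Et.
rewrite (eq_bigr (fun q => \sum_(i in top e @: F q) 1)%N) => [|q _]; last first.
  by rewrite sum1_card card_in_imset.
rewrite pair_big_dep /= -sum1_card (reindex (fun x : 'I_n * 'I_n => (x.2, x.1))) /=;
  last by exists (fun x : 'I_n * 'I_n => (x.2, x.1)) => -[].
apply: eq_bigl => -[q i] /=; rewrite inE /=; case qe: (q \notin codom e); last by rewrite andbF.
rewrite /=; apply/and3P/imsetP => [[ti /eqP li oi]|[p]].
  have [||p bp op] := @ex_blk_off n sz sz_n (blk i) (off q).
  - exact: blk_lt.
  - exact: leq_ltn_trans oi (off_lt sz_n i).
  have pe : p \in codom e by apply: (dce i); rewrite ?is_top_codom // op.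
  exists p; first by rewrite inE pe bp op li !eqxx.
  by have [tp bt _] := topP pe; apply: is_top_uniq ti tp _; rewrite bt bp.
rewrite inE => /and3P [pe /eqP lp /eqP op] ->; have [tp bt ot] := topP pe.
by rewrite bt lp -op eqxx tp.
Qed.

End Cells.

(** * Level dimensions *)

Section Rearrangement.

(* Swapping an adjacent inversion does not decrease the value. *)
Lemma rearrange n (D E : nat -> nat) :
  (forall t, D t.+1 <= D t)%N -> (forall t, (t < n)%N -> (E t <= D t)%N) ->
  exists E', [/\ forall t, (t < n)%N -> (E' t <= D t)%N,
    forall t, (t.+1 < n)%N -> (E' t.+1 <= E' t)%N,
    (\sum_(t < n) E' t = \sum_(t < n) E t)%N &
    (\sum_(t < n) E t * (D t - E t) <= \sum_(t < n) E' t * (D t - E' t))%N].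
Proof.
(* Moving the larger value to the earlier position lowers the weighted sum of the [t * E t], on
   which the induction runs. *)
move=> Dmono; move: {2}(\sum_(t < n) t * E t)%N (leqnn (\sum_(t < n) t * E t)%N) => M.
elim/ltn_ind: M E => M IHM E EM ED.
have [mono|] := classic (forall t, (t.+1 < n)%N -> (E t.+1 <= E t)%N).
  by exists E.
move/not_all_ex_not => [t] /(imply_to_and (t.+1 < n)%N) [tn /negP].
rewrite -ltnNge => Et.
pose E1 s := if s == t then E t.+1 else if s == t.+1 then E t else E s.
pose t1 : 'I_n := Ordinal (ltnW tn); pose t2 : 'I_n := Ordinal tn.
have nt : t2 != t1 by apply/eqP => -[]; lia.
have split2 (F : nat -> nat) : (\sum_(s < n) F s =
    F t + (F t.+1 + \sum_(s < n | (s != t1) && (s != t2)) F s))%N.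
  by rewrite (bigD1 t1) //= (bigD1 t2) //= nt.
have rest (F : nat -> nat -> nat) :
    (\sum_(s < n | (s != t1) && (s != t2)) F s (E1 s) =
     \sum_(s < n | (s != t1) && (s != t2)) F s (E s))%N.
  apply: eq_bigr => s; rewrite -!val_eqE /= /E1 => /andP [/negbTE -> /negbTE ->].
  by [].
have E1t : E1 t = E t.+1 by rewrite /E1 eqxx.
have E1t1 : E1 t.+1 = E t by rewrite /E1 eqxx gtn_eqF.
have D1 := Dmono t; have Et1 := ED _ tn.
have sumE (F : nat -> nat -> nat) : (\sum_(s < n) F s (E1 s) =
    F t (E t.+1) + (F t.+1 (E t) + \sum_(s < n | (s != t1) && (s != t2)) F s (E s)))%N.
  by rewrite (split2 (fun s => F s (E1 s))) E1t E1t1 rest.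
have [||E' [E'D E'mono sumE' valE']] := IHM (\sum_(s < n) s * E1 s)%N _ E1 (leqnn _).
- apply: leq_trans EM.
  by rewrite (sumE (fun s x => s * x)%N) (split2 (fun s => s * E s)%N); nia.
- move=> s sn; rewrite /E1; case: eqP => [->|_]; first by apply: leq_trans Et1 D1.
  by case: eqP => [->|_]; [apply: leq_trans (ltnW Et) Et1|exact: ED].
exists E'; split=> //.
  by rewrite sumE' (sumE (fun _ x => x)) (split2 E); lia.
apply: leq_trans valE'.
rewrite (sumE (fun s x => x * (D s - x))%N) (split2 (fun s => E s * (D s - E s))%N).
rewrite !addnA leq_add2r.
(* The swap gains [(y - x) * (z - w)]; the values are rewritten as sums of their gaps to remove
   truncated subtraction. *)
move: (E t) (E t.+1) (D t) (D t.+1) Et Et1 D1 => x y z w xy yw wz.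
have [a Ea] : exists a, y = (x + a)%N by exists (y - x)%N; lia.
have [b Eb] : exists b, w = (y + b)%N by exists (w - y)%N; lia.
have [c Ec] : exists c, z = (w + c)%N by exists (z - w)%N; lia.
subst y w z.
rewrite (_ : x + a + b + c - x = a + b + c)%N; last by lia.
rewrite (_ : x + a + b - (x + a) = b)%N; last by lia.
rewrite (_ : x + a + b + c - (x + a) = b + c)%N; last by lia.
rewrite (_ : x + a + b - x = a + b)%N; last by lia.
by nia.
Qed.

(* A pair [(x, y)] stands for a level of dimension [x] containing [y] pivots. *)
Definition achievable (ds : seq nat) (d v : nat) : Prop :=
  exists ps : seq (nat * nat), [/\ perm_eq (map fst ps) ds,
    all (fun p => p.2 <= p.1)%N ps, (\sum_(p <- ps) p.2)%N = d &
    (\sum_(p <- ps) p.2 * (p.1 - p.2))%N = v].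

Lemma achievable_perm ds ds' d v :
  perm_eq ds ds' -> achievable ds d v -> achievable ds' d v.
Proof. by move=> Eds [ps [Eps ? ? ?]]; exists ps; split=> //; exact: perm_trans Eds. Qed.

(** A level of dimension zero holds no pivot and contributes nothing, so empty levels may be listed
    freely. *)
Lemma achievable_filter ds d v :
  achievable [seq x <- ds | 0 < x]%N d v <-> achievable ds d v.
Proof.
split=> -[ps [Eps psP psd psv]].
  exists (ps ++ [seq (x, 0%N) | x <- [seq x <- ds | ~~ (0 < x)%N]]); split.
  - rewrite map_cat -map_comp map_id perm_sym -(perm_filterC (fun x => 0 < x)%N ds).
    by rewrite perm_cat2r perm_sym.
  - by rewrite all_cat psP all_map; apply/allP => x.
  - by rewrite big_cat /= big_map [X in (_ + X)%N]big1 ?addn0.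
  - by rewrite big_cat /= big_map [X in (_ + X)%N]big1 ?addn0.
have null p : p \in ps -> ~~ (0 < p.1)%N -> p.2 = 0%N.
  by move=> pin; have /allP/(_ p pin) := psP => /=; lia.
have sumf (F : nat * nat -> nat) : (forall p, p.2 = 0%N -> F p = 0%N) ->
    (\sum_(p <- [seq p <- ps | 0 < p.1]%N) F p = \sum_(p <- ps) F p)%N.
  move=> F0; rewrite big_filter [RHS](bigID (fun p => 0 < p.1)%N) /=.
  rewrite [X in (_ + X)%N](_ : _ = 0%N) ?addn0 // big_seq_cond big1 // => p.
  by case/andP=> pin /(null p pin)/F0.
exists [seq p <- ps | 0 < p.1]%N; split.
- by rewrite -filter_map; apply: perm_filter.
- by rewrite all_filter; apply: sub_all psP => p /= ->; rewrite implybT.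
- by rewrite sumf.
- by rewrite sumf // => p ->; rewrite mul0n.
Qed.

Definition max_achievable ds d r :=
  achievable ds d r /\ forall v, achievable ds d v -> (v <= r)%N.

Lemma max_achievable_perm ds ds' d r :
  perm_eq [seq x <- ds | 0 < x]%N [seq x <- ds' | 0 < x]%N ->
  max_achievable ds d r -> max_achievable ds' d r.
Proof.
move=> Eds [ar rmax]; split=> [|v av].
  apply/achievable_filter; apply: achievable_perm Eds _.
  exact/achievable_filter.
apply: rmax; apply/achievable_filter; rewrite perm_sym in Eds.
by apply: achievable_perm Eds _; apply/achievable_filter.
Qed.

Lemma ex_max_achievable ds d : (d <= sumn ds)%N -> exists r, max_achievable ds d r.
Proof.
move=> d_le.
have [v0 av0] : exists v, achievable ds d v.
  elim: ds d d_le => [|x ds IHds] d /= d_le.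
    exists 0%N, [::]; split=> //; rewrite big_nil //.
    by move: d_le; rewrite leqn0 => /eqP.
  have [|v [ps [Eps psP psd psv]]] := IHds (d - minn d x)%N; first by lia.
  exists (minn d x * (x - minn d x) + v)%N, ((x, minn d x) :: ps); split=> /=.
  - by rewrite perm_cons.
  - by rewrite geq_minr.
  - by rewrite big_cons psd /= subnKC // geq_minl.
  - by rewrite big_cons psv.
have bound v : achievable ds d v -> (v <= d * sumn ds)%N.
  case=> ps [Eps psP psd <-]; rewrite -psd big_distrl /= big_seq [leqRHS]big_seq.
  apply: leq_sum => p pin; rewrite leq_mul2l; apply/orP; right.
  apply: leq_trans (leq_subr _ _) _.
  rewrite -(perm_sumn Eps); elim: (ps) pin => //= q qs IHq.
  by rewrite inE => /predU1P [->|/IHq]; lia.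
pose b v := if excluded_middle_informative (achievable ds d v) then true else false.
have bP v : reflect (achievable ds d v) (b v).
  by rewrite /b; case: excluded_middle_informative => ?; constructor.
have ex_b : exists v, b v by exists v0; apply/bP.
have [r /bP ar rmax] := ex_maxnP ex_b (fun v bv => bound v (elimT (bP v) bv)).
by exists r; split=> // v /bP; apply: rmax.
Qed.

End Rearrangement.

(** * Levels of a Jordan form *)

Section Levels.
Variables (k : closedFieldType) (n : nat) (sz : seq nat) (lam : nat -> k).
Hypothesis sz_n : sumn sz = n.
Implicit Types (S : {set 'I_n}) (i j : 'I_n).

Local Notation blk := (@blk n sz).
Local Notation off := (@off n sz).

Definition level i : k * nat := (lam (blk i), off i).

(** Every eigenvalue is paired with all offsets below [n], including empty levels, so that sums over
    levels become double sums with a fixed range. *)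
Definition levels : seq (k * nat) :=
  [seq (mu, t) | mu <- undup [seq lam b | b <- iota 0 (size sz)], t <- iota 0 n].

Definition in_level S c : nat := #|[set i in S | level i == c]|.

Definition level_sizes : seq nat := [seq in_level setT c | c <- levels].

Lemma levels_uniq : uniq levels.
Proof. by apply: allpairs_uniq; rewrite ?undup_uniq ?iota_uniq // => -[? ?] [? ?]. Qed.

Lemma level_in i : level i \in levels.
Proof.
apply/allpairsP; exists (level i); split=> //.
  by rewrite mem_undup; apply: map_f; rewrite mem_iota blk_lt.
by rewrite mem_iota /=; apply: leq_ltn_trans (ltn_ord i); apply: leq_subr.
Qed.

Lemma sum_by_level S (G : k * nat -> nat) :
  (\sum_(i in S) G (level i) = \sum_(c <- levels) in_level S c * G c)%N.
Proof.
have one i : G (level i) = (\sum_(c <- levels) (level i == c) * G c)%N.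
  rewrite (bigD1_seq (level i)) ?levels_uniq ?level_in //= eqxx mul1n big1 ?addn0 // => c.
  by rewrite eq_sym => /negbTE ->.
under eq_bigr do rewrite one.
rewrite exchange_big /=; apply: eq_bigr => c _; rewrite -big_distrl /=.
congr (_ * _)%N; rewrite /in_level -sum1_card big_mkcond /= [RHS]big_mkcond /=.
by apply: eq_bigr => i _; rewrite inE; case: (i \in S); case: (level i == c).
Qed.

Lemma sum_in_level S : (\sum_(c <- levels) in_level S c = #|S|)%N.
Proof.
rewrite -sum1_card (sum_by_level S (fun _ => 1%N)).
by apply: eq_bigr => c _; rewrite muln1.
Qed.

Lemma in_level_setC S c : in_level (~: S) c = (in_level setT c - in_level S c)%N.
Proof.
rewrite /in_level -(cardsID S [set i in setT | level i == c]) addnC.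
rewrite (_ : [set i in setT | level i == c] :&: S = [set i in S | level i == c]).
  rewrite addnK; congr #|pred_of_set _|; apply/setP => i.
  by rewrite !inE.
by apply/setP => i; rewrite !inE andbC.
Qed.

Lemma in_level_le S c : (in_level S c <= in_level setT c)%N.
Proof. by apply/subset_leq_card/subsetP => i; rewrite !inE => /andP [_]. Qed.

Lemma achievable_in_level S : achievable level_sizes #|S|
  (\sum_(i | i \notin S) in_level S (level i))%N.
Proof.
exists [seq (in_level setT c, in_level S c) | c <- levels]; split.
- by rewrite -map_comp.
- by rewrite all_map; apply/allP => c _; apply: in_level_le.
- by rewrite big_map sum_in_level.
rewrite big_map (eq_bigl (mem (~: S))) => [|i]; last by rewrite !inE.
rewrite (sum_by_level (~: S) (in_level S)); apply: eq_bigr => c _ /=.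
by rewrite mulnC in_level_setC.
Qed.

(** These counts are the parts of the transpose of the partition belonging to [mu]. *)
Lemma in_levelE mu t : in_level setT (mu, t) =
  count (fun b => (lam b == mu) && (t < nth 0 sz b))%N (iota 0 (size sz)).
Proof.
rewrite /in_level cardE -(size_map blk) -size_filter; apply/perm_size/uniq_perm.
- rewrite map_inj_in_uniq ?enum_uniq // => i j; rewrite !mem_enum !inE !xpair_eqE.
  by move=> /and3P [_ _ /eqP oi] /and3P [_ _ /eqP oj] bij; apply: blk_off_inj bij _; rewrite oi.
- by rewrite filter_uniq ?iota_uniq.
move=> b; rewrite mem_filter mem_iota /= add0n; apply/mapP/idP => [[i]|].
  rewrite mem_enum !inE xpair_eqE => /and3P [_ li /eqP <-] ->.
  by rewrite li off_lt // blk_lt.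
case/andP=> /andP [lb tb] bsz; have [i bi oi] := ex_blk_off sz_n bsz tb.
by exists i; rewrite ?bi // mem_enum !inE xpair_eqE bi lb oi /=.
Qed.

Lemma iota_split b b' : (b < b')%N ->
  iota 0 b' = iota 0 b ++ b :: iota b.+1 (b' - b.+1).
Proof.
by move=> lt_b; rewrite -{1}(subnKC (ltnW lt_b)) iotaD add0n -(subnSK lt_b).
Qed.

(** The position of [b] among the blocks with its eigenvalue. Once the sizes are nonincreasing, the
    blocks reaching a level are those of smallest rank. *)
Definition rank_blk (b : nat) : nat := count (fun b' => lam b' == lam b) (iota 0 b).

Lemma rank_blk_lt b b' : lam b = lam b' -> (b < b')%N -> (rank_blk b < rank_blk b')%N.
Proof.
move=> lb lt_b; rewrite /rank_blk (iota_split lt_b) count_cat /= lb eqxx.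
by rewrite addnA addn1 ltnS leq_addr.
Qed.

Lemma rank_blk_inj b b' : lam b = lam b' -> rank_blk b = rank_blk b' -> b = b'.
Proof.
move=> lb rb; case: (ltngtP b b') => // lt_b.
  by have := rank_blk_lt lb lt_b; rewrite rb ltnn.
by have := rank_blk_lt (esym lb) lt_b; rewrite rb ltnn.
Qed.

Hypothesis sz_sorted : sorted geq sz.

Lemma nth_sz_geq b b' : (b <= b')%N -> (nth 0 sz b' <= nth 0 sz b)%N.
Proof.
move=> le_b; case: (ltnP b' (size sz)) => [lt_b|ge_b]; last by rewrite [nth _ _ b']nth_default.
have geq_trans : transitive geq by move=> y x z /= yx zy; exact: leq_trans zy yx.
have geq_refl : reflexive geq by move=> x /=.
exact: (sorted_leq_nth geq_trans geq_refl 0%N sz_sorted b b' (leq_ltn_trans le_b lt_b)).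
Qed.

Lemma rank_blk_level i : (rank_blk (blk i) < in_level setT (level i))%N.
Proof.
rewrite /level in_levelE (iota_split (blk_lt sz_n i)) count_cat /= eqxx off_lt //=.
rewrite addnA addn1 ltnS; apply: leq_trans (leq_addr _ _).
rewrite /rank_blk -!size_filter; apply: eq_leq; congr size; apply: eq_in_filter => b.
rewrite mem_iota /= add0n => lt_b; case: eqP => //= _; apply/esym.
exact: leq_trans (off_lt sz_n i) (nth_sz_geq (ltnW lt_b)).
Qed.

(** The ranks occurring in a level are distinct and bounded by its size, hence they form a full
    initial interval. *)
Lemma card_rank_level mu t x : (x <= in_level setT (mu, t))%N ->
  #|[set i | (level i == (mu, t)) && (rank_blk (blk i) < x)%N]| = x.
Proof.
move=> xD; set S := [set i in setT | level i == (mu, t)].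
pose s := [seq rank_blk (blk i) | i <- enum S].
have us : uniq s.
  rewrite map_inj_in_uniq ?enum_uniq // => i j; rewrite !mem_enum !inE !xpair_eqE /=.
  move=> /andP [/eqP li /eqP oi] /andP [/eqP lj /eqP oj] /rank_blk_inj bij.
  by apply: (@blk_off_inj n sz); rewrite ?oi ?oj // bij // li lj.
have size_s : size s = in_level setT (mu, t) by rewrite size_map -cardE.
have sub_s : {subset s <= iota 0 (in_level setT (mu, t))}.
  move=> _ /mapP [i iS ->]; rewrite mem_iota /= add0n.
  by have := rank_blk_level i; move: iS; rewrite mem_enum !inE /= => /eqP ->.
have ps : perm_eq s (iota 0 (in_level setT (mu, t))).
  apply: uniq_perm; rewrite ?iota_uniq //.
  by have [|_ //] := uniq_min_size us sub_s; rewrite size_iota size_s.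
transitivity (count (fun y => y < x)%N s).
  rewrite count_map -size_filter cardE.
  apply/perm_size/uniq_perm; first exact: enum_uniq.
    by apply: filter_uniq; exact: enum_uniq.
  by move=> i; rewrite mem_enum inE mem_filter mem_enum !inE /= andbC.
rewrite (seq.permP ps) -(subnKC xD) iotaD count_cat add0n.
rewrite (_ : count _ (iota 0 x) = x); last first.
  by rewrite (eq_in_count (a2 := predT)) ?count_predT ?size_iota // => y; rewrite mem_iota.
rewrite (eq_in_count (a2 := pred0)) ?count_pred0 ?addn0 // => y.
by rewrite mem_iota => /andP [xy _] /=; lia.
Qed.

End Levels.

(** * Dimension of the variety of stable subspaces *)

Lemma perm_map_lift (S T : eqType) (f : S -> T) (s : seq S) (t : seq T) :
  perm_eq (map f s) t -> exists2 s', perm_eq s' s & map f s' = t.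
Proof.
case: s => [|x0 s0] E.
  by exists [::] => //; move/perm_size: E; case: t.
set s := x0 :: s0 in E *.
rewrite perm_sym in E; case/(perm_iotaP (f x0)): E => Is PI ->; rewrite size_map in PI.
exists (map (nth x0 s) Is).
  by rewrite -[X in perm_eq _ X](mkseq_nth x0); apply: perm_map.
rewrite -map_comp; apply/eq_in_map => i.
by rewrite (perm_mem PI) mem_iota add0n => /andP [_ lt_i]; rewrite (nth_map x0).
Qed.

Section StableGrassmannian.
Variables (k : closedFieldType) (n : nat) (sz : seq nat) (lam : nat -> k) (d : nat).
Hypothesis sz_n : sumn sz = n.

Local Notation blk := (@blk n sz).
Local Notation off := (@off n sz).
Local Notation J := (bidiag sz (fun i : 'I_n => lam (blk i))).

Variables (A P : 'M[k]_n).
Hypotheses (uP : P \in unitmx) (AE : A = invmx P *m J *m P).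

Lemma trA : A^T = P^T *m J^T *m invmx P^T.
Proof. by rewrite AE !trmx_mul trmx_inv mulmxA. Qed.

Lemma uPT : P^T \in unitmx. Proof. by rewrite unitmx_tr. Qed.

Lemma GrA_Grpt W : GrA d A W -> Grpt d W. Proof. by case. Qed.

Lemma GrA_gen (B : 'M[k]_(d, n)) : row_free B ->
  (GrA d A <<B>>%MS <-> (B *m P^T *m J^T <= B *m P^T)%MS).
Proof.
move=> fB; have stE : (<<B>> *m A^T <= <<B>>)%MS = (B *m P^T *m J^T <= B *m P^T)%MS.
  rewrite genmxE (eqmxMr A^T (genmxE B)) trA !mulmxA.
  apply/idP/idP => [/(submxMr P^T)|/(submxMr (invmx P^T))].
    by rewrite mulmxKV ?uPT.
  by rewrite mulmxK ?uPT.
rewrite -stE; split=> [[]//|st]; split=> //.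
by exists B.
Qed.

Definition extend (e : 'I_d -> 'I_n) (y : {x | x \in params sz lam e} -> k)
  (x : 'I_n * 'I_n) : k := if insub x is Some z then y z else 0.

Lemma extend_params e y x : @extend e y x != 0 -> x \in params sz lam e.
Proof. by rewrite /extend; case: insubP => [z xP _ _|_]; rewrite ?xP ?eqxx. Qed.

Lemma cellmx_subalgebra X (S : (X -> k) -> Prop) (e : 'I_d -> 'I_n)
    (g : X -> 'I_n * 'I_n -> k) a q :
  subalgebra S -> (forall z, S (fun x => g x z)) ->
  S (fun x => cellmx sz e (g x) a q).
Proof.
move=> SS Sg; have [Sc Sa Sm] := SS.
pose t := top sz e (e a); pose m := (off t - off (e a))%N.
have -> : (fun x => cellmx sz e (g x) a q) =
    (fun x => (wrow (g x) t *m shift k n sz m) 0 q).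
  by apply: functional_extensionality => x; rewrite !mxE.
apply: (subalgebra_mulmx (F := fun x => wrow (g x) t) (G := fun _ => shift k n sz m))
  => // i j.
have -> : (fun x => wrow (g x) t i j) = (fun x => (j == t)%:R + g x (t, j)).
  by apply: functional_extensionality => x; rewrite mxE.
by apply: Sa; [exact: Sc|exact: Sg].
Qed.

Lemma card_params_level (e : 'I_d -> 'I_n) : injective e -> down_closed sz e ->
  achievable (level_sizes n sz lam) d #|params sz lam e|.
Proof.
move=> inj_e dce; rewrite card_params //.
have := achievable_in_level lam sz_n [set i in codom e].
rewrite (_ : #|[set i in codom e]| = d); last by rewrite cardsE card_codom // card_ord.
congr achievable; apply: eq_big => [i|q _]; first by rewrite inE.
by congr #|pred_of_set _|; apply/setP => p; rewrite !inE xpair_eqE.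
Qed.

(** A frame of a stable subspace is given by its pivot map, a [d] by [d] multiplier and the free
    coordinates of its cell; the multiplier accounts for the [d * d] of the general bound. *)
Lemma GrA_no_chain r :
  (forall v, achievable (level_sizes n sz lam) d v -> (v <= r)%N) ->
  ~ (exists c, irr_chain d (GrA d A) c r.+1).
Proof.
move=> rmax.
pose Jt (e : {ffun 'I_d -> 'I_n}) : finType :=
  ('I_d * 'I_d + {x | x \in params sz lam e})%type.
pose U e (y : Jt e -> k) : 'M[k]_d := \matrix_(a, b) y (inl (a, b)).
pose Phi e (y : Jt e -> k) :=
  U e y *m cellmx sz e (extend (fun x => y (inr x))) *m invmx P^T.
apply: (no_irr_chain (J := Jt) (Phi := Phi)); first exact: GrA_Grpt.
  move=> e i j; have SS := polynomial_map_subalgebra k (Jt e).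
  have [Sc _ _] := SS.
  have coord z : polynomial_map (fun y : Jt e -> k => y z).
    by exists 1%N; apply: deg_le_coord.
  apply: subalgebra_mulmx => // {}i {}j.
  apply: subalgebra_mulmx => // {}i {}j; last first.
    apply: cellmx_subalgebra => // z; rewrite /extend.
    by case: insub => [w|]; [exact: coord|exact: Sc].
  have := coord (inl (i, j)); congr polynomial_map.
  by apply: functional_extensionality => y; rewrite mxE.
move=> B [fB /(GrA_gen fB) BJ].
have fBP : row_free (B *m P^T).
  by rewrite -row_leq_rank mxrankMfree ?row_free_unit ?uPT // row_leq_rank.
have [e [g [u [inj_e dce gP EB]]]] := stable_cell sz_n fBP BJ.
pose e' : {ffun 'I_d -> 'I_n} := finfun e.
have Ee : e = e' by apply: functional_extensionality => a; rewrite ffunE.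
exists e'.
  rewrite card_sum card_prod !card_ord card_sig leq_add2l; apply: rmax.
  by rewrite -Ee; apply: card_params_level.
exists (fun z : Jt e' => match z with inl ab => u ab.1 ab.2 | inr x => g (val x) end).
rewrite /Phi (_ : U e' _ = u); last by apply/matrixP => a b; rewrite mxE.
rewrite -[B](mulmxK uPT) EB; congr (_ *m _ *m _); rewrite Ee; congr (cellmx _ _ _).
apply: functional_extensionality => x; rewrite /extend.
case: insubP => [z _ <-//|nx]; apply/eqP/negPn/negP => /gP.
by rewrite Ee (negbTE nx).
Qed.

Lemma adj_unit m (M : 'M[k]_m) : M \in unitmx -> \adj M = \det M *: invmx M.
Proof. by move=> uM; rewrite -[LHS](mulmxK uM) mul_adj_mx mul_scalar_mx. Qed.

(** The extra hypothesis says that every free coordinate precedes its pivot. Then all values of the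
    parameters give matrices of the cell, and the cell is a full affine space. *)
Lemma GrA_chain (e : 'I_d -> 'I_n) : injective e -> down_closed sz e ->
  (forall x, x \in params sz lam e -> key sz x.2 < key sz x.1)%N ->
  exists c, irr_chain d (GrA d A) c #|params sz lam e|.
Proof.
move=> inj_e dce keyP.
pose V := {x | x \in params sz lam e}.
have cV : #|{: V}| = #|params sz lam e| by rewrite card_sig.
rewrite -cV.
pose g (y : 'rV[k]_#|{: V}|) := extend (fun x : V => y 0 (enum_rank x)).
have gparams y x : g y x != 0 -> x \in params sz lam e by apply: extend_params.
have gE y (x : V) : g y (val x) = y 0 (enum_rank x) by rewrite /g /extend valK.
have gkey y i q : is_top sz e i -> g y (i, q) != 0 ->
    q \notin codom e /\ (key sz q < key sz i)%N.
  move=> _ /gparams xP; split; last exact: (keyP _ xP).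
  by move: xP; rewrite inE => /and4P [].
have glev y i q : is_top sz e i -> g y (i, q) != 0 ->
    lam (blk q) = lam (blk i) /\ (off q <= off i)%N.
  by move=> _ /gparams; rewrite inE => /and4P [_ _ /eqP -> ->].
have unitU y : colsub e (cellmx sz e (g y)) \in unitmx.
  by apply: cellmx_unit inj_e => //; apply: gkey.
have free_cell y : row_free (cellmx sz e (g y)).
  apply: inj_row_free => u u0; rewrite -[u](mulmxK (unitU y)) mulmx_colsub u0.
  by rewrite linear0 mul0mx.
pose Phi y := cellmx sz e (g y) *m invmx P^T.
have PhiK y : Phi y *m P^T = cellmx sz e (g y) by rewrite /Phi mulmxKV ?uPT.
have idx (x : V) : exists a, e a = (val x).1.
  have := valP x; rewrite inE => /and4P [/is_top_codom/codomP [a Ea] _ _ _].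
  by exists a.
pose ix x := proj1_sig (constructive_indefinite_description _ (idx x)).
have ixE x : e (ix x) = (val x).1 by rewrite /ix; case: constructive_indefinite_description.
pose Bp (B : 'M[k]_(d, n)) := B *m P^T.
(* The adjugate keeps this polynomial in the frame: it is the [j]-th free coordinate of the reduced
   frame, multiplied by the determinant of the pivot columns. *)
pose h (j : 'I_#|{: V}|) (B : 'M[k]_(d, n)) :=
  (\adj (colsub e (Bp B)) *m Bp B) (ix (enum_val j)) (val (enum_val j)).2.
have free_Phi y : row_free (Phi y).
  by rewrite -row_leq_rank mxrankMfree ?row_free_unit ?unitmx_inv ?uPT // row_leq_rank.
apply: (irr_chain_of_cell (Phi := Phi) (h := h)); first exact: GrA_Grpt.
- move=> i j; have SS := @polyfun_subalgebra k 1 #|{: V}|; have [Sc _ _] := SS.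
  apply: (subalgebra_mulmx (F := fun y => cellmx sz e (g y))) => // {}i {}j.
  apply: cellmx_subalgebra => // z; rewrite /g /extend.
  by case: insub => [w|]; [exact: pf_coord|exact: Sc].
- exact: free_Phi.
- move=> y; apply/GrA_gen; first exact: free_Phi.
  by rewrite PhiK; apply: cellmx_stable => //; apply: glev.
- move=> j; have SS := @polyfun_subalgebra k d n; have [Sc _ _] := SS.
  have polB i l : polyfun (fun B => Bp B i l).
    by apply: (subalgebra_mulmx (F := id)) => // *; exact: pf_coord.
  apply: (subalgebra_mulmx (F := fun B => \adj (colsub e (Bp B)))) => // i l.
  apply: (subalgebra_adj (F := fun B => colsub e (Bp B))) => // {}i {}l.
  have := polB i (e l); congr polyfun.
  by apply: functional_extensionality => B; rewrite [RHS]mxE.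
move=> j u y uu; rewrite /h; set x := enum_val j; set a := ix x; set q := (val x).2.
have Ea : e a = (val x).1 by apply: ixE.
have := valP x; rewrite inE -Ea => /and4P [ta qe _ _].
have Et : top sz e (e a) = e a.
  have [tt bt _] := topP sz (codom_f e a).
  by apply: is_top_uniq tt ta bt.
have -> : Bp (u *m Phi y) = u *m cellmx sz e (g y) by rewrite /Bp -mulmxA PhiK.
set M := cellmx sz e (g y); set N := colsub e M.
have uN : N \in unitmx := unitU y.
(* The row of a top pivot is not shifted, so it is a unit vector on the pivot columns; hence
   [invmx N *m M] has the same row [a] as [M]. *)
have rowN : row a N = delta_mx 0 a.
  apply/rowP => b; rewrite !mxE eqxx /=.
  rewrite -[LHS](_ : (wrow (g y) (top sz e (e a)) *m
    shift k n sz (off (top sz e (e a)) - off (e a))) 0 (e b) = _); last by rewrite mxE.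
  rewrite Et subnn shift0 // mulmx1 (wrow_codom (gkey y)) ?codom_f //.
  by rewrite (inj_eq inj_e).
have Maq : M a q = y 0 j.
  rewrite !mxE -[LHS](_ : (wrow (g y) (top sz e (e a)) *m
    shift k n sz (off (top sz e (e a)) - off (e a))) 0 q = _); last by rewrite mxE.
  rewrite Et subnn shift0 // mulmx1 mxE (_ : (q == e a) = false); last first.
    by apply: contraNF qe => /eqP Eq; rewrite -/q Eq; exact: codom_f.
  by rewrite add0r Ea /q -surjective_pairing gE enum_valK.
rewrite -mulmx_colsub -/N adj_unit ?unitmx_mul ?uu // -scalemxAl.
have -> : invmx (u *m N) *m (u *m M) = invmx N *m M.
  apply: (can_inj (mulKmx (_ : u *m N \in unitmx))); first by rewrite unitmx_mul uu.
  by rewrite mulKVmx ?unitmx_mul ?uu // -mulmxA mulKVmx.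
rewrite mxE mulf_eq0.
have /negbTE -> : \det (u *m N) != 0 by rewrite -unitfE -unitmxE unitmx_mul uu.
suff -> : (invmx N *m M) a q = M a q by rewrite Maq.
have : row a (N *m (invmx N *m M)) = row a (invmx N *m M) by rewrite row_mul rowN -rowE.
by rewrite mulKVmx // => /rowP/(_ q); rewrite [in X in X -> _]mxE [row _ _ _ _]mxE => ->.
Qed.

Lemma ex_enumeration (S : {set 'I_n}) : #|S| = d ->
  exists2 e : 'I_d -> 'I_n, injective e & codom e =i S.
Proof.
move=> cS; exists (fun a => enum_val (cast_ord (esym cS) a)).
  by move=> a b /enum_val_inj/cast_ord_inj.
move=> i; apply/codomP/idP => [[a ->]|iS]; first exact: enum_valP.
by exists (cast_ord cS (enum_rank_in iS i)); rewrite cast_ordK enum_rankK_in.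
Qed.

Lemma card_paramsE (e : 'I_d -> 'I_n) (S : {set 'I_n}) :
  codom e =i S -> down_closed sz e -> #|params sz lam e| =
  (\sum_(c <- levels n sz lam) in_level sz lam S c *
     (in_level sz lam [set: 'I_n] c - in_level sz lam S c))%N.
Proof.
move=> eS dce; rewrite card_params // (eq_bigl (mem (~: S))); last first.
  by move=> q; rewrite !inE eS.
rewrite (eq_bigr (fun q => in_level sz lam S (level sz lam q))) => [|q _].
  rewrite sum_by_level //; apply: eq_bigr => c _.
  by rewrite mulnC in_level_setC.
by congr #|pred_of_set _|; apply/setP => p; rewrite !inE xpair_eqE eS.
Qed.

(** An optimal distribution of pivots over the levels is rearranged separately for each eigenvalue
    until it decreases, and then realized by the blocks of smallest rank. *)
Lemma GrA_Grdim r : sorted geq sz ->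
  max_achievable (level_sizes n sz lam) d r -> Grdim d (GrA d A) r.
Proof.
move=> sz_sorted [ar rmax]; split; last exact: GrA_no_chain.
pose D := in_level sz lam [set: 'I_n].
have [ps [Eps psP psd psv]] := ar.
have [ps' Pps' Eps'] := perm_map_lift Eps.
(* The number of pivots that the optimum puts at [c]; the default makes it zero for pairs that are
   not levels. *)
pose E c := (nth (0, 0)%N ps' (index c (levels n sz lam))).2.
have ps'E : ps' = [seq (D c, E c) | c <- levels n sz lam].
  have size_ps' : size ps' = size (levels n sz lam).
    by have := congr1 size Eps'; rewrite !size_map.
  have c0 : k * nat := (0, 0%N).
  apply: (@eq_from_nth _ (0, 0)%N); rewrite ?size_map // => i lt_i.
  rewrite (nth_map c0) -?size_ps' // /E index_uniq ?levels_uniq -?size_ps' //.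
  rewrite [LHS]surjective_pairing; congr (_, _).
  by rewrite -(nth_map _ 0%N fst) // Eps' (nth_map c0) // -size_ps' //.
have ED mu t : (t < n)%N -> (E (mu, t) <= D (mu, t))%N.
  move=> _; case: (boolP ((mu, t) \in levels n sz lam)) => [cin|cout].
    have : all (fun p => p.2 <= p.1)%N ps' by rewrite (perm_all _ Pps').
    by rewrite ps'E all_map => /allP/(_ _ cin).
  by rewrite /E nth_default // ps'E size_map leqNgt index_mem //.
have Dmono mu t : (D (mu, t.+1) <= D (mu, t))%N.
  rewrite /D !in_levelE //; apply: sub_count => b /= /andP [-> /=].
  exact: ltn_trans.
have [E' E'P] : exists E' : k -> nat -> nat, forall mu,
    [/\ forall t, (t < n)%N -> (E' mu t <= D (mu, t))%N,
      forall t, (t.+1 < n)%N -> (E' mu t.+1 <= E' mu t)%N,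
      (\sum_(t < n) E' mu t = \sum_(t < n) E (mu, val t))%N &
      (\sum_(t < n) E (mu, val t) * (D (mu, val t) - E (mu, val t)) <=
       \sum_(t < n) E' mu t * (D (mu, val t) - E' mu t))%N].
  pose R mu := constructive_indefinite_description _ (rearrange (Dmono mu) (ED mu)).
  by exists (fun mu => proj1_sig (R mu)) => mu; exact: proj2_sig (R mu).
have E'mono mu t t' : (t <= t')%N -> (t' < n)%N -> (E' mu t' <= E' mu t)%N.
  move=> le_t; rewrite -(subnKC le_t); elim: (t' - t)%N => [|u IHu] lt_n.
    by rewrite addn0.
  have [_ mono _ _] := E'P mu; rewrite addnS; apply: leq_trans (mono _ _) (IHu _).
    by rewrite -addnS.
  by rewrite (ltn_trans _ lt_n) // addnS.
have off_n (i : 'I_n) : (off i < n)%N.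
  by apply: leq_ltn_trans (ltn_ord i); apply: leq_subr.
(* At each level the longest blocks are taken first; since [E'] decreases with the offset, the
   chosen positions are initial segments of the blocks. *)
pose S := [set i : 'I_n | (rank_blk lam (blk i) < E' (lam (blk i)) (off i))%N].
have inS mu t : (t < n)%N -> in_level sz lam S (mu, t) = E' mu t.
  move=> lt_n; have [E'D _ _ _] := E'P mu.
  rewrite -[RHS](card_rank_level sz_n sz_sorted (E'D t lt_n)).
  congr #|pred_of_set _|; apply/setP => i; rewrite !inE andbC.
  by case: eqP => //= -[<- <-].
have sum_levels (F : k * nat -> nat) : (\sum_(c <- levels n sz lam) F c =
    \sum_(mu <- undup [seq lam b | b <- iota 0 (size sz)]) \sum_(t < n) F (mu, val t))%N.
  rewrite /levels big_allpairs_dep /=; apply: eq_bigr => mu _.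
  by rewrite -(big_mkord xpredT (fun t => F (mu, t))) /index_iota subn0.
have cS : #|S| = d.
  rewrite -psd -(perm_big _ Pps') /= ps'E big_map /= -(sum_in_level lam sz_n) !sum_levels.
  apply: eq_bigr => mu _; have [_ _ <- _] := E'P mu.
  by apply: eq_bigr => t _; rewrite inS ?ltn_ord.
have [e inj_e eS] := ex_enumeration cS.
have dce : down_closed sz e.
  move=> i j; rewrite !eS !inE => iS bj oj; rewrite bj.
  by apply: leq_trans iS _; apply: E'mono.
(* At equal offsets a non-pivot has larger rank than a pivot, hence lies in a later block, and later
   blocks have the smaller [key]. *)
have keyP x : x \in params sz lam e -> (key sz x.2 < key sz x.1)%N.
  rewrite inE => /and4P [/is_top_codom]; rewrite !eS !inE -leqNgt => x1 x2 /eqP l12.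
  rewrite leq_eqVlt key_lt // => /predU1P [o12|->//]; rewrite o12 eqxx ltnn /=.
  rewrite -l12 o12 in x2; have x12 := leq_trans x1 x2.
  rewrite ltnNge leq_eqVlt; apply/negP => /predU1P [b12|lt_b].
    by rewrite b12 ltnn in x12.
  by have := ltn_trans (rank_blk_lt (esym l12) lt_b) x12; rewrite ltnn.
(* The count is achievable, hence at most [r]; the rearrangement did not lower the value, hence it
   is at least [r]. *)
suff <- : #|params sz lam e| = r by apply: GrA_chain.
apply/eqP; rewrite eqn_leq; apply/andP; split.
  by apply: rmax; apply: card_params_level.
rewrite (card_paramsE eS dce) -psv -(perm_big _ Pps') /= ps'E big_map /= !sum_levels.
apply: leq_sum => mu _; have [_ _ _ le_v] := E'P mu.
by apply: leq_trans le_v _; apply: eq_leq; apply: eq_bigr => t _; rewrite inS ?ltn_ord.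
Qed.

End StableGrassmannian.

(** * Centralizers *)

Section Centralizer.
Variables (k : closedFieldType) (n : nat).

(** The two hypotheses say that reading the entries in [I] is injective and surjective on the
    commutant of [J]; conjugation by [P] carries this to the centralizer of [A]. *)
Lemma centralizer_dim_coords (A J P : 'M[k]_n) (I : {set 'I_n * 'I_n}) :
  P \in unitmx -> A = invmx P *m J *m P ->
  (forall Y : 'M[k]_n, Y *m J = J *m Y ->
     (forall p, p \in I -> Y p.1 p.2 = 0) -> Y = 0) ->
  (forall p, p \in I -> exists Y : 'M[k]_n, Y *m J = J *m Y /\
     forall q, q \in I -> Y q.1 q.2 = (q == p)%:R) ->
  centralizer_dim A = #|I|.
Proof.
move=> uP AE coords0 ex_coord.
pose f : {linear 'M[k]_n -> 'M[k]_n} := mulmxr A \- mulmx A.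
pose conj : {linear 'M[k]_n -> 'M[k]_n} := mulmxr (invmx P) \o mulmx P.
have -> : centralizer_dim A = \rank (kermx (lin_mx f)) by [].
pose G0 : 'M[k]_(n * n, #|I|) := \matrix_(r, b)
  (r == mxvec_index (enum_val b).1 (enum_val b).2)%:R.
pose G := lin_mx conj *m G0.
have GE X b : (mxvec X *m G) 0 b = (P *m X *m invmx P) (enum_val b).1 (enum_val b).2.
  rewrite mulmxA mul_vec_lin /= mxE.
  rewrite (bigD1 (mxvec_index (enum_val b).1 (enum_val b).2)) //= mxE eqxx mulr1 mxvecE.
  by rewrite big1 ?addr0 // => r /negbTE nr; rewrite mxE nr mulr0.
have commE X : (mxvec X *m lin_mx f == 0) = (X *m A == A *m X).
  rewrite mul_vec_lin (can2_eq (mxvecK (m := n) (n := n)) (vec_mxK (m := n) (n := n))).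
  by rewrite linear0 /= subr_eq0.
have commP X : X *m A = A *m X <->
    (P *m X *m invmx P) *m J = J *m (P *m X *m invmx P).
  rewrite AE; split=> E.
    have := congr1 (fun M => P *m M *m invmx P) E.
    by rewrite !mulmxA mulmxV // mul1mx mulmxK.
  have := congr1 (fun M => invmx P *m M *m P) E.
  by rewrite !mulmxA mulVmx // mul1mx mulmxKV.
apply/eqP; rewrite eqn_leq; apply/andP; split.
  suff /eqP <- : row_free (row_base (kermx (lin_mx f)) *m G) by apply: rank_leq_col.
  apply: inj_row_free => u; rewrite mulmxA; set w := u *m _ => w0.
  have : (w <= kermx (lin_mx f))%MS by rewrite -(eq_row_base (kermx _)) submxMl.
  rewrite -(vec_mxK w) in w0 *; set X := vec_mx w in w0 *.
  move/sub_kermxP/eqP; rewrite commE => /eqP /commP comm.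
  have X0 : P *m X *m invmx P = 0.
    apply: coords0 comm _ => p pI; have /rowP/(_ (enum_rank_in pI p)) := w0.
    by rewrite GE enum_rankK_in // => ->; rewrite mxE.
  have w00 : w = 0.
    rewrite -(vec_mxK w) -/X -[X](mulKmx uP) -[P *m X](mulmxKV uP) X0.
    by rewrite mul0mx mulmx0 linear0.
  have fb := row_base_free (kermx (lin_mx f)).
  by rewrite -[u]mulmx1 -(mulmxVp fb) mulmxA -/w w00 mul0mx.
pose Y b := constructive_indefinite_description _ (ex_coord _ (enum_valP b)).
pose L : 'M[k]_(#|I|, n * n) :=
  \matrix_b mxvec (invmx P *m proj1_sig (Y b) *m P).
have rowLG b : row b L *m G = delta_mx 0 b.
  apply/rowP => c; rewrite rowK GE !mulmxA mulmxV // mul1mx mulmxK //.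
  case: (Y b) => Yb /= [_ Ycoord]; rewrite Ycoord ?enum_valP // mxE eqxx /=.
  by rewrite (inj_eq enum_val_inj).
have LG : L *m G = 1%:M by apply/row_matrixP => b; rewrite row_mul rowLG row1.
have /eqP <- : row_free L.
  apply: inj_row_free => u u0.
  by rewrite -[u]mulmx1 -LG mulmxA u0 mul0mx.
apply: mxrankS; apply/row_subP => b; rewrite rowK; apply/sub_kermxP/eqP.
rewrite commE; apply/eqP/commP; case: (Y b) => Yb /= [comm _].
suff -> : P *m (invmx P *m Yb *m P) *m invmx P = Yb by [].
by rewrite !mulmxA mulmxV // mul1mx mulmxK.
Qed.

Variables (sz : seq nat) (lam : nat -> k).
Hypothesis sz_n : sumn sz = n.
Implicit Types (i j : 'I_n) (Y : 'M[k]_n).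
Local Notation blk := (@blk n sz).
Local Notation off := (@off n sz).
Local Notation J := (bidiag sz (fun i : 'I_n => lam (blk i))).
Local Notation N := (shift k n sz 1)^T.

Definition is_last i := (off i).+1 == nth 0%N sz (blk i).

Lemma mulmx_NP m (Y : 'M[k]_(m, n)) (i : 'I_m) j :
  (exists j', [/\ blk j' = blk j, off j = (off j').+1 & (Y *m N) i j = Y i j']) \/
  off j = 0%N /\ (Y *m N) i j = 0.
Proof.
case: (posnP (off j)) => [o0|o_gt0].
  right; split=> //; rewrite mxE big1 // => l _.
  by rewrite !mxE o0 addn1 andbF mulr0.
left; have [||j' bj oj] := @ex_blk_off n sz sz_n (blk j) (off j).-1.
- exact: blk_lt.
- by apply: leq_ltn_trans (off_lt sz_n j); lia.
exists j'; split=> //; first by rewrite oj prednK.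
rewrite mxE (bigD1 j') //= !mxE bj oj addn1 prednK // !eqxx mulr1.
rewrite big1 ?addr0 // => l nl; rewrite !mxE.
case: andP => [[/eqP bl /eqP ol]|_]; last by rewrite mulr0.
by case/eqP: nl; apply: (@blk_off_inj n sz); rewrite ?bj ?oj ?bl // ol addn1.
Qed.

Lemma N_mulmxP Y i j :
  (exists i', [/\ blk i' = blk i, off i' = (off i).+1 & (N *m Y) i j = Y i' j]) \/
  is_last i /\ (N *m Y) i j = 0.
Proof.
have := off_lt sz_n i; rewrite leq_eqVlt => /predU1P [last_i|lt_i].
  right; split; first exact/eqP.
  rewrite mxE big1 // => l _; rewrite !mxE.
  case: andP => [[/eqP bl /eqP ol]|_]; last by rewrite mul0r.
  by have := off_lt sz_n l; rewrite ol bl -last_i addn1 ltnn.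
left; have [||i' bi oi] := @ex_blk_off n sz sz_n (blk i) (off i).+1 => //.
  exact: blk_lt.
exists i'; split=> //; rewrite mxE (bigD1 i') //= !mxE bi oi addn1 !eqxx mul1r.
rewrite big1 ?addr0 // => l nl; rewrite !mxE.
case: andP => [[/eqP bl /eqP ol]|_]; last by rewrite mul0r.
by case/eqP: nl; apply: (@blk_off_inj n sz); rewrite ?bi ?oi ?bl // ol addn1.
Qed.

Lemma bidiagE (a : 'I_n -> k) : bidiag sz a = diag_mx (\row_i a i) + N.
Proof. by rewrite -[LHS]trmxK tr_bidiag linearD /= tr_diag_mx. Qed.

Lemma comm_bidiagP Y : Y *m J = J *m Y <-> forall i j,
  Y i j * lam (blk j) + (Y *m N) i j = lam (blk i) * Y i j + (N *m Y) i j.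
Proof.
have entry i j : (Y *m J) i j = Y i j * lam (blk j) + (Y *m N) i j /\
    (J *m Y) i j = lam (blk i) * Y i j + (N *m Y) i j.
  rewrite bidiagE mulmxDr mulmxDl mul_mx_diag mul_diag_mx.
  by split; rewrite [LHS]mxE; congr (_ + _); rewrite !mxE.
split=> [E i j|E]; first by have [<- <-] := entry i j; rewrite E.
by apply/matrixP => i j; have [-> ->] := entry i j.
Qed.

(** A commuting matrix is constant along the diagonals of each pair of blocks with the same
    eigenvalue, so its entries in the last column of each block determine it; the offset condition
    keeps the diagonals that need not vanish. *)
Definition commutant_coords : {set 'I_n * 'I_n} :=
  [set p | [&& is_last p.2, lam (blk p.1) == lam (blk p.2) & (off p.1 <= off p.2)%N]].

Lemma commutant_coords0 Y : Y *m J = J *m Y ->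
  (forall p, p \in commutant_coords -> Y p.1 p.2 = 0) -> Y = 0.
Proof.
move=> /comm_bidiagP comm Y0.
(* The equation at [(i, j)] gives a nonzero multiple of this entry in terms of the entry to its left
   and the entry below, so the induction moves left or down. *)
have diff i j : lam (blk i) != lam (blk j) -> Y i j = 0.
  move: {2}(off j + (nth 0 sz (blk i) - off i))%N
    (leqnn (off j + (nth 0 sz (blk i) - off i))%N) => m.
  elim: m i j => [|m IHm] i j le_m nlam.
    by have := off_lt sz_n i; lia.
  have YN0 : (Y *m N) i j = 0.
    have [[j' [bj oj ->]]|[]//] := mulmx_NP Y i j.
    by apply: IHm; rewrite ?bj //; lia.
  have NY0 : (N *m Y) i j = 0.
    have [[i' [bi oi ->]]|[]//] := N_mulmxP Y i j.
    by apply: IHm; rewrite ?bi //; have := off_lt sz_n i; lia.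
  have /eqP := comm i j; rewrite YN0 NY0 !addr0 mulrC -subr_eq0 -mulrBl mulf_eq0.
  by rewrite subr_eq0 eq_sym (negbTE nlam) => /eqP.
have same i j : lam (blk i) = lam (blk j) -> (Y *m N) i j = (N *m Y) i j.
  by move=> lij; have := comm i j; rewrite lij mulrC => /addrI.
(* The entry equals the one up and to the left; as its row offset is larger, the diagonal runs into
   the first column, where [Y *m N] vanishes. *)
have upper i j : lam (blk i) = lam (blk j) -> (off j < off i)%N -> Y i j = 0.
  move: {2}(off j) (erefl (off j)) => m; elim/ltn_ind: m i j => m IHm i j om lij lt_ij.
  have [||i' bi oi] := @ex_blk_off n sz sz_n (blk i) (off i).-1.
  - exact: blk_lt.
  - by apply: leq_ltn_trans (off_lt sz_n i); lia.
  have lij' : lam (blk i') = lam (blk j) by rewrite bi.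
  have := same i' j lij'.
  have [[i2 [b2 o2 ->]]|[/eqP li _]] := N_mulmxP Y i' j; last first.
    by have := off_lt sz_n i; rewrite -bi -li oi; lia.
  have -> : i2 = i by apply: (@blk_off_inj n sz); rewrite ?b2 // o2 oi; lia.
  have [[j' [bj oj ->]]|[oj -> <-//]] := mulmx_NP Y i' j => <-.
  by apply: (IHm (off j')); rewrite ?bj ?bi //; lia.
(* Going down and to the right instead, the diagonal ends at a prescribed entry of the last column
   or leaves through the last row, where [N *m Y] vanishes. *)
have lower i j : lam (blk i) = lam (blk j) -> Y i j = 0.
  move: {2}(nth 0 sz (blk j) - off j)%N (leqnn (nth 0 sz (blk j) - off j)%N) => m.
  elim: m i j => [|m IHm] i j le_m lij; first by have := off_lt sz_n j; lia.
  case: (ltnP (off j) (off i)) => [/upper|le_ij]; first exact.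
  have := off_lt sz_n j; rewrite leq_eqVlt => /predU1P [last_j|lt_j].
    by apply: (Y0 (i, j)); rewrite inE /= /is_last last_j eqxx lij eqxx.
  have [||j' bj oj] := @ex_blk_off n sz sz_n (blk j) (off j).+1 => //.
    exact: blk_lt.
  have lij' : lam (blk i) = lam (blk j') by rewrite bj.
  have := same i j' lij'.
  have [[j2 [b2 o2 ->]]|[oj0]] := mulmx_NP Y i j'; last by rewrite oj0 in oj.
  have -> : j2 = j by apply: (@blk_off_inj n sz); rewrite ?b2 //; lia.
  have [[i' [bi oi ->]]|[_ ->//]] := N_mulmxP Y i j' => ->.
  by apply: IHm; rewrite ?bi // bj; lia.
apply/matrixP => i j; rewrite mxE.
by have [/lower|/diff] := eqVneq (lam (blk i)) (lam (blk j)).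
Qed.

Lemma commutant_coords_ex p : p \in commutant_coords ->
  exists Y, Y *m J = J *m Y /\
    forall q, q \in commutant_coords -> Y q.1 q.2 = (q == p)%:R.
Proof.
case: p => i0 j0; rewrite inE /= => /and3P [/eqP last0 /eqP l0 le0].
(* A single diagonal of ones through [(i0, j0)] inside one pair of blocks. *)
pose Y : 'M[k]_n := \matrix_(i, j) ([&& blk i == blk i0, blk j == blk j0
  & off i + off j0 == off j + off i0]%N)%:R.
exists Y; split.
  apply/comm_bidiagP => i j.
  have -> : Y i j * lam (blk j) = lam (blk i) * Y i j.
    rewrite mxE; case: and3P => [[/eqP -> /eqP -> _]|_]; last by rewrite mul0r mulr0.
    by rewrite l0 mulrC.
  congr (_ + _); have oj := off_lt sz_n j.
  (* The mixed cases are the borders of the block pair. [last0] keeps the diagonal from leaving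
     through the last row before the last column, and [le0] from entering through the first column
     below the first row. *)
  have [[j' [bj oj' ->]]|[oj0 ->]] := mulmx_NP Y i j;
  have [[i' [bi oi' ->]]|[/eqP li ->]] := N_mulmxP Y i j; rewrite ?mxE ?bi ?bj.
  - by congr (nat_of_bool _)%:R; do 2 congr (_ && _); lia.
  - case: and3P => // -[/eqP bi0 /eqP bj0 /eqP E].
    have oi0 := off_lt sz_n i0; rewrite bi0 in li; rewrite bj0 in oj.
    by exfalso; lia.
  - case: and3P => // -[/eqP bi0 /eqP bj0 /eqP E].
    by exfalso; lia.
  - by [].
move=> [i j]; rewrite inE /= => /and3P [/eqP lj /eqP lij le].
rewrite mxE xpair_eqE; congr (nat_of_bool _)%:R.
apply/and3P/andP => [[/eqP bi /eqP bj /eqP E]|[/eqP -> /eqP ->]]; last first.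
  by rewrite !eqxx addnC.
have oj : off j = off j0 by rewrite bj -last0 in lj; case: lj.
split; apply/eqP; last exact: (blk_off_inj bj oj).
by apply: (blk_off_inj bi); lia.
Qed.

(** The sum of squares counts pairs [(i, l)] on a common level; replacing [l] by the last position
    of its block is a bijection onto the coordinates. *)
Lemma card_commutant_coords :
  #|commutant_coords| = (\sum_(x <- level_sizes n sz lam) x ^ 2)%N.
Proof.
rewrite /level_sizes big_map.
under eq_bigr do rewrite -mulnn.
rewrite -(sum_by_level lam sz_n setT (in_level sz lam setT)).
pose T (i : 'I_n) := [set l in [set: 'I_n] | level sz lam l == level sz lam i].
(* For the pivot map [id] every position is a pivot, so [top] is the end of the block. *)
have topP' l : [/\ is_last (top sz id l), blk (top sz id l) = blk l
    & (off l <= off (top sz id l))%N].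
  have [|/andP [_ /forallP tt] bt ot] := @topP n sz n id l; first exact: codom_f id l.
  split=> //; rewrite /is_last eqn_leq off_lt //= leqNgt; apply/negP => lt_o.
  have [||i bi oi] := @ex_blk_off n sz sz_n (blk (top sz id l)) (off (top sz id l)).+1 => //.
    exact: blk_lt.
  have := tt i; rewrite (codom_f id i) bi eqxx /= oi; lia.
have inj_top i : {in T i &, injective (top sz id)}.
  move=> l l'; rewrite !inE /= !xpair_eqE => /andP [_ /eqP ol] /andP [_ /eqP ol'] E.
  apply: (@blk_off_inj n sz); last by rewrite ol ol'.
  by have [_ <- _] := topP' l; have [_ <- _] := topP' l'; rewrite E.
rewrite (eq_bigl xpredT) => [|i]; last by rewrite inE.
rewrite (eq_bigr (fun i => \sum_(j in top sz id @: T i) 1)%N) => [|i _]; last first.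
  by rewrite sum1_card card_in_imset.
rewrite pair_big_dep /= -sum1_card; apply: eq_bigl => -[i j] /=.
rewrite inE /=; apply/and3P/imsetP => [[/eqP lj /eqP lij le]|[l]].
  have [||l bl ol] := @ex_blk_off n sz sz_n (blk j) (off i).
  - exact: blk_lt.
  - exact: leq_ltn_trans le (off_lt sz_n j).
  exists l; first by rewrite !inE /= xpair_eqE bl ol lij !eqxx.
  have [/eqP lt bt ot] := topP' l.
  apply: (@blk_off_inj n sz); first by rewrite bt bl.
  by move: lj; rewrite -bl -bt -lt => -[].
rewrite !inE /= xpair_eqE => /andP [/eqP ll /eqP ol] ->.
by have [lt bt ot] := topP' l; rewrite lt bt ll eqxx -ol ot.
Qed.

Lemma centralizer_dim_bidiag (A P : 'M[k]_n) :
  P \in unitmx -> A = invmx P *m J *m P ->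
  centralizer_dim A = (\sum_(x <- level_sizes n sz lam) x ^ 2)%N.
Proof.
move=> uP AE; rewrite -card_commutant_coords.
exact: centralizer_dim_coords uP AE commutant_coords0 commutant_coords_ex.
Qed.

End Centralizer.

(** * Jordan forms *)

Section JordanForms.
Variable k : closedFieldType.

Lemma similar_trans n (A B C : 'M[k]_n) : Defs.similar A B -> Defs.similar B C -> Defs.similar A C.
Proof.
move=> [P uP ->] [Q uQ ->].
have uQP : Q *m P \in unitmx by rewrite unitmx_mul uQ.
exists (Q *m P) => //; have -> : invmx (Q *m P) = invmx P *m invmx Q.
  have E1 : invmx P *m invmx Q *m (Q *m P) = 1%:M by rewrite -mulmxA mulKmx // mulVmx.
  by rewrite -[RHS](mulmxK uQP) E1 mul1mx.
by rewrite !mulmxA.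
Qed.

Lemma jblkE (bl : seq (k * nat)) i : (i < sumn (map snd bl))%N ->
  jblk bl i = reshape_index (map snd bl) i.
Proof.
set sz := map snd bl => lt_i; set r := reshape_index sz i.
have r_lt : (r < size bl)%N by rewrite -(size_map snd) reshape_indexP.
have := reshape_indexK sz i; rewrite /flatten_index -/r => Ei.
have := reshape_offsetP lt_i; rewrite -/r => lt_o.
have Pr : (i < sumn (take r.+1 sz))%N.
  by rewrite (take_nth 0%N) ?size_map // sumn_rcons -{1}Ei ltn_add2l.
have nP t : (t < r)%N -> (i < sumn (take t.+1 sz))%N = false.
  move=> lt_t; apply/negbTE; rewrite -leqNgt -{1}Ei.
  rewrite -(cat_take_drop t.+1 (take r sz)) take_takel // sumn_cat -addnA.
  exact: leq_addr.
rewrite /jblk -/sz (iota_split r_lt) find_cat ifF; first by rewrite size_iota /= Pr addn0.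
by apply/negbTE/hasPn => t; rewrite mem_iota add0n /= => /nP ->.
Qed.

Lemma jordan_mxE n (bl : seq (k * nat)) : sumn (map snd bl) = n ->
  jordan_mx n bl = bidiag (map snd bl)
    (fun i : 'I_n => fst (nth (0 : k, 0%N) bl (blk (map snd bl) i))).
Proof.
move=> sz_n; have jE (i : 'I_n) : jblk bl i = blk (map snd bl) i.
  by rewrite jblkE // sz_n.
apply/matrixP => i j; rewrite !mxE !jE; case: eqP => // _.
by rewrite nat_succ_blk //; case: (_ && _).
Qed.

Lemma stable_eigenvector n r (K : 'M[k]_(r, n)) (M : 'M[k]_n) :
  (K *m M <= K)%MS -> K != 0 ->
  exists mu (w : 'rV[k]_n), [/\ (w <= K)%MS, w != 0 & w *m M = mu *: w].
Proof.
move=> KM K0; have r0 : (0 < \rank K)%N by rewrite lt0n mxrank_eq0.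
have KbM : (row_base K *m M <= row_base K)%MS.
  by rewrite (eqmxMr _ (eq_row_base K)) eq_row_base.
pose R := row_base K *m M *m pinvmx (row_base K).
have RE : R *m row_base K = row_base K *m M by rewrite mulmxKpV.
have /closed_rootP [mu] : size (char_poly R) != 1%N.
  by rewrite size_char_poly eqSS -lt0n.
rewrite -eigenvalue_root_char => /eigenvalueP [x Ex x0].
exists mu, (x *m row_base K); split.
- by rewrite (submx_trans (submxMl _ _)) // eq_row_base.
- apply: contra_neq x0 => xK; rewrite -[x]mulmx1 -(mulmxVp (row_base_free K)).
  by rewrite mulmxA xK mul0mx.
- by rewrite -mulmxA -RE mulmxA Ex scalemxAl.
Qed.

Section Chains.
Variables (n : nat) (A : 'M[k]_n) (T : eqType) (cs : seq T).
Variables (la : T -> k) (sz : T -> nat) (v : T -> 'rV[k]_n).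

Definition chain c s : 'rV[k]_n := iter s (mulmxr (A - (la c)%:M)) (v c).

Hypothesis cs_uniq : uniq cs.
Hypothesis cs_n : sumn (map sz cs) = n.
Hypothesis chain_end : forall c, c \in cs -> chain c (sz c) = 0.
Hypothesis last_indep : forall mu (u : T -> k),
  \sum_(c <- cs | la c == mu) u c *: chain c (sz c).-1 = 0 ->
  forall c, c \in cs -> la c = mu -> u c = 0.

(* A kernel of the transition matrix would contain an eigenvector of the Jordan
   matrix, which only involves the last vectors of the chains. *)
Lemma similar_of_chains :
  Defs.similar A (jordan_mx n [seq (la c, sz c) | c <- cs]).
Proof.
have Esz : map snd [seq (la c, sz c) | c <- cs] = map sz cs by rewrite -map_comp.
rewrite jordan_mxE Esz //.
case Ecs: cs => [|c0 cs'].
  exists 1%:M; rewrite ?unitmx1 //; apply/matrixP => i.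
  by suff : (i < 0)%N by []; rewrite -[X in (_ < X)%N]/(sumn (map sz [::])) -Ecs cs_n.
rewrite -Ecs; set J := bidiag _ _.
pose b (i : 'I_n) := blk (map sz cs) i; pose o (i : 'I_n) := off (map sz cs) i.
pose C i := nth c0 cs (b i).
have b_lt i : (b i < size cs)%N by rewrite -(size_map sz) blk_lt.
have C_in i : C i \in cs by rewrite mem_nth.
have nth_sz i : nth 0%N (map sz cs) (b i) = sz (C i) by rewrite (nth_map c0).
have o_lt i : (o i < sz (C i))%N by rewrite -nth_sz off_lt.
have JE : J = diag_mx (\row_i la (C i)) + (shift k n (map sz cs) 1)^T.
  rewrite /J bidiagE; congr (diag_mx _ + _); apply/rowP => i; rewrite !mxE.
  by rewrite (nth_map c0) ?b_lt.
pose P : 'M[k]_n := \matrix_i chain (C i) (o i).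
have PE : J *m P = P *m A.
  apply/row_matrixP => i; rewrite !row_mul rowK.
  have Ji : row i J = la (C i) *: delta_mx 0 i +
      row i (shift k n (map sz cs) 1)^T.
    rewrite JE linearD /= row_diag_mx; congr (_ + _).
    by apply/rowP => j; rewrite !mxE eqxx /=; case: (j == i); rewrite ?mulr1 ?mulr0.
  rewrite Ji mulmxDl -scalemxAl -rowE rowK.
  have -> : chain (C i) (o i) *m A =
      la (C i) *: chain (C i) (o i) + chain (C i) (o i).+1.
    by rewrite /chain iterS /= mulmxBr mul_mx_scalar [RHS]addrC subrK.
  congr (_ + _); apply/rowP => j; rewrite -row_mul [LHS]mxE.
  have [[i' [bi oi ->]]|[/eqP li ->]] := N_mulmxP cs_n P i j.
    by rewrite mxE /o oi /C /b bi.
  by rewrite /o li nth_sz chain_end ?mxE.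
have uP : P \in unitmx.
  rewrite -row_free_unit -kermx_eq0; apply/negPn/negP => K0.
  have [|mu [w [wK w0 Ew]]] := @stable_eigenvector n n (kermx P) J _ K0.
    by apply/sub_kermxP; rewrite -mulmxA PE mulmxA mulmx_ker mul0mx.
  have wP : w *m P = 0 by apply/sub_kermxP.
  have entry j : w 0 j * la (C j) + (w *m (shift k n (map sz cs) 1)^T) 0 j = mu * w 0 j.
    by have /rowP/(_ j) := Ew; rewrite JE mulmxDr mul_mx_diag !mxE.
  have w_diff j : la (C j) != mu -> w 0 j = 0.
    move: {2}(o j) (erefl (o j)) => m; elim: m j => [|m IHm] j om nla.
    - have := entry j; have [[j' [_ oj _]]|[_ ->]] := mulmx_NP cs_n w 0 j.
        by rewrite /o oj in om.
      rewrite addr0 mulrC => /eqP; rewrite -subr_eq0 -mulrBl mulf_eq0 subr_eq0.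
      by rewrite (negbTE nla) => /eqP.
    - have := entry j; have [[j' [bj oj ->]]|[oj _]] := mulmx_NP cs_n w 0 j.
        rewrite (IHm j'); [|by move: om; rewrite /o oj => -[]|by rewrite /C /b bj].
        rewrite addr0 mulrC => /eqP; rewrite -subr_eq0 -mulrBl mulf_eq0 subr_eq0.
        by rewrite (negbTE nla) => /eqP.
      by rewrite /o oj in om.
  (* The eigenvector equation one position further along the chain has the two terms in [mu]
     cancelling, and leaves [w 0 i = 0]. *)
  have w_same i : la (C i) = mu -> (o i).+1 != sz (C i) -> w 0 i = 0.
    move=> lai nlast; have lt_o : ((o i).+1 < nth 0%N (map sz cs) (b i))%N.
      by rewrite nth_sz ltn_neqAle nlast o_lt.
    have [|j bj oj] := ex_blk_off cs_n _ lt_o; first by rewrite size_map.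
    have Cj : C j = C i by rewrite /C /b bj.
    have := entry j.
    have [[i' [bi oi ->]]|[oj0 _]] := mulmx_NP cs_n w 0 j; last first.
      by rewrite oj0 in oj.
    have -> : i' = i.
      by apply: (@blk_off_inj n (map sz cs)); rewrite ?bi //; move: oi; rewrite oj => -[].
    by rewrite Cj lai mulrC => /eqP; rewrite -subr_eq0 addrC addKr => /eqP.
  pose last i := (o i).+1 == sz (C i).
  (* Since [cs] has no repetition each sum has a single term, the coefficient at the end of the
     chain. *)
  pose u c := \sum_(i | (C i == c) && last i) w 0 i.
  have u0 : forall c, c \in cs -> la c = mu -> u c = 0.
    apply: last_indep; rewrite -[RHS]wP mulmx_sum_row.
    rewrite (eq_bigr (fun i => \sum_(c <- cs) if C i == c then w 0 i *: row i P else 0)); last first.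
      move=> i _; rewrite (bigD1_seq (C i)) ?C_in //= eqxx big1 ?addr0 // => c.
      by rewrite eq_sym => /negbTE ->.
    rewrite exchange_big /= big_mkcond /=; apply: eq_bigr => c _.
    rewrite -big_mkcond /=; case: eqP => [lac|nlac]; last first.
      by rewrite big1 // => i /eqP Ci; rewrite w_diff ?scale0r // Ci; apply/eqP.
    rewrite /u scaler_suml [RHS](bigID last) /= [X in _ = _ + X]big1 ?addr0 => [|i /andP [/eqP Ci nl]].
      by apply: eq_bigr => i /andP [/eqP Ci /eqP li]; rewrite rowK Ci -[o i]/((o i).+1.-1) li Ci.
    by rewrite w_same ?scale0r // Ci.
  case/eqP: w0; apply/rowP => i; rewrite [RHS]mxE.
  have [lai|/w_diff //] := eqVneq (la (C i)) mu.
  have [li|/(w_same _ lai) //] := boolP (last i).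
  have := u0 _ (C_in i) lai; rewrite /u (big_pred1 i) // => j /=.
  apply/andP/eqP => [[/eqP Cj lj]|->]; last by rewrite eqxx.
  have bj : b j = b i by apply/eqP; rewrite -(nth_uniq c0 (b_lt j) (b_lt i) cs_uniq) -/(C j) Cj.
  apply: (@blk_off_inj n (map sz cs)) => //.
  by have := eqP lj; rewrite Cj -(eqP li) => -[].
by exists P => //; rewrite -mulmxA PE mulKmx.
Qed.

End Chains.
End JordanForms.

(** * Jordan form of a bidiagonal matrix *)

Section CyclicBlocks.
Variables (k : closedFieldType) (n : nat) (sz : seq nat).
Hypothesis sz_n : sumn sz = n.+1.
Variable al : nat -> nat -> k.

Local Notation blk := (@blk n.+1 sz).
Local Notation off := (@off n.+1 sz).
Local Notation B := (bidiag sz (fun i : 'I_n.+1 => al (blk i) (off i))).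

Definition unit_row b t : 'rV[k]_n.+1 := \row_j ((blk j == b) && (off j == t))%:R.

Lemma unit_rowE b t j : unit_row b t 0 j = ((blk j == b) && (off j == t))%:R.
Proof. by rewrite mxE. Qed.

(* The block [b] is a cyclic module generated by its first basis vector. *)
Definition cyc (h : {poly k}) b : 'rV[k]_n.+1 := unit_row b 0 *m horner_mx B h.

Lemma mul_bidiag_entry (x : 'rV[k]_n.+1) j :
  (x *m B) 0 j = x 0 j * al (blk j) (off j) + (x *m (shift k n.+1 sz 1)^T) 0 j.
Proof. by rewrite bidiagE mulmxDr mul_mx_diag !mxE. Qed.

Lemma cycM h a b : cyc (h * ('X - a%:P)) b = mulmxr (B - a%:M) (cyc h b).
Proof.
by rewrite /cyc rmorphM /= rmorphB /= horner_mx_X horner_mx_C mulmxA.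
Qed.

Lemma cyc_MXaddC h c b : cyc (h * 'X + c%:P) b = cyc h b *m B + c *: unit_row b 0.
Proof.
rewrite /cyc rmorphD rmorphM /= horner_mx_X horner_mx_C mulmxDr mulmxA.
by rewrite mul_mx_scalar.
Qed.

Lemma cyc_out h b j : blk j != b -> cyc h b 0 j = 0.
Proof.
move: j; elim/poly_ind: h => [|h c IHh] j bj.
  by rewrite /cyc rmorph0 mulmx0 mxE.
rewrite cyc_MXaddC mxE mul_bidiag_entry IHh // mul0r add0r.
rewrite [(c *: unit_row b 0) 0 j]mxE unit_rowE (negbTE bj) mulr0 addr0.
by have [[j' [bj' _ ->]]|[_ ->]//] := mulmx_NP sz_n (cyc h b) 0 j; rewrite IHh ?bj'.
Qed.

(** The diagonal of the matrix affects only the positions below the degree; from the degree on the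
    entries are the coefficients of [h] themselves. *)
Lemma cyc_coef (h : {poly k}) b j : blk j = b -> (size h <= (off j).+1)%N ->
  cyc h b 0 j = h`_(off j).
Proof.
move: j; elim/poly_ind: h => [|h c IHh] j bj size_h.
  by rewrite /cyc rmorph0 mulmx0 mxE coef0.
have size_h' : (size h <= off j)%N.
  by move: size_h; rewrite size_MXaddC; case: eqP => [->|_]; rewrite ?size_poly0.
rewrite cyc_MXaddC mxE mul_bidiag_entry IHh ?(leq_trans size_h') //.
rewrite (nth_default _ size_h') mul0r add0r.
rewrite [(c *: unit_row b 0) 0 j]mxE unit_rowE bj eqxx /= coefD coefMX coefC.
have [[j' [bj' oj ->]]|[oj ->]] := mulmx_NP sz_n (cyc h b) 0 j.
  by rewrite IHh ?bj' -?oj // oj /= mulr0 !addr0.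
by rewrite oj eqxx /= mulr1.
Qed.

(** Each factor removes the diagonal term and moves the unit vector one step forward. When [t] is
    the size of the block the vector is zero, so the full product annihilates the generator. *)
Lemma cyc_prod b t : (t <= nth 0 sz b)%N ->
  cyc (\prod_(s <- iota 0 t) ('X - (al b s)%:P)) b = unit_row b t.
Proof.
elim: t => [|t IHt] le_t.
  by rewrite big_nil /cyc rmorph1 mulmx1.
rewrite -[X in iota 0 X]addn1 iotaD big_cat /= big_seq1 add0n cycM IHt; last exact: ltnW.
apply/rowP => j; rewrite /= mulmxBr mul_mx_scalar.
have -> : (unit_row b t *m B - al b t *: unit_row b t) 0 j =
    (unit_row b t *m B) 0 j - al b t * unit_row b t 0 j.
  by rewrite [LHS]mxE; congr (_ + _); rewrite !mxE.
rewrite mul_bidiag_entry !unit_rowE addrAC.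
have -> : ((blk j == b) && (off j == t))%:R * al (blk j) (off j) -
    al b t * ((blk j == b) && (off j == t))%:R = 0.
  by case: andP => [[/eqP -> /eqP ->]|_]; rewrite ?mul0r ?mulr0 ?subr0 // mul1r mulr1 subrr.
rewrite add0r; have [[j' [bj oj ->]]|[oj ->]] := mulmx_NP sz_n (unit_row b t) 0 j.
  by rewrite unit_rowE bj oj eqSS.
by rewrite oj andbF.
Qed.

Variable D : nat -> seq (k * nat).
Hypothesis D_uniq : forall b, uniq (map fst (D b)).
Hypothesis D_pos : forall b x, x \in D b -> (0 < x.2)%N.
Hypothesis D_perm : forall b, (b < size sz)%N ->
  perm_eq [seq al b s | s <- iota 0 (nth 0%N sz b)] (flatten [seq nseq x.2 x.1 | x <- D b]).

Lemma block_poly b : (b < size sz)%N ->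
  \prod_(s <- iota 0 (nth 0%N sz b)) ('X - (al b s)%:P) =
  \prod_(x <- D b) ('X - (x.1)%:P) ^+ x.2.
Proof.
move=> lt_b; rewrite -(big_map (al b) xpredT (fun z => 'X - z%:P)).
rewrite (perm_big _ (D_perm lt_b)) /= big_flatten big_map /=.
by apply: eq_bigr => x _; rewrite big_nseq iter_mulr_1.
Qed.

(** The block polynomial without its [x]-primary factor; applied to the generator it starts the
    Jordan chain of [x]. *)
Definition coblock b x : {poly k} := \prod_(y <- D b | y != x) ('X - (y.1)%:P) ^+ y.2.

Lemma coblock_mul b x : (b < size sz)%N -> x \in D b ->
  coblock b x * ('X - (x.1)%:P) ^+ x.2 =
  \prod_(s <- iota 0 (nth 0%N sz b)) ('X - (al b s)%:P).
Proof.
move=> lt_b xD; rewrite block_poly // (bigD1_seq x) //= 1?mulrC //.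
exact: map_uniq (D_uniq b).
Qed.

Lemma coblock_last b x : (b < size sz)%N -> x \in D b ->
  let h := coblock b x * ('X - (x.1)%:P) ^+ x.2.-1 in
  h \is monic /\ size h = nth 0%N sz b.
Proof.
move=> lt_b xD h.
have mh : h \is monic.
  apply: rpredM; last by apply: rpredX; apply: monicXsubC.
  by apply: rpred_prod => y _; apply: rpredX; apply: monicXsubC.
split=> //; have : size (h * ('X - (x.1)%:P)) = (nth 0%N sz b).+1.
  rewrite -mulrA -exprSr prednK ?(D_pos xD) // coblock_mul //.
  rewrite -(big_map (al b) xpredT (fun z => 'X - z%:P)) size_prod_XsubC.
  by rewrite size_map size_iota.
rewrite size_Mmonic ?monicXsubC ?monic_neq0 // size_XsubC addn2 /= => -[].
by [].
Qed.

(** The chain of [x] in block [b] starts at [coblock b x] and stops after [x.2] steps, when the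
    block polynomial is reached. Its last vector comes from a monic polynomial of degree one less
    than the block size, so its entry at the end of the block is 1, which separates the chains of
    one eigenvalue. *)
Lemma bidiag_similar bl : perm_eq bl (flatten [seq D b | b <- iota 0 (size sz)]) ->
  Defs.similar B (jordan_mx n.+1 bl).
Proof.
pose cs0 : seq (nat * (k * nat)) := [seq (b, x) | b <- iota 0 (size sz), x <- D b].
have Ecs0 : map snd cs0 = flatten [seq D b | b <- iota 0 (size sz)].
  by rewrite /cs0 map_flatten -map_comp; congr flatten; apply: eq_map => b /=;
     rewrite -map_comp map_id.
rewrite perm_sym -Ecs0 => /perm_map_lift [cs Pcs <-].
have cs_mem c : c \in cs -> (c.1 < size sz)%N /\ c.2 \in D c.1.
  rewrite (perm_mem Pcs) => /allpairsPdep [b [x [bin xD ->]]] /=.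
  by rewrite mem_iota in bin.
pose la (c : nat * (k * nat)) := c.2.1.
pose sc (c : nat * (k * nat)) := c.2.2.
pose v (c : nat * (k * nat)) := cyc (coblock c.1 c.2) c.1.
have -> : map snd cs = [seq (la c, sc c) | c <- cs].
  by apply: eq_map => c; rewrite /la /sc -surjective_pairing.
have chainE c s : chain B la v c s = cyc (coblock c.1 c.2 * ('X - (la c)%:P) ^+ s) c.1.
  elim: s => [|s IHs]; first by rewrite expr0 mulr1.
  by rewrite /chain iterS -/(chain B la v c s) IHs exprSr mulrA cycM.
have cs_uniq : uniq cs.
  rewrite (perm_uniq Pcs); apply: allpairs_uniq_dep; rewrite ?iota_uniq //.
    by move=> b _; exact: map_uniq (D_uniq b).
  by move=> [b x] [b' x'] _ _ [-> ->].
apply: (similar_of_chains (la := la) (sz := sc) (v := v)) => //.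
- rewrite (perm_sumn (perm_map sc Pcs)) -sz_n /cs0 map_flatten -map_comp.
  rewrite sumn_flatten -map_comp -[in RHS](mkseq_nth 0%N sz); congr sumn.
  apply/eq_in_map => b; rewrite mem_iota add0n => /andP [_ lt_b] /=.
  have := perm_size (D_perm lt_b); rewrite size_map size_iota size_flatten => ->.
  rewrite /shape -!map_comp; congr sumn; apply: eq_map => x /=.
  by rewrite size_nseq.
- move=> c /cs_mem [lt_b cD]; rewrite [LHS]chainE coblock_mul // cyc_prod //.
  apply/rowP => j; rewrite unit_rowE mxE; case: andP => // -[/eqP bj /eqP oj].
  by have := off_lt sz_n j; rewrite bj oj ltnn.
move=> mu u u0 c0 c0in lac0; have [lt_b c0D] := cs_mem c0 c0in.
have [mh size_h] := coblock_last lt_b c0D.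
have sz_gt0 : (0 < nth 0%N sz c0.1)%N by rewrite -size_h size_poly_gt0 monic_neq0.
have [|j bj oj] := @ex_blk_off _ sz sz_n c0.1 (nth 0%N sz c0.1).-1 lt_b.
  by rewrite prednK.
have /rowP/(_ j) := u0; rewrite summxE big_mkcond /= (bigD1_seq c0) //= lac0 eqxx.
rewrite mxE chainE cyc_coef //; last by rewrite size_h oj prednK.
rewrite big1_seq => [|c /andP [nc cin]].
  rewrite addr0 oj -size_h -lead_coefE (monicP mh) mulr1 => ->.
  by rewrite mxE.
(* A different chain with the same eigenvalue lies in another block, because the values in [D b] are
   distinct; it has no entry at [j]. *)
case: eqP => // lac; rewrite mxE chainE.
have [cb|ncb] := eqVneq (blk j) c.1; last by rewrite cyc_out ?mulr0.
case/eqP: nc; have [_ cD] := cs_mem c cin.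
have c1 : c.1 = c0.1 by rewrite -cb bj.
rewrite [c]surjective_pairing [c0]surjective_pairing -c1; congr (_, _).
rewrite -c1 in c0D; rewrite [LHS]surjective_pairing [RHS]surjective_pairing.
have /(nthP (0, 0%N)) [a a_lt Ea] := cD; have /(nthP (0, 0%N)) [a0 a0_lt Ea0] := c0D.
have Ela : c.2.1 = c0.2.1 by rewrite -/(la c) -/(la c0) lac lac0.
suff -> : c.2 = c0.2 by [].
rewrite -Ea -Ea0; congr nth; apply/eqP.
rewrite -(nth_uniq (0 : k) _ _ (D_uniq c.1)) ?size_map //.
by rewrite !(nth_map (0 : k, 0%N)) // Ea Ea0 Ela.
Qed.

End CyclicBlocks.

(** * Partitions *)

Section PartitionCounts.

Lemma count_gt_sorted (p : seq nat) j t : sorted geq p ->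
  (j < count (fun x => t < x)%N p)%N = (t < nth 0%N p j)%N.
Proof.
elim: p j => [|x p IHp] j; first by rewrite nth_nil.
rewrite /= => xp; have sp := path_sorted xp.
have geq_trans : transitive geq by move=> b a c /= ab bc; exact: leq_trans bc ab.
have le_x y : y \in p -> (y <= x)%N.
  by have /allP := order_path_min geq_trans xp; apply.
case: (ltnP t x) => tx; last first.
  rewrite add0n (_ : count _ p = 0%N); last first.
    apply/eqP; rewrite -leqn0 leqNgt -has_count; apply/hasPn => y /le_x yx.
    by rewrite -leqNgt (leq_trans yx).
  apply/esym/negbTE; rewrite -leqNgt; case: j => [|j] //=.
  case: (ltnP j (size p)) => [lt_j|ge_j]; last by rewrite nth_default.
  exact: leq_trans (le_x _ (mem_nth _ lt_j)) tx.
by case: j => [|j] //=; rewrite add1n ltnS IHp.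
Qed.

Lemma count_lt_iota a M : (a <= M)%N -> count (fun t => t < a)%N (iota 0 M) = a.
Proof.
move=> aM; rewrite -(subnKC aM) iotaD count_cat add0n.
rewrite (eq_in_count (a2 := predT)) ?count_predT ?size_iota => [|t]; last first.
  by rewrite mem_iota.
rewrite (eq_in_count (a2 := pred0)) ?count_pred0 ?addn0 // => t.
by rewrite mem_iota => /andP [at_ _] /=; rewrite ltnNge at_.
Qed.

Lemma count_columns (p : seq nat) M j : sorted geq p -> (nth 0%N p j <= M)%N ->
  count (fun t => j < count (fun x => t < x)%N p)%N (iota 0 M) = nth 0%N p j.
Proof.
move=> sp le_M; rewrite -[RHS](count_lt_iota le_M); apply: eq_count => t.
exact: count_gt_sorted.
Qed.

Lemma nth_le_maxn (p : seq nat) j : (nth 0%N p j <= foldr maxn 0%N p)%N.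
Proof.
elim: p j => [|x p IHp] [|j] //=; rewrite ?leq_maxl //.
exact: leq_trans (IHp j) (leq_maxr _ _).
Qed.

Lemma nth_le_sumn (p : seq nat) j : (nth 0%N p j <= sumn p)%N.
Proof.
elim: p j => [|x p IHp] [|j] //=; rewrite ?leq_addr //.
exact: leq_trans (IHp j) (leq_addl _ _).
Qed.

Lemma count_ptranspose (p : seq nat) j : sorted geq p ->
  count (fun x => j < x)%N (ptranspose p) = nth 0%N p j.
Proof. by move=> sp; rewrite count_map; apply: count_columns (nth_le_maxn _ _). Qed.

Lemma ptranspose_pos (p : seq nat) : all (fun x => 0 < x)%N (ptranspose p).
Proof.
apply/allP => x /mapP [t]; rewrite mem_iota add0n => /andP [_ lt_t] -> {x}.
rewrite -has_count; elim: p lt_t => //= x p IHp.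
by rewrite leq_max => /orP [->//|/IHp ->]; rewrite orbT.
Qed.

(** The multiplicity of a positive value is the difference of two consecutive tail counts. *)
Lemma perm_pos_count (s s' : seq nat) :
  (forall j, count (fun x => j < x)%N s = count (fun x => j < x)%N s') ->
  perm_eq [seq x <- s | 0 < x]%N [seq x <- s' | 0 < x]%N.
Proof.
move=> E; rewrite /perm_eq; apply/allP => y _; apply/eqP.
rewrite /= !count_filter; case: y => [|y].
  by rewrite !(eq_count (a2 := pred0)) ?count_pred0 // => -[].
have split (q : seq nat) : count (fun x => y < x)%N q =
    (count (predI (pred1 y.+1) (fun x => 0 < x)%N) q + count (fun x => y.+1 < x)%N q)%N.
  rewrite -count_predUI (eq_count (a2 := fun x => y < x)%N) => [|x /=]; last by lia.
  by rewrite (eq_count (a1 := predI _ _) (a2 := pred0)) ?count_pred0 ?addn0 // => x /=; lia.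
by have := E y; rewrite !split E => /addIn ->.
Qed.

Lemma nth_psum p q j : nth 0%N (psum p q) j = (nth 0 p j + nth 0 q j)%N.
Proof. by elim: p q j => [|a p IHp] [|b q] [|j] //=; rewrite ?addn0. Qed.

Lemma size_psum p q : size (psum p q) = maxn (size p) (size q).
Proof. by elim: p q => [|a p IHp] [|b q] //=; rewrite IHp maxnSS. Qed.

Lemma sumn_psum p q : sumn (psum p q) = (sumn p + sumn q)%N.
Proof. by elim: p q => [|a p IHp] [|b q] //=; rewrite ?addn0 // IHp addnACA. Qed.

Lemma nth_sorted_geq (p : seq nat) i : sorted geq p -> (nth 0%N p i.+1 <= nth 0%N p i)%N.
Proof.
move=> sp; case: (ltnP i.+1 (size p)) => [lt_i|ge_i]; last by rewrite nth_default.
by have /(sortedP 0%N)/(_ i lt_i) := sp.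
Qed.

Lemma is_partition_psum p q :
  is_partition p -> is_partition q -> is_partition (psum p q).
Proof.
move=> /andP [sp /(all_nthP 0%N) pp] /andP [sq /(all_nthP 0%N) pq]; apply/andP; split.
  apply/(sortedP 0%N) => i _ /=; rewrite !nth_psum.
  by apply: leq_add; apply: nth_sorted_geq.
apply/(all_nthP 0%N) => i; rewrite size_psum leq_max nth_psum addn_gt0.
by move=> /orP [/pp|/pq] /= ->; rewrite ?orbT.
Qed.

Variables (m : nat) (Delta : 'I_m -> seq nat).
Hypothesis Dpart : forall i, is_partition (Delta i).

Lemma nth_SigmaD j : nth 0%N (SigmaD Delta) j = (\sum_(i < m) nth 0 (Delta i) j)%N.
Proof.
rewrite /SigmaD -[RHS]big_enum /=.
elim: (enum 'I_m) => [|i s IHs] /=; first by rewrite nth_nil big_nil.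
by rewrite big_cons nth_psum IHs.
Qed.

Lemma sumn_SigmaD : sumn (SigmaD Delta) = (\sum_(i < m) sumn (Delta i))%N.
Proof.
rewrite /SigmaD -[RHS]big_enum /=.
elim: (enum 'I_m) => [|i s IHs] /=; first by rewrite big_nil.
by rewrite big_cons sumn_psum IHs.
Qed.

Lemma is_partition_SigmaD : is_partition (SigmaD Delta).
Proof.
rewrite /SigmaD; elim: (enum 'I_m) => //= i s IHs.
exact: is_partition_psum.
Qed.

Lemma size_SigmaD_geq i : (size (Delta i) <= size (SigmaD Delta))%N.
Proof.
have := mem_enum 'I_m i; rewrite /SigmaD; elim: (enum 'I_m) => //= i' s IHs.
rewrite size_psum inE leq_max; case: eqP => [->|_ /IHs ->]; rewrite ?leqnn ?orbT //.
Qed.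

End PartitionCounts.

(** * Invariants of a Jordan matrix from its partitions *)

Section Invariants.
Variables (k : closedFieldType) (n : nat).

(** The cyclic description of a Jordan matrix, one eigenvalue per block, yields its blocks in any
    order. *)
Lemma jordan_perm (bl bl' : seq (k * nat)) :
  sumn (map snd bl) = n.+1 -> (forall x, x \in bl -> 0 < x.2)%N ->
  perm_eq bl' bl -> Defs.similar (jordan_mx n.+1 bl) (jordan_mx n.+1 bl').
Proof.
move=> sz_n bl_pos Pbl.
pose x0 : k * nat := (0, 0%N).
pose D b := if (b < size bl)%N then [:: nth x0 bl b] else [::].
rewrite jordan_mxE //.
apply: (@bidiag_similar k n (map snd bl) sz_n (fun b _ => (nth x0 bl b).1) D) => //.
- by move=> b; rewrite /D; case: ifP.
- move=> b x; rewrite /D; case: ifP => // lt_b; rewrite inE => /eqP ->.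
  by apply: bl_pos; apply: mem_nth.
- move=> b; rewrite size_map => lt_b; rewrite /D lt_b /= cats0 (nth_map x0) //.
  by elim: ((nth x0 bl b).2) (0%N) => //= q IHq s; rewrite perm_cons.
rewrite size_map (_ : flatten _ = bl) //.
rewrite -[RHS](mkseq_nth x0) /mkseq -[RHS]flatten_seq1 -map_comp; congr flatten.
by apply/eq_in_map => b; rewrite mem_iota add0n /D /= => ->.
Qed.

Section Form.
Variables (m : nat) (Delta : 'I_m -> seq nat) (lam : 'I_m -> k).
Hypothesis Dpart : forall i, is_partition (Delta i).
Hypothesis Dsum : (\sum_(i < m) sumn (Delta i))%N = n.+1.
Hypothesis lam_inj : injective lam.

Definition jblocks : seq (k * nat) :=
  flatten [seq [seq (lam i, s) | s <- Delta i] | i <- enum 'I_m].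

Lemma jblocks_sum : sumn (map snd jblocks) = n.+1.
Proof.
rewrite -Dsum map_flatten -map_comp sumn_flatten -map_comp.
rewrite -[RHS]big_enum /= sumnE big_map.
by apply: eq_bigr => i _ /=; rewrite -map_comp map_id.
Qed.

Lemma jblocks_pos x : x \in jblocks -> (0 < x.2)%N.
Proof.
case/flattenP => _ /mapP [i _ ->] /mapP [s sD ->] /=.
by have /andP [_ /allP] := Dpart i; apply.
Qed.

Lemma count_jblocks i t : count (fun x => (x.1 == lam i) && (t < x.2)%N) jblocks =
  count (fun s => t < s)%N (Delta i).
Proof.
rewrite count_flatten -map_comp sumnE big_map big_enum /= (bigD1 i) //=.
rewrite count_map big1 ?addn0 => [|j nj].
  by apply: eq_count => s /=; rewrite eqxx.
by rewrite count_map (eq_count (a2 := pred0)) ?count_pred0 // => s /=; rewrite (inj_eq lam_inj) (negbTE nj).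
Qed.

(** The levels of [lam i] are the columns of [Delta i], and the columns longer than [j] number the
    [j]-th part; summing over [i] gives the [j]-th part of [SigmaD Delta], whatever the eigenvalues
    are. *)
Lemma count_level_sizes bl j : perm_eq bl jblocks ->
  count (fun x => j < x)%N
    (level_sizes n.+1 (map snd bl) (fun b => (nth (0 : k, 0%N) bl b).1)) =
  (\sum_(i < m) nth 0 (Delta i) j)%N.
Proof.
move=> Pbl; pose x0 : k * nat := (0, 0%N); pose lamb b := (nth x0 bl b).1.
have sz_n : sumn (map snd bl) = n.+1 by rewrite (perm_sumn (perm_map snd Pbl)) jblocks_sum.
have inE' mu t : in_level (map snd bl) lamb [set: 'I_n.+1] (mu, t) =
    count (fun x => (x.1 == mu) && (t < x.2)%N) jblocks.
  rewrite in_levelE // -(seq.permP Pbl) -[in RHS](mkseq_nth x0 bl) count_map size_map.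
  by apply: eq_in_count => b; rewrite mem_iota /= add0n => lt_b; rewrite (nth_map x0).
rewrite /level_sizes count_map /levels count_flatten -map_comp sumnE big_map /=.
rewrite size_map (_ : [seq lamb b | b <- iota 0 (size bl)] = map fst bl); last first.
  by rewrite -[in RHS](mkseq_nth x0 bl) -map_comp.
pose F mu := count (fun t => j < count (fun x => (x.1 == mu) && (t < x.2)%N) jblocks)%N
  (iota 0 n.+1).
rewrite (eq_bigr F) => [|mu _]; last first.
  rewrite count_map; transitivity (count (fun t => j <
    in_level (map snd bl) lamb [set: 'I_n.+1] (mu, t))%N (iota 0 n.+1)) => //.
  by apply: eq_count => t; rewrite inE'.
have F_lam i : F (lam i) = nth 0%N (Delta i) j.
  rewrite /F; under eq_count do rewrite count_jblocks.
  apply: count_columns; first by have /andP [] := Dpart i.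
  by apply: leq_trans (nth_le_sumn _ _) _; rewrite -Dsum (bigD1 i) //= leq_addr.
set mus := undup _.
have mus_lam mu : mu \in mus -> exists i, mu = lam i.
  rewrite mem_undup => /mapP [x]; rewrite (perm_mem Pbl) => /flattenP [_ /mapP [i _ ->]].
  by case/mapP => s _ -> ->; exists i.
have lam_mus i : lam i \notin mus -> Delta i = [::].
  move=> nlam; case E: (Delta i) => [|s D] //; case/negP: nlam.
  rewrite mem_undup; apply/mapP; exists (lam i, s) => //.
  rewrite (perm_mem Pbl); apply/flattenP; exists [seq (lam i, s) | s <- Delta i].
    by apply/mapP; exists i; rewrite ?mem_enum.
  by rewrite E map_f ?mem_head.
transitivity (\sum_(mu <- mus) \sum_(i < m) (lam i == mu) * F (lam i))%N.
  rewrite big_seq [RHS]big_seq; apply: eq_bigr => mu /mus_lam [i ->].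
  rewrite (bigD1 i) //= eqxx mul1n big1 ?addn0 // => i' ni.
  by rewrite (inj_eq lam_inj) (negbTE ni).
rewrite exchange_big /=; apply: eq_bigr => i _; rewrite F_lam -big_distrl /=.
case: (boolP (lam i \in mus)) => [lin|/lam_mus ->]; last by rewrite nth_nil muln0.
rewrite (bigD1_seq (lam i)) ?undup_uniq //= eqxx big1 ?mul1n // => mu.
by rewrite eq_sym => /negbTE ->.
Qed.

Lemma jblocks_invariants (A : 'M[k]_n.+1) ds :
  Defs.similar A (jordan_mx n.+1 jblocks) ->
  (forall j, count (fun x => j < x)%N ds = \sum_(i < m) nth 0 (Delta i) j)%N ->
  centralizer_dim A = (\sum_(x <- ds) x ^ 2)%N /\
  forall d r, max_achievable ds d r -> Grdim d (GrA d A) r.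
Proof.
move=> simA ds_count.
(* The selection of pivots by rank needs nonincreasing block sizes, so the blocks are sorted by size
   across all eigenvalues. *)
pose by_size (x y : k * nat) := (y.2 <= x.2)%N.
pose bl := sort by_size jblocks; pose lamb b := (nth (0 : k, 0%N) bl b).1.
have Pbl : perm_eq bl jblocks by rewrite perm_sort.
have sz_n : sumn (map snd bl) = n.+1 by rewrite (perm_sumn (perm_map snd Pbl)) jblocks_sum.
have sz_sorted : sorted geq (map snd bl).
  by rewrite sorted_map; apply: sort_sorted => x y; apply: leq_total.
have [P uP AE] : Defs.similar A (bidiag (map snd bl)
    (fun i : 'I_n.+1 => lamb (blk (map snd bl) i))).
  rewrite -jordan_mxE //; apply: similar_trans simA _.
  exact: jordan_perm jblocks_sum jblocks_pos Pbl.
have Pds : perm_eq [seq x <- level_sizes n.+1 (map snd bl) lamb | 0 < x]%N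
    [seq x <- ds | 0 < x]%N.
  by apply: perm_pos_count => j; rewrite ds_count count_level_sizes.
have sum_pos (s : seq nat) : (\sum_(x <- s) x ^ 2 = \sum_(x <- [seq x <- s | 0 < x]) x ^ 2)%N.
  rewrite big_filter (bigID (fun x => 0 < x)%N) /= [X in (_ + X)%N]big1 ?addn0 // => x.
  by rewrite -leqNgt leqn0 => /eqP ->.
split=> [|d r rmax].
  by rewrite (centralizer_dim_bidiag sz_n uP AE) sum_pos (perm_big _ Pds) -sum_pos.
apply: (GrA_Grdim sz_n uP AE sz_sorted); rewrite perm_sym in Pds.
exact: max_achievable_perm Pds rmax.
Qed.

End Form.
End Invariants.

(** * Degenerations *)

Section Degenerations.
Variable k : closedFieldType.

Lemma ex_uniq_seq N : exists2 s : seq k, uniq s & size s = N.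
Proof.
elim: N => [|N [s us ss]]; first by exists [::].
have [|t] := @exists_nonroot k (\prod_(z <- s) ('X - z%:P)).
  by rewrite monic_neq0 ?monic_prod_XsubC.
rewrite -rootE root_prod_XsubC => ts.
by exists (t :: s); rewrite /= ?ts ?us ?ss.
Qed.

(** A polynomial vanishing on [S] restricts to a one-variable polynomial whose product with [R]
    vanishes everywhere; since [R] is nonzero the restriction is zero, also at [t = 0]. *)
Lemma zclosure_curve n (S : 'M[k]_n -> Prop) (Bt : k -> 'M[k]_n) (R : {poly k}) :
  (forall i j, exists p : {poly k}, forall t, Bt t i j = p.[t]) -> R != 0 ->
  (forall t, R.[t] != 0 -> S (Bt t)) -> zclosure S (Bt 0).
Proof.
move=> polB R0 SB f pf f0.
have [q Eq] := polyfun_comp (horner_subalgebra k) polB pf.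
suff q0 : q = 0 by rewrite Eq q0 horner0.
have /eqP : q * R = 0.
  apply: horner_eq0 => t; rewrite hornerM -Eq.
  have [->|Rt] := eqVneq R.[t] 0; first by rewrite mulr0.
  by rewrite f0 ?mul0r //; apply: SB.
by rewrite mulf_eq0 (negbTE R0) orbF => /eqP.
Qed.

Lemma zclosure_bidiag n sz (a c : 'I_n -> k) (P : 'M[k]_n) (S : 'M[k]_n -> Prop)
    (R : {poly k}) : P \in unitmx -> R != 0 ->
  (forall A t, R.[t] != 0 ->
     Defs.similar A (bidiag sz (fun i => a i + t * c i)) -> S A) ->
  zclosure S (invmx P *m bidiag sz a *m P).
Proof.
move=> uP R0 SB.
pose Bt t := invmx P *m bidiag sz (fun i => a i + t * c i) *m P.
have -> : bidiag sz a = bidiag sz (fun i => a i + 0 * c i).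
  by congr bidiag; apply: functional_extensionality => i; rewrite mul0r addr0.
apply: (zclosure_curve (Bt := Bt) _ R0) => [i j|t Rt]; last first.
  by apply: SB Rt _; exists P.
pose S' (f : k -> k) := exists p : {poly k}, forall t, f t = p.[t].
have SS : subalgebra S' := horner_subalgebra k; have [Sc _ _] := SS.
suff SB' : forall i j, S' (fun t => bidiag sz (fun i => a i + t * c i) i j).
  apply: (subalgebra_mulmx (S := S') (G := fun _ => P) i j SS) => // {}i {}j.
  exact: (subalgebra_mulmx (S := S') (F := fun _ => invmx P)).
move=> {}i {}j; have [->|nij] := eqVneq i j.
  exists ((a j)%:P + 'X * (c j)%:P) => t.
  by rewrite mxE eqxx !hornerE.
exists (((blk sz i == blk sz j) && (off sz j == (off sz i).+1))%:R)%:P => t.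
by rewrite mxE (negbTE nij) hornerC.
Qed.

Section Form.
Variables (n m : nat) (Delta : 'I_m -> seq nat).
Hypothesis Dpart : forall i, is_partition (Delta i).
Hypothesis Dsum : (\sum_(i < m) sumn (Delta i))%N = n.+1.
Let Gamma := SigmaD Delta.

Lemma count_flattenE (T : Type) (S : eqType) (a : pred T) (f : S -> seq T) (s : seq S) :
  count a (flatten [seq f x | x <- s]) = (\sum_(x <- s) count a (f x))%N.
Proof. by rewrite count_flatten -map_comp sumnE big_map. Qed.

Lemma row_count (p : seq nat) N (g : pred nat) :
  all (fun x => 0 < x)%N p -> (size p <= N)%N ->
  (\sum_(j <- iota 0 N) ((0 < nth 0 p j) && g (nth 0 p j)) = count g p)%N.
Proof.
elim: p N => [|x p IHp] N /=; first by move=> _ _; rewrite big1 // => j _; rewrite nth_nil.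
case: N => // N /andP [x0 p0]; rewrite ltnS => le_N.
rewrite big_cons /= x0 /=; congr (_ + _)%N; rewrite -(IHp N) //.
by rewrite -/(iota 1 N) (iotaDl 1 0 N) big_map.
Qed.

(** Both sides sum [g] of the column index over the cells of the diagram of [p], once by columns and
    once by rows. *)
Lemma col_count (p : seq nat) N (g : nat -> nat) : all (fun x => x <= N)%N p ->
  (\sum_(c <- iota 0 N) count (fun x => c < x)%N p * g c =
   \sum_(x <- p) \sum_(c <- iota 0 x) g c)%N.
Proof.
elim: p => [|x p IHp] /=; first by rewrite big_nil big1.
case/andP=> xN /IHp E; rewrite big_cons -E.
under eq_bigr do rewrite mulnDl; rewrite big_split /=; congr (_ + _)%N.
rewrite -[in LHS](subnKC xN) iotaD big_cat /= add0n.
rewrite [X in (_ + X)%N](_ : _ = 0%N) ?addn0; last first.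
  rewrite big_seq big1 // => c; rewrite mem_iota => /andP [xc _].
  by rewrite ltnNge xc.
rewrite big_seq [RHS]big_seq; apply: eq_bigr => c.
by rewrite mem_iota /= add0n => ->; rewrite mul1n.
Qed.

Lemma iota_nth_map (T S : Type) (f : T -> nat) (g : T -> k) (F : nat -> k -> S) L :
  [seq F (nth 0%N (map f L) x) (nth 0 (map g L) x) | x <- iota 0 (size L)] =
  [seq F (f p) (g p) | p <- L].
Proof.
elim: L => //= p L IHL; congr cons.
by rewrite -/(iota 1 (size L)) (iotaDl 1 0 (size L)) -map_comp -IHL.
Qed.

(** The same blocks, grouped by their position [j] in the partitions instead of by eigenvalue: the
    sizes in group [j] add up to the [j]-th part of [Gamma]. *)
Lemma Gamma_blocks_perm (lam : 'I_m -> k) :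
  perm_eq (jblocks Delta lam) (flatten [seq
    [seq (lam i, nth 0%N (Delta i) j) | i <- enum 'I_m & (0 < nth 0 (Delta i) j)%N]
    | j <- iota 0 (size Gamma)]).
Proof.
apply/seq.permP => a; rewrite !count_flattenE.
transitivity (\sum_(j <- iota 0 (size Gamma)) \sum_(i <- enum 'I_m)
    ((0 < nth 0 (Delta i) j) && a (lam i, nth 0 (Delta i) j)))%N; last first.
  apply: eq_bigr => j _; rewrite count_map count_filter -sum1_count [RHS]big_mkcond.
  by apply: eq_bigr => i _ /=; rewrite andbC; case: (_ && _).
rewrite exchange_big /=; apply: eq_bigr => i _; rewrite count_map.
rewrite (@row_count (Delta i) _ (fun s => a (lam i, s))) ?size_SigmaD_geq //.
by have /andP [] := Dpart i.
Qed.

(** Block [j] has the sum of the [j]-th parts of the [Delta i] as its size. Giving the eigenvalue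
    [mu + t * ac i] as many diagonal places as that part of [Delta i] splits the block, for nonzero
    [t], into the corresponding Jordan blocks. *)
Lemma U_in_closure (A : 'M[k]_n.+1) : Uset Gamma A -> zclosure (@Xset k n.+1 m Delta) A.
Proof.
have /andP [_ Gpos] : is_partition Gamma by apply: is_partition_SigmaD.
have Gsum : sumn Gamma = n.+1 by rewrite sumn_SigmaD.
case=> mu [P uP ->].
have Esz : map snd [seq (mu, s) | s <- Gamma] = Gamma by rewrite -map_comp map_id.
have [s us ss] := ex_uniq_seq m.
pose ac (i : 'I_m) := nth 0 s i.
have ac_inj : injective ac.
  by move=> i j /eqP; rewrite nth_uniq ?ss // => /eqP; apply: val_inj.
(* The directions in which the diagonal entries of block [j] move. *)
pose row j := flatten [seq nseq (nth 0%N (Delta i) j) (ac i) | i <- enum 'I_m].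
have size_row j : size (row j) = nth 0%N Gamma j.
  rewrite size_flatten /shape -map_comp nth_SigmaD sumnE big_map big_enum /=.
  by apply: eq_bigr => i _; rewrite size_nseq.
rewrite jordan_mxE Esz //.
have -> : bidiag Gamma (fun i : 'I_n.+1 =>
    (nth (0, 0%N) [seq (mu, s) | s <- Gamma] (blk Gamma i)).1) =
    bidiag Gamma (fun _ : 'I_n.+1 => mu).
  congr bidiag; apply: functional_extensionality => i.
  by rewrite (nth_map 0%N) ?blk_lt.
apply: (zclosure_bidiag (c := fun i => nth 0 (row (blk Gamma i)) (off Gamma i))
  (R := 'X)) => //; first by rewrite polyX_eq0.
move=> B t; rewrite hornerX => t0 simB.
pose lam i := mu + t * ac i.
have lam_inj : injective lam by move=> i j /addrI/(mulfI t0)/ac_inj.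
exists lam; split=> //; apply: similar_trans simB _; rewrite -/(jblocks Delta lam).
apply: (@bidiag_similar k n Gamma Gsum (fun j s => mu + t * nth 0 (row j) s)
  (fun j => [seq (lam i, nth 0%N (Delta i) j) | i <- enum 'I_m & (0 < nth 0 (Delta i) j)%N])).
- move=> j; rewrite -map_comp map_inj_uniq; last exact: lam_inj.
  by rewrite filter_uniq ?enum_uniq.
- by move=> j x /mapP [i]; rewrite mem_filter => /andP [i0 _] ->.
- move=> j _; rewrite -map_comp.
  rewrite (_ : [seq mu + t * nth 0 (row j) s | s <- _] = [seq mu + t * z | z <- row j]); last first.
    by rewrite -[in RHS](mkseq_nth 0 (row j)) -map_comp size_row.
  rewrite /row map_flatten -map_comp; apply/seq.permP => a; rewrite !count_flattenE [RHS]big_filter.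
  rewrite [LHS](bigID (fun i => 0 < nth 0 (Delta i) j)%N) /= [X in (_ + X)%N]big1 ?addn0.
    by apply: eq_bigr => i _; rewrite map_nseq.
  by move=> i; rewrite -leqNgt leqn0 => /eqP ->.
exact: Gamma_blocks_perm.
Qed.

Definition columns : seq ('I_m * nat) :=
  [seq p <- [seq (i, c) | i <- enum 'I_m, c <- iota 0 n.+1]
     | (0 < count (fun x => p.2 < x) (Delta p.1))%N].

Definition column_size (p : 'I_m * nat) : nat := count (fun x => p.2 < x)%N (Delta p.1).

Lemma Delta_le i x : x \in Delta i -> (x <= n.+1)%N.
Proof.
move=> /(nthP 0%N) [j _ <-]; apply: leq_trans (nth_le_sumn _ _) _.
by rewrite -Dsum (bigD1 i) //= leq_addr.
Qed.

Lemma sum_columns (g : 'I_m * nat -> nat) :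
  (\sum_(p <- columns) column_size p * g p =
   \sum_(i < m) \sum_(c <- iota 0 n.+1) column_size (i, c) * g (i, c))%N.
Proof.
rewrite big_filter [LHS]big_mkcond big_allpairs_dep big_enum.
apply: eq_bigr => i _; apply: eq_bigr => c _; rewrite /column_size /=.
by case: posnP => // ->.
Qed.

(** The transpose of a sum of partitions is the union of their columns: both lists have the same
    tail counts, namely the parts of [Gamma]. *)
Lemma columns_perm : perm_eq (map column_size columns) (ptranspose Gamma).
Proof.
have /andP [Gsorted _] : is_partition Gamma by apply: is_partition_SigmaD.
have pos_id (s : seq nat) : all (fun x => 0 < x)%N s -> [seq x <- s | 0 < x]%N = s.
  by move/all_filterP.
rewrite -[X in perm_eq X _]pos_id; last first.
  by rewrite all_map; apply/allP => p; rewrite mem_filter => /andP [].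
rewrite -[X in perm_eq _ X]pos_id ?ptranspose_pos //.
apply: perm_pos_count => j; rewrite count_ptranspose // nth_SigmaD count_map.
rewrite count_filter count_flattenE big_enum; apply: eq_bigr => i _.
have /andP [si _] := Dpart i.
rewrite count_map -[RHS](@count_columns (Delta i) n.+1) //; last first.
  by apply: leq_trans (nth_le_sumn _ _) _; rewrite -Dsum (bigD1 i) //= leq_addr.
apply: eq_count => c /=; rewrite /column_size /=.
by case: (count _ _) => [|x]; rewrite ?andbT.
Qed.

(** The diagonal entry at offset [c] in a block of [lam i] is moved to [lam i + t * bc c]. For
    general [t] these values differ for different [(i, c)], and [(i, c)] occurs once for each part
    of [Delta i] larger than [c], so the multiplicities are the column lengths. *)
Lemma X_in_closure (A : 'M[k]_n.+1) :
  Xset Delta A -> zclosure (@Sset k n.+1 (ptranspose Gamma)) A.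
Proof.
case=> lam [lam_inj [P uP ->]]; rewrite -/(jblocks Delta lam).
set bl := jblocks Delta lam; pose x0 : k * nat := (0, 0%N).
have sz_n : sumn (map snd bl) = n.+1 by apply: jblocks_sum.
have [s us ss] := ex_uniq_seq n.+1; pose bc c := nth 0 s c.
have bc_inj c c' : (c < n.+1)%N -> (c' < n.+1)%N -> bc c = bc c' -> c = c'.
  by move=> lt_c lt_c' /eqP; rewrite nth_uniq ?ss // => /eqP.
rewrite jordan_mxE //.
pose pairs := [seq (i, c) | i <- enum 'I_m, c <- iota 0 n.+1].
(* The product of the differences of the moved eigenvalues as polynomials in [t]. Each factor is
   nonzero, since equal constant and linear coefficients would force the two pairs to be equal. *)
pose R : {poly k} := \prod_(p <- pairs) \prod_(p' <- pairs | p != p')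
  ((lam p.1 - lam p'.1)%:P + (bc p.2 - bc p'.2) *: 'X).
have pairsP p : p \in pairs -> (p.2 < n.+1)%N.
  by case/allpairsP => -[i c] [_ cin ->]; move: cin; rewrite mem_iota => /andP [].
apply: (zclosure_bidiag (c := fun i => bc (off (map snd bl) i)) (R := R)) => //.
  rewrite /R prodf_seq_neq0; apply/allP => p pin; rewrite implyTb.
  rewrite prodf_seq_neq0; apply/allP => p' pin'; apply/implyP => npp'.
  apply/eqP => E; have := congr1 (fun q : {poly k} => q`_0) E.
  have := congr1 (fun q : {poly k} => q`_1) E.
  rewrite !coefD !coefC !coefZ !coefX /= mulr1 mulr0 add0r addr0 ?coef0.
  move=> /eqP; rewrite subr_eq0 => /eqP /(bc_inj _ _ (pairsP _ pin) (pairsP _ pin')) E2.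
  move=> /eqP; rewrite subr_eq0 => /eqP /lam_inj E1.
  by case/eqP: npp'; rewrite [p]surjective_pairing [p']surjective_pairing E1 E2.
move=> B t Rt simB; pose ev (p : 'I_m * nat) := lam p.1 + t * bc p.2.
have ev_inj p p' : p \in pairs -> p' \in pairs -> ev p = ev p' -> p = p'.
  move=> pin pin' Ep; apply/eqP/negPn/negP => npp'; case/negP: Rt.
  rewrite /R horner_prod; apply/eqP.
  rewrite (big_rem p) //= horner_prod (big_rem p') //= npp'.
  rewrite !hornerE -[X in X * _ * _](_ : 0 = _) ?mul0r //.
  by move/eqP: Ep; rewrite /ev -subr_eq0 => /eqP <-; ring.
have pairs_uniq : uniq pairs.
  by apply: allpairs_uniq; rewrite ?enum_uniq ?iota_uniq // => -[? ?] [? ?].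
(* The columns are reordered so that their lengths follow the parts of the transpose one by one, as
   [Sset] requires. *)
have [L PL EL] := perm_map_lift columns_perm.
have L_pairs p : p \in L -> p \in pairs.
  by rewrite (perm_mem PL) mem_filter => /andP [].
have L_uniq : uniq L by rewrite (perm_uniq PL) filter_uniq.
have size_L : size L = size (ptranspose Gamma) by rewrite -EL size_map.
exists (fun x => nth 0 (map ev L) x); split.
  move=> x y; rewrite -!size_L => lt_x lt_y /eqP; rewrite nth_uniq ?size_map //.
    by move/eqP.
  by rewrite map_inj_in_uniq // => p p' /L_pairs pin /L_pairs; apply: ev_inj.
apply: similar_trans simB _.
pose al b s := (nth x0 bl b).1 + t * bc s.
pose D b := [seq (al b s, 1%N) | s <- iota 0 (nth 0%N (map snd bl) b)].
apply: (@bidiag_similar k n (map snd bl) sz_n al D).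
- move=> b; rewrite /D -map_comp; case: (ltnP b (size bl)) => [lt_b|ge_b]; last first.
    by rewrite nth_default ?size_map.
  have /flattenP [_ /mapP [i _ ->] /mapP [s0 s0D Eb]] := mem_nth x0 lt_b.
  rewrite (nth_map x0) // Eb /= map_inj_in_uniq ?iota_uniq // => c c'.
  rewrite !mem_iota !add0n /= => lt_c lt_c'; rewrite /al Eb /= => Ec.
  have mem_pairs d : (d < s0)%N -> (i, d) \in pairs.
    move=> lt_d; apply/allpairsP; exists (i, d); split; rewrite ?mem_enum //.
    by rewrite mem_iota add0n /= (leq_trans lt_d) // (Delta_le s0D).
  by have [] := ev_inj (i, c) (i, c') (mem_pairs _ lt_c) (mem_pairs _ lt_c') Ec.
- by move=> b x /mapP [c _ ->].
- by move=> b _; rewrite /D -[X in perm_eq X _]flatten_seq1 -!map_comp.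
have -> : flatten [seq nseq (nth 0%N (ptranspose Gamma) x) ((map ev L)`_x, 1%N)
    | x <- iota 0 (size (ptranspose Gamma))] =
    flatten [seq nseq (column_size p) (ev p, 1%N) | p <- L].
  rewrite -size_L -EL; congr flatten.
  exact: (iota_nth_map column_size ev (fun a z => nseq a (z, 1%N)) L).
apply/seq.permP => a; rewrite !count_flattenE.
transitivity (\sum_(p <- L) column_size p * a (ev p, 1%N))%N.
  by apply: eq_bigr => p _; rewrite count_nseq mulnC.
rewrite (perm_big _ PL) /= sum_columns size_map.
transitivity (\sum_(x <- bl) \sum_(c <- iota 0 x.2) a ((x.1 + t * bc c)%R, 1))%N; last first.
  rewrite -{1}[bl](mkseq_nth x0) big_map big_seq [RHS]big_seq; apply: eq_bigr => b.
  rewrite mem_iota add0n => /andP [_ lt_b]; rewrite count_map (nth_map x0) //.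
  by rewrite -sum1_count [RHS]big_mkcond; apply: eq_bigr => c _ /=; case: (a _).
rewrite big_flatten big_map big_enum; apply: eq_bigr => i _.
rewrite big_map -(@col_count (Delta i) n.+1 (fun c => nat_of_bool (a (ev (i, c), 1%N)))) //.
by apply/allP => x /Delta_le.
Qed.

End Form.
End Degenerations.

Lemma sumn_ptranspose (p : seq nat) : sumn (ptranspose p) = sumn p.
Proof.
rewrite sumnE big_map (eq_bigr (fun c => count (fun x => c < x) p * 1)%N) => [|c _]; last first.
  by rewrite muln1.
rewrite col_count.
  by rewrite sumnE; apply: eq_bigr => x _; rewrite sum1_size size_iota.
by apply/allP => x /(nthP 0%N) [j _ <-]; apply: nth_le_maxn.
Qed.

(** * The invariants of the unipotent type and semisimple families *)

Section Families.
Variables (k : closedFieldType) (n : nat) (Gamma : seq nat).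
Hypothesis Gpart : is_partition Gamma.
Hypothesis Gsum : sumn Gamma = n.+1.

Definition has_invariants (A : 'M[k]_n.+1) : Prop :=
  centralizer_dim A = (\sum_(x <- ptranspose Gamma) x ^ 2)%N /\
  forall d r, max_achievable (ptranspose Gamma) d r -> Grdim d (GrA d A) r.

Lemma Uset_invariants A : Uset Gamma A -> has_invariants A.
Proof.
case=> mu simA.
apply: (@jblocks_invariants k n 1 (fun _ => Gamma) (fun _ => mu)) => //.
- by rewrite big_ord1.
- by move=> i j _; rewrite !ord1.
- suff -> : jblocks (fun _ : 'I_1 => Gamma) (fun _ => mu) = [seq (mu, s) | s <- Gamma] by [].
  by rewrite /jblocks enum_ordSl /= (size0nil (size_enum_ord 0)) /= cats0.
- by move=> j; rewrite big_ord1 count_ptranspose //; case/andP: Gpart.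
Qed.

Lemma Sset_invariants A : Sset (ptranspose Gamma) A -> has_invariants A.
Proof.
case=> lam [lam_inj simA]; set N := size (ptranspose Gamma) in lam_inj simA.
(* A semisimple matrix has partitions consisting of ones; their sum has as its [j]-th part the
   number of eigenspaces of dimension larger than [j]. *)
pose Delta (i : 'I_N) := nseq (nth 0%N (ptranspose Gamma) i) 1%N.
have sum_nth (F : nat -> nat) :
    (\sum_(i < N) F (nth 0 (ptranspose Gamma) i) = \sum_(x <- ptranspose Gamma) F x)%N.
  by rewrite (big_nth 0%N) big_mkord.
apply: (@jblocks_invariants k n N Delta (fun i => lam i)).
- move=> i; rewrite /is_partition /Delta; elim: (nth _ _ _) => //= -[|a] //=.
- rewrite -[RHS]Gsum -sumn_ptranspose sumnE -(sum_nth id).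
  by apply: eq_bigr => i _; rewrite sumn_nseq mul1n.
- by move=> i j /(lam_inj _ _ (ltn_ord i) (ltn_ord j))/val_inj.
- suff -> : jblocks Delta (fun i : 'I_N => lam i) =
      flatten [seq nseq (nth 0%N (ptranspose Gamma) i) (lam i, 1%N) | i <- iota 0 N] by [].
  rewrite /jblocks -val_enum_ord -map_comp; congr flatten; apply: eq_map => i /=.
  by rewrite map_nseq.
- move=> j; rewrite -sum1_count big_mkcond /= -(sum_nth (fun x => if j < x then 1 else 0)%N).
  by apply: eq_bigr => i _; rewrite nth_nseq.
Qed.

End Families.

Theorem theorem2p2 (k : closedFieldType) (n m : nat)
    (Delta : 'I_m -> seq nat) :
  (0 < n)%N ->
  (forall i, is_partition (Delta i) /\ Delta i <> [::]) ->
  (\sum_(i < m) sumn (Delta i))%N = n ->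
  let Gamma := SigmaD Delta in
  let Gamma' := ptranspose Gamma in
  let inU (A : 'M[k]_n) :=
    Sset Gamma' A \/ Xset Delta A \/ Uset Gamma A in
  (forall A, Xset Delta A -> zclosure (@Sset k n Gamma') A) /\
  (forall A, Uset Gamma A -> zclosure (@Xset k n m Delta) A) /\
  (forall A, inU A ->
     centralizer_dim A = (\sum_(x <- Gamma') x ^ 2)%N) /\
  (forall d, (1 <= d < n)%N ->
     exists r, forall A, inU A -> Grdim d (GrA d A) r).
Proof.
case: n => // n _ Dpart Dsum Gamma Gamma' inU.
have Dpart' i : is_partition (Delta i) by case: (Dpart i).
have Gpart : is_partition Gamma by apply: is_partition_SigmaD.
have Gsum : sumn Gamma = n.+1 by rewrite sumn_SigmaD.
have inv A : inU A -> has_invariants Gamma A.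
  case=> [|[[lam [lam_inj simA]]|]]; first exact: Sset_invariants.
    apply: (jblocks_invariants Dpart' Dsum lam_inj simA) => j.
    by rewrite count_ptranspose ?nth_SigmaD //; case/andP: Gpart.
  exact: Uset_invariants.
split; first by move=> A; apply: X_in_closure.
split; first by move=> A; apply: U_in_closure.
split=> [A /inv []//|d /andP [_ lt_d]].
(* The dimension is the maximum determined by [Gamma'] and [d] alone, chosen before the matrix. *)
have [|r rmax] := @ex_max_achievable Gamma' d.
  by rewrite sumn_ptranspose Gsum ltnW.
by exists r => A /inv [_]; apply.
Qed.
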